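(* Let $f=f^+-f^-\in L^\infty(\mathbb{R}^n)$ have compact support $S_f$ and satisfy $\int_{\mathbb{R}^n} f\,dx=0$, let $\Omega\subset\mathbb{R}^n$ be a convex bounded domain with $\Omega\supset \operatorname{conv} S_f$, let $n<p<+\infty$, and let $\lambda,\delta>0$. Let $\mu^0\in\mathscr M_0$ and let $[0,+\infty)\ni t\mapsto\mu(t;\mu^0)$ be the solution of the $L^2(\Omega)$ gradient flow of $\mathcal E_{\lambda,\delta}$ starting at $\mu^0$. Then $$\lim_{t\to+\infty}\|\mu(t;\mu^0)-\mu^*_{\lambda,\delta}\|_{W^{1,p}}=0\qquad\forall\mu^0\in\mathscr M_0,$$ where $\mu^*_{\lambda,\delta}:=\operatorname{argmin}_{\mu\in\mathscr M_0}\mathcal E_{\lambda,\delta}(\mu)$.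
   Context: $\mathscr M_0:=\{\mu\in W^{1,p}_0(\Omega):\mu(x)\ge0\ \forall x\in\Omega\}$, $\mathscr U:=\{u\in H^1(\Omega):\int_\Omega u\,dx=0\}$. The functional $\mathcal E_{\lambda,\delta}:L^2(\Omega)\to\mathbb{R}\cup\{+\infty\}$ is $$\mathcal E_{\lambda,\delta}(\mu):=\sup_{u\in\mathscr U}\left(2\int_\Omega fu\,dx-\int_\Omega(\mu+\lambda)|\nabla u|^2dx\right)+\int_\Omega\mu\,dx+\delta\|\nabla\mu\|_{L^p(\Omega)}^p\quad\text{if }\mu\in\mathscr M_0,$$ and $+\infty$ otherwise; it is strictly convex and has a unique minimizer. $\partial\mathcal E_{\lambda,\delta}(\mu)=\{\xi\in L^2(\Omega):\mathcal E_{\lambda,\delta}(\nu)-\mathcal E_{\lambda,\delta}(\mu)\ge\langle\xi;\nu-\mu\rangle\ \forall\nu\in L^2(\Omega)\}$ is the convex subdifferential in $L^2(\Omega)$ and $\partial^\circ\mathcal E_{\lambda,\delta}(\mu)$ is its element of minimal $L^2$ norm. The gradient flow is the unique absolutely continuous (on bounded time intervals), a.e. differentiable curve $\mu(\cdot;\mu^0):[0,+\infty)\to L^2(\Omega)$ with $\mu'(t)=-\partial^\circ\mathcal E_{\lambda,\delta}(\mu(t))$ for a.e. $t>0$ and $\mu(0)=\mu^0$. The paper writes this flow as the PDE system $$\tfrac{d}{dt}\mu=[|\nabla u|^2-1+\delta p\,\Delta_p\mu]\chi_{\{\mu>0\}}+[(|\nabla u|^2-1)\chi_{\{\mu=0\}}]^+,\qquad-\operatorname{div}((\mu+\lambda)\nabla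 u)=f\ \text{ in }\Omega,$$ with $\mu=0$ and $\partial_nu=0$ on $\partial\Omega$, $\int_\Omega u\,dx=0$, $\mu(0,\cdot)=\mu^0$. *)

(* Defs.v *)
From HB Require Import structures.
From mathcomp Require Import all_boot all_order all_algebra.
From mathcomp Require Import all_classical all_reals all_analysis.

Set Implicit Arguments.
Unset Strict Implicit.
Unset Printing Implicit Defensive.

Import Order.TTheory GRing.Theory Num.Theory.
Import numFieldNormedType.Exports.

Local Open Scope classical_set_scope.
Local Open Scope ring_scope.

(* Lebesgue measure on R^n is built by iterated products on [n.-tuple R], where
   the library already provides the product sigma-algebra, and then transported
   to ['rV[R]_n], which carries the topology and the differential calculus; see
   [lebesgue_rV_box]. *)

Section tuple_cons.
Context d (T : measurableType d) (n : nat).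

Definition tuple_cons (x : T * n.-tuple T) : n.+1.-tuple T :=
  [tuple of x.1 :: x.2].

Lemma measurable_tuple_cons : measurable_fun [set: T * n.-tuple T] tuple_cons.
Proof. by apply: measurable_cons; [exact: measurable_fst|exact: measurable_snd]. Qed.

HB.instance Definition _ :=
  isMeasurableFun.Build _ _ _ _ tuple_cons measurable_tuple_cons.

End tuple_cons.

Section measure_cons.
Context d (T : measurableType d) (R : realType) (n : nat).
Variable m1 : {sigma_finite_measure set T -> \bar R}.
Variable m2 : {sigma_finite_measure set (n.-tuple T) -> \bar R}.

Definition measure_cons : set (n.+1.-tuple T) -> \bar R :=
  pushforward (m1 \x m2)%E (@tuple_cons _ T n).

Let measure_cons0 : measure_cons set0 = 0%E.
Proof. exact: measure0. Qed.

Let measure_cons_ge0 A : (0 <= measure_cons A)%E.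
Proof. exact: measure_ge0. Qed.

Let measure_cons_sigma_additive : semi_sigma_additive measure_cons.
Proof. exact: measure_semi_sigma_additive. Qed.

HB.instance Definition _ := isMeasure.Build _ _ _ measure_cons
  measure_cons0 measure_cons_ge0 measure_cons_sigma_additive.

Let measure_cons_sigma_finite : sigma_finite setT measure_cons.
Proof.
have /sigma_finiteP[F [TF ndF Foo]] := sigma_finiteT m1.
have /sigma_finiteP[G [TG ndG Goo]] := sigma_finiteT m2.
pose g (t : n.+1.-tuple T) := (thead t, [tuple of behead t]).
have gK : cancel (@tuple_cons _ T n) g.
  by move=> [x t]; rewrite /g theadE; congr pair; exact/val_inj.
have mg : measurable_fun setT g.
  apply/measurable_fun_pairP; split; first exact: measurable_tnth.
  exact: measurable_behead.
exists (fun k => g @^-1` (F k `*` G k)).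
  apply/esym; rewrite -subTset => t _.
  have [i _ Fi] : (\bigcup_i F i) (g t).1 by rewrite -TF.
  have [j _ Gj] : (\bigcup_i G i) (g t).2 by rewrite -TG.
  exists (maxn i j) => //; split => /=.
    by move: Fi; exact/subsetPset/ndF/leq_maxl.
  by move: Gj; exact/subsetPset/ndG/leq_maxr.
move=> k; have [mF Fk] := Foo k; have [mG Gk] := Goo k; split.
  by rewrite -[X in measurable X]setTI; apply: mg => //; exact: measurableX.
rewrite /measure_cons /pushforward.
rewrite (_ : _ @^-1` _ = F k `*` G k).
  by rewrite product_measure1E// lte_mul_pinfty// ge0_fin_numE.
by rewrite -comp_preimage (_ : g \o _ = id)// funeqE => x /=; rewrite gK.
Qed.

HB.instance Definition _ := Measure_isSigmaFinite.Build _ _ _ measure_cons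
  measure_cons_sigma_finite.

End measure_cons.

Fixpoint lebesgue_tuple (R : realType) (n : nat) :
    {sigma_finite_measure set (n.-tuple (measurableTypeR R)) -> \bar R} :=
  match n with
  | 0 => dirac [tuple]
  | m.+1 => measure_cons lebesgue_measure (lebesgue_tuple R m)
  end.

Section lebesgue_rV.
Variables (R : realType) (n : nat).

Definition tuple_of_row (x : 'rV[R]_n) : n.-tuple (measurableTypeR R) :=
  [tuple x ord0 i | i < n].

Definition row_of_tuple (t : n.-tuple (measurableTypeR R)) : 'rV[R]_n :=
  \row_i tnth t i.

Lemma row_of_tupleK : cancel row_of_tuple tuple_of_row.
Proof. by move=> t; apply: eq_from_tnth => i; rewrite tnth_mktuple mxE. Qed.

(* The sigma-algebra on R^n generated by the coordinates, i.e. the Borel one. *)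
HB.instance Definition _ :=
  Measurable.copy 'rV[R]_n (g_sigma_algebra_preimageType tuple_of_row).

Lemma measurable_row_of_tuple : measurable_fun setT row_of_tuple.
Proof.
move=> _ _ [B mB <-]; rewrite !setTI -comp_preimage.
by rewrite (_ : _ \o _ = id)// funeqE => t; exact: row_of_tupleK.
Qed.

HB.instance Definition _ :=
  isMeasurableFun.Build _ _ _ _ row_of_tuple measurable_row_of_tuple.

Definition lebesgue_rV : set 'rV[R]_n -> \bar R :=
  pushforward (lebesgue_tuple R n) row_of_tuple.

Let lebesgue_rV0 : lebesgue_rV set0 = 0%E.
Proof. exact: measure0. Qed.

Let lebesgue_rV_ge0 A : (0 <= lebesgue_rV A)%E.
Proof. exact: measure_ge0. Qed.

Let lebesgue_rV_sigma_additive : semi_sigma_additive lebesgue_rV.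
Proof. exact: measure_semi_sigma_additive. Qed.

HB.instance Definition _ := isMeasure.Build _ _ _ lebesgue_rV
  lebesgue_rV0 lebesgue_rV_ge0 lebesgue_rV_sigma_additive.

End lebesgue_rV.

Lemma lebesgue_tuple_box (R : realType) (n : nat)
    (A : 'I_n -> set (measurableTypeR R)) :
  (forall i, measurable (A i)) ->
  lebesgue_tuple R n [set t | forall i, A i (tnth t i)] =
  (\prod_(i < n) lebesgue_measure (A i))%E.
Proof.
elim: n A => [|n IHn] A mA.
  rewrite big_ord0 /= diracE mem_set//; by case.
rewrite big_ord_recl -IHn//.
rewrite -product_measure1E//; last first.
  rewrite (_ : [set _ | _] = \bigcap_(i in [set: 'I_n])
      ((fun t : n.-tuple (measurableTypeR R) => tnth t i) @^-1` A (lift ord0 i))).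
    apply: fin_bigcap_measurable => // i _.
    by rewrite -[X in measurable X]setTI; exact: measurable_tnth.
  by apply/seteqP; split => t /=; [move=> h i _; exact: h|move=> h i; exact: h].
rewrite /= /measure_cons /pushforward; congr (product_measure1 _ _ _).
apply/seteqP; split => -[x t] /=.
  move=> h; split; first by have := h ord0; rewrite tnth0.
  by move=> i; have := h (lift ord0 i); rewrite tnthS.
move=> [h0 h] i; case: (unliftP ord0 i) => [j ->|->]; last by rewrite tnth0.
by rewrite tnthS; exact: h.
Qed.

Lemma lebesgue_rV_box (R : realType) (n : nat) (A : 'I_n -> set R) :
  (forall i, measurable (A i : set (measurableTypeR R))) ->
  lebesgue_rV [set x : 'rV[R]_n | forall i, A i (x ord0 i)] =
  (\prod_(i < n) lebesgue_measure (A i))%E.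
Proof.
move=> mA; rewrite -lebesgue_tuple_box// /lebesgue_rV /pushforward.
congr (lebesgue_tuple _ _ _); apply/seteqP.
by split => t /= h i; have := h i; rewrite mxE.
Qed.

(* Elements of the function spaces over [Om] are represented by functions on
   the whole of R^n, of which only the restriction to [Om] matters; [u \_ Om]
   is the extension by zero of that restriction. *)

Section sobolev.
Variables (R : realType) (n : nat).
Local Notation Rn := 'rV[R]_n.
Local Notation leb := (@lebesgue_rV R n).
Implicit Types (Om : set Rn) (u : Rn -> R) (G : Rn -> Rn) (p : R).

(* The norm of ['rV[R]_n] in the library is the sup norm. *)
Definition enorm (v : Rn) : R := Num.sqrt (\sum_(i < n) v ord0 i ^+ 2).

Definition partial (i : 'I_n) u : Rn -> R :=
  fun x => 'D_(delta_mx ord0 i) u x.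

Definition iter_partial (s : seq 'I_n) u : Rn -> R := foldr partial u s.

Definition smooth u : Prop := forall s : seq 'I_n,
  continuous (iter_partial s u) /\
  forall i x, derivable (iter_partial s u) x (delta_mx ord0 i).

Definition test_function Om : set (Rn -> R) :=
  [set phi | smooth phi /\
    exists K : set Rn, [/\ compact K, K `<=` Om & forall x, ~ K x -> phi x = 0]].

Definition loc_integrable Om u : Prop :=
  forall K : set Rn, compact K -> K `<=` Om -> leb.-integrable K (EFin \o u).

Definition is_weak_grad Om u G : Prop :=
  [/\ loc_integrable Om u,
      forall i, loc_integrable Om (fun x => G x ord0 i) &
      forall phi, test_function Om phi -> forall i,
        (\int[leb]_(x in Om) (u x * partial i phi x) =
         - \int[leb]_(x in Om) (G x ord0 i * phi x))%R].

(* A weak gradient is unique up to a Lebesgue-null subset of [Om]; one is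
   selected here. *)
Definition wgrad Om u : Rn -> Rn := xget (cst 0) (is_weak_grad Om u).

Definition Lp Om p : set (Rn -> R) := [set u | u \_ Om \in Lfun leb p%:E].

Definition Lp_norm Om p u : \bar R := 'N[leb]_(p%:E)[EFin \o (u \_ Om)].

Definition Sobolev Om p : set (Rn -> R) :=
  [set u | [/\ Lp Om p u, exists G, is_weak_grad Om u G &
    forall i, Lp Om p (fun x => wgrad Om u x ord0 i)]].

Definition Lp_norm_grad Om p u : \bar R :=
  Lp_norm Om p (fun x => enorm (wgrad Om u x)).

(* Set to [+oo] outside of W^{1,p}(Om), where [wgrad] may be a default value: a finite
   norm entails membership in W^{1,p}(Om). *)
Definition Sobolev_norm Om p u : \bar R :=
  if `[< Sobolev Om p u >]
  then ((Lp_norm Om p u `^ p + Lp_norm_grad Om p u `^ p) `^ p^-1)%E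
  else +oo%E.

(* W^{1,p}_0(Om), the closure of the test functions in W^{1,p}(Om) *)
Definition Sobolev0 Om p : set (Rn -> R) :=
  [set u | Sobolev Om p u /\
    forall e : R, 0 < e -> exists2 phi, test_function Om phi &
      (Sobolev_norm Om p (u \- phi)%R < e%:E)%E].

End sobolev.

Section gradient_flow.
Variables (R : realType) (n : nat) (Om : set 'rV[R]_n).
Local Notation Rn := 'rV[R]_n.
Local Notation leb := (@lebesgue_rV R n).
Implicit Types (E : (Rn -> R) -> \bar R) (mu nu xi : Rn -> R)
  (c : R -> Rn -> R).

Definition dotL2 xi nu : R := (\int[leb]_(x in Om) (xi x * nu x))%R.

(* [E mu < +oo] makes the subdifferential empty outside of the domain of [E],
   where [E nu - E mu] is not meaningful. *)
Definition subdiff E mu : set (Rn -> R) :=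
  [set xi | [/\ Lp Om 2 xi, (E mu < +oo)%E & forall nu, Lp Om 2 nu ->
    ((dotL2 xi (nu \- mu)%R)%:E <= E nu - E mu)%E]].

Definition is_min_subdiff E mu xi : Prop :=
  subdiff E mu xi /\
  forall eta, subdiff E mu eta -> (Lp_norm Om 2 xi <= Lp_norm Om 2 eta)%E.

Definition is_deriveL2 c (t : R) (v : Rn -> R) : Prop :=
  Lp Om 2 v /\
  Lp_norm Om 2 (fun x => h^-1 * (c (t + h) x - c t x) - v x)
    @[h --> 0^'] --> 0%E.

Definition abs_continuousL2 (T : R) c : Prop :=
  forall e : R, 0 < e -> exists2 d : R, 0 < d &
    forall (m : nat) (a b : 'I_m -> R),
      (forall i, [/\ 0 <= a i, a i <= b i & b i <= T]) ->
      (forall i j, i != j -> b i <= a j \/ b j <= a i) ->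
      \sum_(i < m) (b i - a i) < d ->
      (\sum_(i < m) Lp_norm Om 2 (c (b i) \- c (a i))%R < e%:E)%E.

(* Only the values [c t] with [0 <= t] matter. *)
Definition is_gradient_flow E mu0 c : Prop :=
  [/\ forall t, 0 <= t -> Lp Om 2 (c t),
      forall T, 0 < T -> abs_continuousL2 T c,
      {ae @lebesgue_measure R, forall t : R, 0 < t ->
        exists xi, is_min_subdiff E (c t) xi /\ is_deriveL2 c t (\- xi)} &
      {ae leb, forall x, Om x -> c 0 x = mu0 x}].

End gradient_flow.

Section energy.
Variables (R : realType) (n : nat) (Om : set 'rV[R]_n) (p : R).
Local Notation Rn := 'rV[R]_n.
Local Notation leb := (@lebesgue_rV R n).

(* A class in W^{1,p}_0(Om), p > n, is evaluated pointwise through its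
   continuous representative [v]. *)
Definition M0 : set (Rn -> R) :=
  [set mu | Sobolev0 Om p mu /\
    exists v : Rn -> R, [/\ forall x, Om x -> {for x, continuous v},
      {ae leb, forall x, Om x -> v x = mu x} &
      forall x, Om x -> 0 <= v x]].

Definition H1_mean0 : set (Rn -> R) :=
  [set u | Sobolev Om 2 u /\ (\int[leb]_(x in Om) u x = 0)%R].

Definition energy (f : Rn -> R) (lam delta : R) (mu : Rn -> R) : \bar R :=
  if `[< M0 mu >] then
    (ereal_sup [set (2 * \int[leb]_(x in Om) (f x * u x))%:E -
                    \int[leb]_(x in Om)
                      ((mu x + lam) * enorm (wgrad Om u x) ^+ 2)%:E
               | u in H1_mean0] +
     \int[leb]_(x in Om) (mu x)%:E +
     delta%:E * Lp_norm_grad Om p mu `^ p)%E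
  else +oo%E.

Definition is_argmin (A : set (Rn -> R)) (E : (Rn -> R) -> \bar R)
    (mu : Rn -> R) : Prop :=
  A mu /\ forall nu, A nu -> (E mu <= E nu)%E.

End energy.

Section data.
Variables (R : realType) (n : nat).
Local Notation Rn := 'rV[R]_n.

(* The essential support: the complement of the largest open set on which [f]
   vanishes almost everywhere *)
Definition ess_support (f : Rn -> R) : set Rn :=
  [set x | forall U : set Rn, open U -> U x ->
    ~ {ae @lebesgue_rV R n, forall y, U y -> f y = 0}].

Definition conv_hull (A : set Rn) : set Rn :=
  \bigcap_(C in [set C | convex_set (C : set (convex_lmodType Rn)) /\ A `<=` C]) C.

Definition convex_bounded_domain (Om : set Rn) : Prop :=
  [/\ open Om, connected Om, Om !=set0,
      convex_set (Om : set (convex_lmodType Rn)) & bounded_set Om].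

End data.

(* Main.v *)
(* The energy is uniformly convex through its term [delta * |grad mu|^p], hence
   [E(mu) - E(mu_star)] controls the gradient of [mu - mu_star] in [L^p], and the
   Poincare inequality upgrades this to the [W^{1,p}] norm. It is thus enough to show
   that the energy tends to its minimum along the flow. The distance to [mu_star]
   decreases at rate at least [E(mu(t)) - E(mu_star)], so that the energy is close to
   its minimum at most times; since the flow is a contraction, its speed is bounded
   after any positive time, hence the energy increases at bounded rate and is close to
   its minimum at all large times of differentiability. These are dense and gradient
   bounds pass to [L^2] limits, which covers all large times.
   The minimizer is square integrable because [p >= 2] or [n = 1]. *)
Require Import Defs.
From HB Require Import structures.
From mathcomp Require Import all_boot all_order all_algebra.
From mathcomp Require Import all_classical all_reals all_analysis.
From mathcomp Require Import measurable_realfun ring lra.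

Import Order.TTheory GRing.Theory Num.Theory.
Import numFieldNormedType.Exports.

Local Open Scope classical_set_scope.
Local Open Scope ring_scope.

Set Implicit Arguments.
Unset Strict Implicit.
Unset Printing Implicit Defensive.

(** * Lebesgue measure on R^n *)

(** The minimality of [mustar] enters through midpoints: the dual term is a supremum of affine
    functions of mu, so the average of two energies exceeds the energy of the midpoint by at least
    [delta] times the convexity defect of the gradient energy, while the midpoint energy is at least
    the minimum. As [p] may be below 2 when [n = 1], this defect is compared with |v - w|^p by a
    compactness argument valid for every [p > 1], at the price of an error proportional to |v|^p +
    |w|^p; the energy bounds the gradient energies, which makes the error harmless. Three classical
    tools are replaced. Absolutely continuous functions are not integrated: a slope bound at almost
    every time becomes a bound on increments by creeping along the interval. Weak compactness in
    W^{1,p} gives way to uniform convexity, which makes well chosen approximants a Cauchy sequence.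
    Semicontinuity of the energy is avoided: the energy of the flow is known to be finite only at
    almost every time, so that only the gradient bound on mu(t) - mu_star is carried over to the
    remaining times. *)

Section rV_measurable.
Variables (R : realType) (n : nat).
Local Notation Rn := 'rV[R]_n.
Local Notation leb := (@lebesgue_rV R n).

Definition open_box (a b : Rn) : set Rn :=
  [set x | forall i, a ord0 i < x ord0 i < b ord0 i].

Definition open_boxes : set (set Rn) := [set A | exists a b, A = open_box a b].

Lemma measurable_coord i : measurable_fun setT (fun x : Rn => x ord0 i).
Proof.
have -> : (fun x : Rn => x ord0 i) = (fun t => tnth t i) \o @tuple_of_row R n.
  by apply/funext => x /=; rewrite tnth_mktuple.
apply: measurableT_comp => //; first exact: measurable_tnth.
by move=> _ A mA; rewrite setTI; exists A => //; rewrite setTI.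
Qed.

Lemma measurable_box (A : 'I_n -> set R) :
  (forall i, measurable (A i : set (measurableTypeR R))) ->
  measurable [set x : Rn | forall i, A i (x ord0 i)].
Proof.
move=> mA; rewrite (_ : [set _ | _] = \bigcap_(i in [set: 'I_n])
    ((fun x : Rn => x ord0 i) @^-1` A i)).
  apply: fin_bigcap_measurable => // i _.
  by rewrite -[X in measurable X]setTI; apply: measurable_coord;
    [exact: measurableT|exact: mA].
by apply/seteqP; split => t /=; [move=> h i _; exact: h|move=> h i; exact: h].
Qed.

Lemma open_boxE a b : open_box a b =
  [set x : Rn | forall i, `]a ord0 i, b ord0 i[%classic (x ord0 i)].
Proof. by apply/seteqP; split => x h i; have := h i; rewrite /= in_itv. Qed.

Lemma measurable_open_box a b : measurable (open_box a b).
Proof. by rewrite open_boxE; exact: (measurable_box (A := fun i => `]a ord0 i, b ord0 i[%classic)). Qed.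

Lemma open_box_fin a b : (leb (open_box a b) < +oo)%E.
Proof.
rewrite open_boxE (lebesgue_rV_box (A := fun i => `]a ord0 i, b ord0 i[%classic))//.
rewrite (eq_bigr (fun i => (fine (lebesgue_measure `]a ord0 i, b ord0 i[))%:E)).
  by rewrite prodEFin ltry.
move=> i _; rewrite fineK//= lebesgue_measure_itv.
by case: ifP.
Qed.

Lemma open_box_cover :
  \bigcup_k open_box (const_mx (- k%:R)) (const_mx k%:R) = [set: Rn].
Proof.
rewrite -subTset => x _.
pose M := \sum_i `|x ord0 i|.
have [k Mk] : exists k : nat, M < k%:R.
  by exists (Num.truncn M).+1; exact: truncnS_gt.
exists k => // i; rewrite !mxE -ltr_norml (le_lt_trans _ Mk)//.
by rewrite /M (bigD1 i)//= lerDl sumr_ge0.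
Qed.

Lemma open_boxesI : setI_closed open_boxes.
Proof.
move=> _ _ [a [b ->]] [c [d ->]].
exists (\row_i Num.max (a ord0 i) (c ord0 i)), (\row_i Num.min (b ord0 i) (d ord0 i)).
apply/seteqP; split => x /=.
  move=> [h1 h2] i; rewrite !mxE gt_max lt_min.
  by have /andP[-> ->] := h1 i; have /andP[-> ->] := h2 i.
move=> h; split => i; have := h i; rewrite !mxE gt_max lt_min.
  by move=> /andP[/andP[-> _] /andP[-> _]].
by move=> /andP[/andP[_ ->] /andP[_ ->]].
Qed.

(** An open half-space bounded below in one coordinate is a countable union of boxes, so the
    coordinates are measurable for the sigma-algebra that the boxes generate. Boxes are stable under
    intersection, hence two measures can be compared on them alone. *)
Lemma measurable_rVE : @measurable _ Rn = <<s open_boxes >>.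
Proof.
apply/seteqP; split; last first.
  apply: smallest_sub; first exact: sigma_algebra_measurable.
  by move=> _ [a [b ->]]; exact: measurable_open_box.
pose idT := fun x : g_sigma_algebraType open_boxes => (x : Rn).
suff mc i : measurable_fun [set: g_sigma_algebraType open_boxes]
    (fun x => idT x ord0 i : measurableTypeR R).
  have : measurable_fun [set: g_sigma_algebraType open_boxes]
      (@tuple_of_row R n \o idT).
    by apply/measurable_fun_tnthP => i; apply: eq_measurable_fun (mc i) => x _;
      rewrite /= tnth_mktuple.
  by move=> mt _ [B mB <-]; have := mt measurableT _ mB; rewrite !setTI.
apply: (measurability _ (RGenOInfty.measurableE R)) => // _ [_ [c ->] <-].
rewrite setTI (_ : _ @^-1` _ = \bigcup_k open_box
   (\row_j if j == i then c else - k%:R) (const_mx k%:R)).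
  apply: bigcupT_measurable => k; apply: sub_sigma_algebra.
  by eexists; eexists.
apply/seteqP; split => x /=; rewrite in_itv/= andbT; last first.
  by move=> [k _ /(_ i)]; rewrite !mxE eqxx => /andP[].
move=> cx; have : [set: Rn] x by [].
rewrite -open_box_cover => -[k _ xk]; exists k => // j; rewrite !mxE.
by have := xk j; rewrite !mxE; case: eqVneq => // -> /andP[_ ->]; rewrite cx.
Qed.

Lemma measure_rV_unique (m1 m2 : {measure set Rn -> \bar R}) :
  (forall a b, m1 (open_box a b) = m2 (open_box a b)) ->
  (forall a b, m1 (open_box a b) < +oo)%E ->
  forall A, measurable A -> m1 A = m2 A.
Proof.
move=> m12 m1oo A mA.
apply: (measure_unique open_boxes
  (fun k => open_box (const_mx (- k%:R)) (const_mx k%:R))) => //.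
- exact: measurable_rVE.
- exact: open_boxesI.
- by move=> i; eexists; eexists.
- exact: open_box_cover.
- by move=> _ [a [b ->]].
Qed.

Definition shift_rV (h x : Rn) : Rn := x + h.

Lemma measurable_shift_rV h : measurable_fun setT (shift_rV h).
Proof.
suff : measurable_fun setT (@tuple_of_row R n \o shift_rV h).
  move=> mt _ _ [B mB <-]; have := mt measurableT _ mB.
  by rewrite !setTI.
apply/measurable_fun_tnthP => i.
apply: (@eq_measurable_fun _ _ _ _ _ (fun x : Rn => x ord0 i + h ord0 i)).
  by move=> x _; rewrite /= tnth_mktuple mxE.
by apply: measurable_funD => //; exact: measurable_coord.
Qed.

HB.instance Definition _ h :=
  isMeasurableFun.Build _ _ _ _ (shift_rV h) (measurable_shift_rV h).

Lemma shift_open_box h a b :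
  shift_rV h @^-1` open_box a b = open_box (a - h) (b - h).
Proof.
apply/seteqP; split => x hx i; have := hx i; by rewrite /shift_rV !mxE ltrBlDr ltrBrDr.
Qed.

Lemma lebesgue_rV_shift h A : measurable A -> leb (shift_rV h @^-1` A) = leb A.
Proof.
move=> mA; apply: (@measure_rV_unique (pushforward leb (shift_rV h)) leb) => //.
- move=> a b; rewrite /= /pushforward shift_open_box.
  rewrite !open_boxE (lebesgue_rV_box (A := fun i => `]a ord0 i, b ord0 i[%classic))//.
  rewrite (lebesgue_rV_box (A := fun i => `](a - h) ord0 i, (b - h) ord0 i[%classic))//.
  apply: eq_bigr => i _; rewrite !lebesgue_measure_itv/= !lte_fin !mxE.
  by rewrite ltrD2r -!EFinB; case: ifP => // _; congr EFin; ring.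
- by move=> a b; rewrite /= /pushforward shift_open_box; exact: open_box_fin.
Qed.

(** Translation invariance will make the integrals of difference quotients vanish, which is how
    integration by parts is obtained. *)
Lemma integral_shift_rV (g : Rn -> R) h :
  leb.-integrable setT (EFin \o g) ->
  leb.-integrable setT (EFin \o (g \o shift_rV h)) /\
  (\int[leb]_x g (shift_rV h x) = \int[leb]_x g x)%R.
Proof.
move=> ig; have mg := measurable_int _ ig.
have sE : forall A, measurable A -> pushforward leb (shift_rV h) A = leb A.
  by move=> A; exact: lebesgue_rV_shift.
have ig' : leb.-integrable setT (EFin \o (g \o shift_rV h)).
  apply/integrableP; split; first exact: (measurableT_comp mg (measurable_shift_rV h)).
  have /integrableP[_] := ig; apply: le_lt_trans.
  rewrite [leRHS](eq_measure_integral (pushforward leb (shift_rV h))); last first.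
    by move=> A mA _; apply/esym/sE.
  rewrite [leRHS]ge0_integral_pushforward//; exact: measurableT_comp.
split => //; rewrite /Rintegral; congr fine.
transitivity (\int[pushforward leb (shift_rV h)]_x (g x)%:E)%E.
  by rewrite [RHS]integral_pushforward.
by apply: eq_measure_integral => A mA _; exact: sE.
Qed.

End rV_measurable.

(** * Topology and Borel sets of R^n *)

Section rV_borel.
Variables (R : realType) (n : nat).
Local Notation Rn := 'rV[R]_n.
Local Notation leb := (@lebesgue_rV R n).

Definition closed_box (a b : Rn) : set Rn :=
  [set x | forall i, a ord0 i <= x ord0 i <= b ord0 i].

Lemma closed_box_compact a b : compact (closed_box a b).
Proof.
rewrite (_ : closed_box a b =
    [set x : Rn | forall i, `[a ord0 i, b ord0 i]%classic (x ord0 i)]).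
  by apply: (@rV_compact _ _ (fun i => `[a ord0 i, b ord0 i]%classic)) => i; exact: segment_compact.
by apply/seteqP; split => x h i; have := h i; rewrite /= in_itv.
Qed.

(** Boxes with rational corners are enumerated through [pickle]. The closed boxes are kept inside
    [U] so that they are compact pieces of it, on which local integrability applies and bumps are
    test functions. *)
Lemma open_rV_boxes (U : set Rn) : open U ->
  exists (D : set nat) (a b : nat -> Rn),
    (forall k, D k -> closed_box (a k) (b k) `<=` U) /\
    U = \bigcup_(k in D) open_box (a k) (b k).
Proof.
move=> oU.
(* Integers coding no pair get a default box, which is harmless because only boxes whose closure
   lies in [U] are retained. *)
pose ab k : Rn * Rn := match (unpickle k : option ('rV[rat]_n * 'rV[rat]_n)%type) with
  | Some q => (map_mx ratr q.1, map_mx ratr q.2) | None => (0, 0) end.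
exists [set k | closed_box (ab k).1 (ab k).2 `<=` U], (fun k => (ab k).1), (fun k => (ab k).2).
split=> //; apply/seteqP; split => x; last first.
  by move=> [k kU xk]; apply: kU => i; have /andP[/ltW-> /ltW->] := xk i.
move=> Ux; have /nbhs_ballP[e/= e0 eU] := open_nbhs_nbhs (conj oU Ux).
have hq (i : 'I_n) : exists q : rat * rat,
    [/\ x ord0 i - e / 2 < ratr q.1, ratr q.1 < x ord0 i, x ord0 i < ratr q.2 &
        ratr q.2 < x ord0 i + e / 2].
  have [|q /[!in_itv]/= /andP[q1 q2]] := @rat_in_itvoo R (x ord0 i - e / 2) (x ord0 i).
    by rewrite ltrBlDr ltrDl divr_gt0.
  have [|r /[!in_itv]/= /andP[r1 r2]] := @rat_in_itvoo R (x ord0 i) (x ord0 i + e / 2).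
    by rewrite ltrDl divr_gt0.
  by exists (q, r).
have [q hq'] := choice hq.
have abE : ab (pickle (\row_i (q i).1, \row_i (q i).2)) =
    (\row_i ratr (q i).1, \row_i ratr (q i).2).
  by rewrite /ab pickleK/=; congr pair; apply/rowP => i; rewrite !mxE.
exists (pickle (\row_i (q i).1, \row_i (q i).2)); rewrite /= abE /=.
  move=> y yb; apply: eU; split => // i j; rewrite [i]ord1.
  have := yb j; rewrite !mxE => /andP[y1 y2]; have [q1 q2 q3 q4] := hq' j.
  rewrite /ball/= ltr_norml; apply/andP; split; lra.
by move=> i; rewrite !mxE; have [_ -> -> _] := hq' i.
Qed.

Lemma open_rV_measurable (U : set Rn) : open U -> measurable U.
Proof.
move=> /open_rV_boxes[D [a [b [_ ->]]]].
by apply: bigcup_measurable => k _; exact: measurable_open_box.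
Qed.

Lemma closed_rV_measurable (U : set Rn) : closed U -> measurable U.
Proof.
by move=> cU; rewrite -(setCK U); apply: measurableC; apply: open_rV_measurable;
  rewrite openC.
Qed.

Lemma compact_rV_measurable (K : set Rn) : compact K -> measurable K.
Proof.
by move=> cK; apply: closed_rV_measurable; apply: compact_closed => //;
  exact: norm_hausdorff.
Qed.

Lemma measurable_closed_box a b : measurable (closed_box a b).
Proof. exact/compact_rV_measurable/closed_box_compact. Qed.

Lemma continuous_rV_measurable (g : Rn -> R) (D : set Rn) :
  continuous g -> measurable_fun D g.
Proof.
move=> /continuousP cg; apply: measurable_funTS.
apply: (measurability _ (RGenOpens.measurableE R)) => // _ [_ [a [b ->] <-]].
by rewrite setTI; apply: open_rV_measurable; apply: cg; exact: interval_open.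
Qed.

Lemma bounded_rV_box (A : set Rn) : bounded_set A ->
  exists2 M : R, 0 < M & A `<=` open_box (const_mx (- M)) (const_mx M).
Proof.
move=> [M [_ /(_ (Num.max 1 (M + 1)))]] h.
have M1 : M < Num.max 1 (M + 1) by rewrite lt_max ltrDl ltr01 orbT.
exists (Num.max 1 (M + 1) + 1); first by rewrite addr_gt0// lt_max ltr01.
move=> x Ax i; rewrite !mxE -ltr_norml.
apply: (@le_lt_trans _ _ `|x|); last first.
  by apply: (le_lt_trans (h M1 x Ax)); rewrite ltrDl.
rewrite [leRHS]/Num.Def.normr/= mx_normrE.
exact: (le_bigmax _ (fun i : 'I_1 * 'I_n => `|x i.1 i.2|) (ord0, i)).
Qed.

Lemma bounded_rV_fin (A : set Rn) : measurable A -> bounded_set A -> (leb A < +oo)%E.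
Proof.
move=> mA /bounded_rV_box[M _ AM].
apply: le_lt_trans (open_box_fin (const_mx (- M)) (const_mx M)).
by apply: le_measure; rewrite ?inE//; exact: measurable_open_box.
Qed.

End rV_borel.

(** * Smooth bump functions *)

Section flat.
Variable R : realType.
Implicit Types (p : {poly R}) (x y : R).

(** Allowing an arbitrary polynomial in 1/x in front of exp(-1/x) makes the family closed under
    derivation, the origin included. *)
Definition flat p x : R := if 0 < x then p.[x^-1] * expR (- x^-1) else 0.

Lemma horner_le_pow p : exists2 C : R, 0 <= C &
  forall y, 1 <= y -> `|p.[y]| <= C * y ^+ size p.
Proof.
exists (\sum_(i < size p) `|p`_i|); first exact: sumr_ge0.
move=> y y1; rewrite horner_coef mulr_suml; apply: le_trans (ler_norm_sum _ _ _) _.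
apply: ler_sum => i _; rewrite normrM ler_wpM2l// ger0_norm ?exprn_ge0 ?(le_trans _ y1)//.
by apply: ler_weXn2l => //; exact: ltnW.
Qed.

(** With y = 1/x and k the size of [p], the polynomial is at most C y^k, while the exponential
    series gives exp y >= y^(k+1) / (k+1)!. One power of y is left over, which is the factor x. *)
Lemma flat_le p : exists2 C : R, 0 <= C &
  forall x, 0 < x -> x <= 1 -> `|flat p x| <= C * x.
Proof.
have [C C0 hC] := horner_le_pow p.
exists (C * (size p).+1`!%:R); first by rewrite mulr_ge0.
move=> x x0 x1; rewrite /flat x0 normrM.
have xV1 : 1 <= x^-1 by rewrite invf_ge1.
have xV0 : 0 <= x^-1 by rewrite invr_ge0 ltW.
rewrite (ger0_norm (expR_ge0 _)) expRN ler_pdivrMr ?expR_gt0//.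
apply: le_trans (hC _ xV1) _; rewrite -!mulrA ler_wpM2l//.
have := expR_ge1Dxn (size p) xV0.
set e := expR _; set k := (_`!)%:R => h.
have k0 : 0 < k :> R by rewrite ltr0n fact_gt0.
have : (x^-1) ^+ (size p).+1 <= e * k.
  by rewrite -ler_pdivrMr//; apply: le_trans h; rewrite lerDr.
rewrite exprS mulrC ler_pdivrMr// => /le_trans; apply.
by rewrite le_eqVlt; apply/orP; left; apply/eqP; ring.
Qed.

Lemma flat_cvg0 p : {for 0, continuous (flat p)}.
Proof.
have [C C0 hC] := flat_le p.
have f0 : flat p 0 = 0 by rewrite /flat ltxx.
rewrite /prop_for /continuous_at f0.
apply/cvgrPdist_le => e e0; near=> x.
rewrite sub0r normrN; have [x0|x0] := ltP 0 x; last first.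
  by rewrite /flat ltNge x0/= normr0 ltW.
have x1 : x < Num.min 1 (e / (C + 1)).
  have : `|x| < Num.min 1 (e / (C + 1)).
    by near: x; apply: (@nbhs0_lt R R); rewrite lt_min ltr01 divr_gt0// ltr_wpDl.
  by rewrite gtr0_norm.
move: x1; rewrite lt_min => /andP[x1 xe].
apply: le_trans (hC _ x0 (ltW x1)) _.
apply: le_trans (_ : (C + 1) * x <= _); first by rewrite mulrDl lerDl mul1r ltW.
by rewrite mulrC -ler_pdivlMr ?ltr_wpDl// ltW.
Unshelve. all: by end_near. Qed.

Lemma is_derive_flat p x : is_derive x 1 (flat p) (flat ('X ^+ 2 * (p - p^`())) x).
Proof.
have [x0|x0|->] := ltgtP x 0; last first.
(* Dividing [flat p z] by z multiplies the polynomial by one more 1/z, so the difference quotient at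
   the origin is again a flat function and tends to zero. *)
- apply/is_derive1_caratheodory; exists (flat ('X * p)); split.
  + move=> z; rewrite /flat ltxx !subr0; case: ifPn => z0; rewrite ?mul0r//.
    by rewrite hornerM hornerX; field; rewrite gt_eqF.
  + exact: flat_cvg0.
  + by rewrite /flat ltxx.
- rewrite /flat x0.
  apply: (@near_eq_is_derive _ _ _ (fun z : R => p.[z^-1] * expR (- z^-1))).
    near=> z; have z0 : 0 < z by near: z; exact: lt_nbhsr.
    by rewrite z0.
  have dV : is_derive x 1 (fun z : R => z^-1) (- x ^- 2).
    have := @is_deriveV _ id x 1 1 _ (is_derive_id _ _).
    by rewrite /= /GRing.scale /= mulr1; apply; rewrite gt_eqF.
  have dN : is_derive x 1 (fun z : R => - z^-1) (x ^- 2).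
    by have := is_deriveN dV; rewrite opprK.
  have d1 := is_derive1_comp (is_derive_poly p x^-1) dV.
  have d2 := @is_derive1_comp R expR (fun z : R => - z^-1) x _ _ (is_derive_expR _) dN.
  apply: is_derive_eq (is_deriveM d1 d2) _.
  rewrite /= /GRing.scale/= hornerM hornerXn hornerD hornerN; field.
  by rewrite gt_eqF.
- rewrite /flat ltNge (ltW x0) /=.
  apply: (@near_eq_is_derive _ _ _ (cst 0)).
    near=> z; have z0 : z < 0 by near: z; exact: lt_nbhsl.
    by rewrite ltNge (ltW z0).
Unshelve. all: by end_near. Qed.

(* A class of functions closed under derivation, hence made of smooth functions. *)
Inductive flat_alg : (R -> R) -> Prop :=
| flat_algF p a b : flat_alg (fun x => flat p (a * x + b))
| flat_algD f g : flat_alg f -> flat_alg g -> flat_alg (f + g)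
| flat_algM f g : flat_alg f -> flat_alg g -> flat_alg (f * g).

Lemma flat_algP f : flat_alg f ->
  exists2 g, flat_alg g & forall x, is_derive x 1 f (g x).
Proof.
elim=> [p a b|{}f g Sf [f' Sf' df] Sg [g' Sg' dg]|{}f g Sf [f' Sf' df] Sg [g' Sg' dg]].
- exists (fun x => flat (a *: ('X ^+ 2 * (p - p^`()))) (a * x + b)) => [|x].
    exact: flat_algF.
  have dl : is_derive x 1 (fun z : R => a * z + b) a.
    have := is_deriveD (is_deriveZ a (is_derive_id x 1)) (is_derive_cst b x 1).
    by rewrite addr0 /GRing.scale/= mulr1.
  apply: is_derive_eq (@is_derive1_comp R (flat p) (fun z : R => a * z + b) x _ _
    (is_derive_flat _ _) dl) _.
  rewrite /flat; case: ifP => _; last by rewrite mul0r.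
  by rewrite hornerZ; ring.
- by exists (f' + g') => [|x]; [exact: flat_algD|exact: is_deriveD].
- exists (f * g' + g * f') => [|x].
    by apply: flat_algD; exact: flat_algM.
  exact: is_deriveM.
Qed.

Lemma flat_alg_continuous f : flat_alg f -> continuous f.
Proof.
move=> /flat_algP[g _ df] x; apply: differentiable_continuous.
by apply/derivable1_diffP; have [] := df x.
Qed.

(** The parameter [k] steepens the flanks: as it grows, these bumps, all between 0 and 1, tend
    pointwise to the indicator function of ]a, b[. *)
Definition bumpf (k a b x : R) : R := flat 1 (k * x + - (k * a)) * flat 1 (- k * x + k * b).

Lemma bumpf_alg k a b : flat_alg (bumpf k a b).
Proof. by apply: flat_algM; exact: flat_algF. Qed.

Lemma bumpfE k a b x : 0 < k ->
  bumpf k a b x = if a < x < b then expR (- (k * (x - a))^-1) * expR (- (k * (b - x))^-1) else 0.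
Proof.
move=> k0; rewrite /bumpf /flat !hornerE.
rewrite (_ : k * x + - (k * a) = k * (x - a)); last by ring.
rewrite (_ : - k * x + k * b = k * (b - x)); last by ring.
rewrite !pmulr_rgt0// !subr_gt0.
by case: (a < x); case: (x < b); rewrite /= ?mul0r ?mulr0 ?mul1r.
Qed.

Lemma bumpf_ge0 k a b x : 0 < k -> 0 <= bumpf k a b x.
Proof.
by move=> k0; rewrite bumpfE//; case: ifP => // _; rewrite mulr_ge0// expR_ge0.
Qed.

Lemma bumpf_le1 k a b x : 0 < k -> bumpf k a b x <= 1.
Proof.
move=> k0; rewrite bumpfE//; case: ifP => // /andP[ax xb].
by rewrite mulr_ile1 ?expR_ge0// -expR0 ler_expR oppr_le0 invr_ge0 mulr_ge0 ?ltW ?subr_gt0.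
Qed.

Lemma bumpf_cvg a b x : (bumpf k.+1%:R a b x) @[k --> \oo] --> (if a < x < b then 1 else 0 : R).
Proof.
rewrite (_ : (fun k => _) = fun k : nat => if a < x < b then
   expR (- (k.+1%:R * (x - a))^-1) * expR (- (k.+1%:R * (b - x))^-1) else 0); last first.
  by apply/funext => k; rewrite bumpfE.
case: ifPn => /= [/andP[ax xb]|_]; last exact: cvg_cst.
have cV (c : R) : 0 < c -> expR (- (k.+1%:R * c)^-1) @[k --> \oo] --> (1 : R).
  move=> c0; rewrite -[X in _ --> X]expR0; apply: continuous_cvg; first exact: continuous_expR.
  rewrite -[X in _ --> X]oppr0; apply: cvgN.
  rewrite (_ : (fun _ => _) = fun k : nat => c^-1 * harmonic k); last first.
    by apply/funext => k; rewrite /harmonic/= invfM mulrC.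
  rewrite -[X in _ --> X](mulr0 c^-1); apply: cvgM; first exact: cvg_cst.
  exact: cvg_harmonic.
by rewrite -[X in _ --> X](mulr1 1); apply: cvgM; apply: cV; rewrite subr_gt0.
Qed.

End flat.

Section box_bump.
Variables (R : realType) (n : nat).
Local Notation Rn := 'rV[R]_n.
Local Notation leb := (@lebesgue_rV R n).

(** Reduces derivatives along a direction of R^n to one real variable, where the chain rule and the
    mean value theorem are applied. *)
Lemma is_derive_line (u : Rn -> R) (x v : Rn) (d : R) :
  is_derive (0 : R) 1 (fun t : R => u (t *: v + x)) d <-> is_derive x v u d.
Proof.
have E : (fun h : R => h^-1 *: (((fun t : R => u (t *: v + x)) \o shift 0) (h *: 1) -
    u (0 *: v + x))) = (fun h : R => h^-1 *: ((u \o shift x) (h *: v) - u x)).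
  by apply/funext => h; rewrite /= scale0r add0r addr0 /GRing.scale/= mulr1.
split=> -[].
  rewrite /derivable E => dv dE; split => //.
  by rewrite -dE /derive E.
rewrite /derivable -E => dv dE; split => //.
by rewrite -dE /derive E.
Qed.

Definition prod_fun (h : 'I_n -> R -> R) (x : Rn) : R := \prod_i h i (x ord0 i).

Lemma is_derive_prod_fun (h : 'I_n -> R -> R) i (g : R) (x : Rn) : is_derive (x ord0 i) 1 (h i) g ->
  is_derive x (delta_mx ord0 i) (prod_fun h) (g * \prod_(j | j != i) h j (x ord0 j)).
Proof.
move=> dg; apply/is_derive_line.
set c := \prod_(j | _) _.
rewrite (_ : (fun t => _) = fun t : R => h i (t + x ord0 i) * c); last first.
  apply/funext => t; rewrite /prod_fun (bigD1 i)//= !mxE !eqxx mulr1; congr (_ * _).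
  apply: eq_bigr => j ji; rewrite !mxE eqxx /= -val_eqE/= val_eqE.
  by rewrite (negbTE ji) mulr0 add0r.
have dt : is_derive (0 : R) (1 : R) (fun t : R => t + x ord0 i) (1 : R).
  by have := is_deriveD (is_derive_id (0 : R) (1 : R)) (is_derive_cst (x ord0 i) (0 : R) (1 : R)); rewrite addr0.
have dh : is_derive (0 : R) (1 : R) (h i \o (fun t : R => t + x ord0 i)) (g * 1).
  by apply: is_derive1_comp; rewrite ?add0r.
have := is_deriveZ c dh; rewrite mulr1 => H.
rewrite (_ : (fun t => _) = c \*: (h i \o (fun t : R => t + x ord0 i))); last first.
  by apply/funext => t; rewrite /= mulrC.
by rewrite (mulrC g).
Qed.

Lemma prod_fun_continuous (h : 'I_n -> R -> R) : (forall i, continuous (h i)) -> continuous (prod_fun h).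
Proof.
move=> ch x; rewrite /continuous_at /prod_fun.
have H := @cvg_big R 'I_n *%R 1 xpredT mul_continuous _ (nbhs x) (index_enum _)
  (fun i (y : Rn) => h i (y ord0 i)) (fun i => h i (x ord0 i)) _.
apply: H => i _.
apply: (@continuous_comp _ _ _ (fun x : Rn => x ord0 i) (h i)); last exact: ch.
exact: coord_continuous.
Qed.

(** A partial derivative changes a single factor of the product and keeps it in the class
    [flat_alg], so the induction never leaves products of such functions. *)
Lemma iter_partial_prod_fun s h : (forall i, flat_alg (h i)) ->
  exists2 h', (forall i, flat_alg (h' i)) & iter_partial s (prod_fun h) = prod_fun h'.
Proof.
elim: s h => [|i s IHs] h Sh /=; first by exists h.
have [h' Sh' ->] := IHs _ Sh; have [g Sg dg] := flat_algP (Sh' i).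
exists (fun j => if j == i then g else h' j) => [j|]; first by case: ifP.
apply/funext => x; rewrite /partial.
have [_ ->] := is_derive_prod_fun (dg (x ord0 i)).
rewrite /prod_fun [RHS](bigD1 i)//= eqxx; congr (_ * _).
by apply: eq_bigr => j /negbTE ->.
Qed.

Lemma prod_fun_smooth h : (forall i, flat_alg (h i)) -> smooth (prod_fun h).
Proof.
move=> Sh s; have [h' Sh' ->] := iter_partial_prod_fun s Sh; split.
  by apply: prod_fun_continuous => i; exact: flat_alg_continuous.
move=> i x; have [g _ dg] := flat_algP (Sh' i).
by have [] := is_derive_prod_fun (dg (x ord0 i)).
Qed.

Definition box_bump (k : R) (a b x : Rn) : R :=
  prod_fun (fun i => bumpf k (a ord0 i) (b ord0 i)) x.

Lemma box_bump_out k a b x : 0 < k -> ~ open_box a b x -> box_bump k a b x = 0.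
Proof.
move=> k0; rewrite /open_box/= => /existsNP[i /negP xi].
by rewrite /box_bump /prod_fun (bigD1 i)//= bumpfE// (negbTE xi) mul0r.
Qed.

Lemma box_bump_ge0 k a b x : 0 < k -> 0 <= box_bump k a b x.
Proof. by move=> k0; apply: prodr_ge0 => i _; exact: bumpf_ge0. Qed.

Lemma box_bump_le1 k a b x : 0 < k -> box_bump k a b x <= 1.
Proof.
move=> k0; rewrite /box_bump /prod_fun.
apply: (@le_trans _ _ (\prod_(i < n) (1 : R))); last by rewrite big1.
by apply: ler_prod => i _; rewrite bumpf_ge0//= bumpf_le1.
Qed.

Lemma box_bump_test k a b Om : 0 < k -> closed_box a b `<=` Om ->
  test_function Om (box_bump k a b).
Proof.
move=> k0 abO; split; first by apply: prod_fun_smooth => i; exact: bumpf_alg.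
exists (closed_box a b); split => //; first exact: closed_box_compact.
move=> x xab; apply: box_bump_out => // xo; apply: xab => i.
by have /andP[/ltW-> /ltW->] := xo i.
Qed.

Lemma box_bump_cvg a b x :
  (box_bump k.+1%:R a b x) @[k --> \oo] --> (\1_(open_box a b) x : R).
Proof.
rewrite (_ : \1_(open_box a b) x =
    \prod_i (if a ord0 i < x ord0 i < b ord0 i then 1 else 0)).
  have H := @cvg_big R 'I_n *%R 1 xpredT mul_continuous nat \oo (index_enum _)
    (fun i k => bumpf k.+1%:R (a ord0 i) (b ord0 i) (x ord0 i))
    (fun i => if a ord0 i < x ord0 i < b ord0 i then 1 else 0) _.
  apply: H => i _.
  exact: bumpf_cvg.
rewrite indicE; have [/set_mem xo|/negP] := boolP (x \in _).
  by rewrite big1// => i _; rewrite xo.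
rewrite inE /open_box/= => /existsNP[i /negP xi].
by rewrite (bigD1 i)//= (negbTE xi) mul0r.
Qed.

End box_bump.

(** * The fundamental lemma of the calculus of variations *)

Section induced_measure.
Context d (T : measurableType d) (R : realType) (mu : {measure set T -> \bar R}).
Variable f : T -> \bar R.
Hypothesis mf : measurable_fun setT f.
Hypothesis f0 : forall x, (0 <= f x)%E.

(** The proofs about [f] are arguments of the term so that a measure structure can be attached to
    it. *)
Definition induced_measure of measurable_fun setT f & (forall x, (0 <= f x)%E) :=
  fun A : set T => (\int[mu]_(x in A) f x)%E.

Local Notation nu := (induced_measure mf f0).

Let nu0 : nu set0 = 0%E. Proof. exact: integral_set0. Qed.
Let nu_ge0 A : (0 <= nu A)%E. Proof. exact: integral_ge0. Qed.
Let nu_sigma : semi_sigma_additive nu. Proof. exact: semi_sigma_additive_nng_induced. Qed.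
HB.instance Definition _ := isMeasure.Build _ _ _ nu nu0 nu_ge0 nu_sigma.
End induced_measure.

Section dominated.
Context d (T : measurableType d) (R : realType) (mu : {measure set T -> \bar R}).
Implicit Types (D : set T) (g h : T -> R).

Lemma Rintegral_dominated D (gk : nat -> T -> R) g h : measurable D ->
  (forall k, measurable_fun D (gk k)) -> measurable_fun D g ->
  {ae mu, forall x, D x -> gk k x @[k --> \oo] --> g x} ->
  mu.-integrable D (EFin \o h) ->
  {ae mu, forall x, forall k, D x -> `|gk k x| <= h x} ->
  mu.-integrable D (EFin \o g) /\
  (\int[mu]_(x in D) gk k x)%R @[k --> \oo] --> (\int[mu]_(x in D) g x)%R.
Proof.
move=> mD mgk mg cg ih gh.
have mgk' k : measurable_fun D (EFin \o gk k) by exact/measurable_EFinP.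
have mg' : measurable_fun D (EFin \o g) by exact/measurable_EFinP.
have cg' : {ae mu, forall x, D x -> (EFin \o gk k) x @[k --> \oo] --> (EFin \o g) x}.
  apply: filterS cg => x cx Dx; apply: cvg_EFin; last exact: cx.
  exact: nearW.
have gh' : {ae mu, forall x, forall k, D x -> (`|(EFin \o gk k) x| <= (EFin \o h) x)%E}.
  by apply: filterS gh => x cx k Dx; rewrite /= lee_fin; exact: cx.
have [ig _ ci] := dominated_convergence mD mgk' mg' cg' ih gh'.
split => //; apply: fine_cvg; rewrite fineK//; exact: integrable_fin_num.
Qed.

Lemma negligible_aeP (A : set T) : mu.-negligible A -> {ae mu, forall x, ~ A x}.
Proof. by move=> nA; apply: negligibleS nA => x /= /contrapT. Qed.

End dominated.

Section du_bois_reymond.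
Variables (R : realType) (n : nat).
Local Notation Rn := 'rV[R]_n.
Local Notation leb := (@lebesgue_rV R n).

(** The positive and negative parts of [g] are densities of two finite measures that agree on boxes,
    hence on all measurable sets; so [g] has zero integral over each of them. *)
Lemma integral_boxes0 (g : Rn -> R) : leb.-integrable setT (EFin \o g) ->
  (forall a b, \int[leb]_(x in open_box a b) g x = 0)%R ->
  {ae leb, forall x, g x = 0}.
Proof.
move=> ig g0.
have mp : measurable_fun setT (EFin \o g)^\+%E := measurable_funepos (measurable_int _ ig).
have mn : measurable_fun setT (EFin \o g)^\-%E := measurable_funeneg (measurable_int _ ig).
have p0 x : (0 <= (EFin \o g)^\+ x)%E by exact: funepos_ge0.
have n0 x : (0 <= (EFin \o g)^\- x)%E by exact: funeneg_ge0.
have igA A : measurable A -> leb.-integrable A (EFin \o g).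
  by move=> mA; apply: integrableS ig.
pose m1 := induced_measure leb mp p0; pose m2 := induced_measure leb mn n0.
have m12 A : measurable A -> m1 A = m2 A.
  apply: (@measure_rV_unique _ _ m1 m2) => a b.
  - have iab := igA _ (measurable_open_box a b).
    have := g0 a b; rewrite /Rintegral integralE /= /induced_measure.
    have := integrable_pos_fin_num (measurable_open_box a b) iab.
    have := integrable_neg_fin_num (measurable_open_box a b) iab.
    set u := (\int[_]_(_ in _) _)%E; set v := (\int[_]_(_ in _) _)%E.
    by move: u v => [u| |] [v| |] //= _ _ /eqP; rewrite subr_eq0 => /eqP ->.
  - have := integrable_pos_fin_num (measurable_open_box a b) (igA _ (measurable_open_box a b)).
    by rewrite ge0_fin_numE//; exact: integral_ge0.
have : ae_eq leb setT (EFin \o g) (cst 0%E).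
  apply: integral_ae_eq => // E _ mE.
  rewrite integral0 integralE.
  have -> : (\int[leb]_(x in E) (EFin \o g)^\+ x)%E =
    (\int[leb]_(x in E) (EFin \o g)^\- x)%E := m12 E mE.
  rewrite subee//.
  exact: integrable_neg_fin_num (igA _ mE).
by apply: filterS => x /(_ I) /= [].
Qed.

Lemma test_integrable (Om : set Rn) (u psi : Rn -> R) (K : set Rn) :
  loc_integrable Om u -> continuous psi -> compact K -> K `<=` Om ->
  (forall x, ~ K x -> psi x = 0) ->
  leb.-integrable setT (EFin \o (fun x => u x * psi x)).
Proof.
move=> iu cpsi cK KO psi0; have mK := compact_rV_measurable cK.
have -> : EFin \o (fun x => u x * psi x) = (EFin \o (fun x => u x * psi x)) \_ K.
  apply/funext => x; rewrite /patch; case: ifPn => // /negP; rewrite inE => Kx.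
  by rewrite /= psi0// mulr0.
apply/(integrable_mkcond _ mK).
have [M M0 psiM] : exists2 M : R, 0 <= M & forall x, K x -> `|psi x| <= M.
  have [->|/set0P K0] := eqVneq K set0; first by exists 0.
  have [|c _ hc] := @compact_EVT_max _ _ (fun x => `|psi x|) K K0 cK.
    apply: continuous_subspaceT => x; apply: (continuous_comp (cpsi x)).
    exact: norm_continuous.
  by exists `|psi c| => // x Kx; apply: hc; rewrite inE.
apply: (@le_integrable _ _ _ leb _ mK (EFin \o (fun x => u x * psi x)) (fun x => (M%:E * (u x)%:E)%E)).
- have := measurable_int _ (iu K cK KO) => /measurable_EFinP mu.
  by apply/measurable_EFinP/measurable_funM => //; exact: continuous_rV_measurable.
- move=> x Kx /=; rewrite lee_fin !normrM (ger0_norm M0) mulrC.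
  by rewrite ler_wpM2r// psiM.
- exact: integrableZl (iu K cK KO).
Qed.

Lemma Rintegral_test (Om : set Rn) (u psi : Rn -> R) (K : set Rn) :
  K `<=` Om -> (forall x, ~ K x -> psi x = 0) ->
  (\int[leb]_(x in Om) (u x * psi x) = \int[leb]_x (u x * psi x))%R.
Proof.
move=> KO psi0; rewrite Rintegral_mkcond; apply: eq_Rintegral => x _.
rewrite /patch; case: ifPn => // /negP; rewrite inE => Ox.
by rewrite psi0 ?mulr0//; exact: contra_not (KO x) Ox.
Qed.

(** Steepening bumps tend to the indicator of a box while staying below 1, so dominated convergence
    turns the hypothesis into vanishing integrals of [g] over boxes. Countably many boxes with
    closure in [Om] cover it; on each of them [g] is integrable and [integral_boxes0] applies. *)
Lemma du_bois_reymond (Om : set Rn) (g : Rn -> R) : open Om -> loc_integrable Om g ->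
  (forall phi, test_function Om phi -> \int[leb]_(x in Om) (g x * phi x) = 0)%R ->
  {ae leb, forall x, Om x -> g x = 0}.
Proof.
move=> oOm ig g0; have [D [a [b [abO OmE]]]] := open_rV_boxes oOm.
suff H k : D k -> {ae leb, forall x, open_box (a k) (b k) x -> g x = 0}.
  have : {ae leb, forall x, forall k, D k -> open_box (a k) (b k) x -> g x = 0}.
    apply/ae_foralln => k; have [Dk|nDk] := pselect (D k).
      by apply: filterS (H k Dk) => x hx _.
    exact: aeW.
  by apply: filterS => x hx; rewrite OmE => -[k Dk xk]; exact: hx xk.
move=> Dk; have {OmE}{}abO := abO k Dk; move: (a k) (b k) abO => {Dk}{D k}{}a {}b abO.
have mab := measurable_open_box a b.
have sab (c d : Rn) : open_box c d `<=` closed_box c d.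
  by move=> x xcd i; have /andP[/ltW -> /ltW ->] := xcd i.
have igc : leb.-integrable (closed_box a b) (EFin \o g).
  by apply: ig => //; exact: closed_box_compact.
have igab : leb.-integrable (open_box a b) (EFin \o g).
  by apply: integrableS igc => //; exact: measurable_closed_box.
have mgc : measurable_fun (closed_box a b) g by exact/measurable_EFinP/(measurable_int _ igc).
suff : {ae leb, forall x, (g \_ (open_box a b)) x = 0}.
  by apply: filterS => x + xab; rewrite /patch mem_set.
apply: integral_boxes0.
  have /(integrable_mkcond _ mab) := igab; congr (integrable _ _ _).
  by apply/funext => x; rewrite /patch/=; case: ifP.
move=> c' d'.
(* The part of an arbitrary box inside the local box is again a box, and its closure stays in [Om],
   so its bumps are test functions. *)
pose c := \row_i Num.max (c' ord0 i) (a ord0 i).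
pose d := \row_i Num.min (d' ord0 i) (b ord0 i).
have Ecd : open_box c' d' `&` open_box a b = open_box c d.
  apply/seteqP; split => x /=.
    move=> [h1 h2] i; rewrite !mxE gt_max lt_min.
    by have /andP[-> ->] := h1 i; have /andP[-> ->] := h2 i.
  move=> h; split => i; have := h i; rewrite !mxE gt_max lt_min.
    by move=> /andP[/andP[-> _] /andP[-> _]].
  by move=> /andP[/andP[_ ->] /andP[_ ->]].
have cdab : closed_box c d `<=` closed_box a b.
  move=> x xcd i; have := xcd i; rewrite !mxE ge_max le_min.
  by move=> /andP[/andP[_ ->] /andP[_ ->]].
rewrite -Rintegral_mkcondr {}Ecd.
have mcd := measurable_closed_box c d.
pose phi k := box_bump k.+1%:R c d : Rn -> R.
have phi0 k : (\int[leb]_(x in closed_box c d) (g x * phi k x) = 0)%R.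
  rewrite -(g0 (phi k)); last first.
    by apply: box_bump_test => //; exact: subset_trans abO.
  have phi_out x : ~ closed_box c d x -> phi k x = 0.
    by move=> xcd; apply: box_bump_out => // /sab.
  by rewrite (Rintegral_test _ _ phi_out)// (@Rintegral_test Om _ _ (closed_box c d))//;
    exact: subset_trans abO.
have mphi k : continuous (phi k).
  by apply: prod_fun_continuous => i; apply: flat_alg_continuous; exact: bumpf_alg.
have mgcd : measurable_fun (closed_box c d) g.
  by apply: measurable_funS mgc => //; exact: measurable_closed_box.
have [|||||_] := @Rintegral_dominated _ _ _ leb (closed_box c d) (fun k x => g x * phi k x)
    (fun x => g x * \1_(open_box c d) x) (fun x => `|g x|) mcd.
- move=> k; apply: measurable_funM => //; exact: continuous_rV_measurable.
- apply: measurable_funM => //; apply: measurable_indic; exact: measurable_open_box.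
- apply: aeW => x _; apply: cvgM; [exact: cvg_cst|exact: box_bump_cvg].
- suff : leb.-integrable (closed_box c d) (abse \o (EFin \o g)) by [].
  by apply: integrable_abse; apply: integrableS igc => //; exact: measurable_closed_box.
- apply: aeW => x k _; rewrite normrM ler_piMr// ger0_norm; first exact: box_bump_le1.
  exact: box_bump_ge0.
rewrite (_ : (fun k => _) = cst 0); last by apply/funext.
move=> /cvg_unique -/(_ (@norm_hausdorff _ _) _ (cvg_cst 0)) E.
rewrite -[RHS]E.
transitivity (\int[leb]_(x in closed_box c d `&` open_box c d) g x)%R.
  by congr (Rintegral _ _ _); rewrite setIidr.
rewrite Rintegral_mkcondr; apply: eq_Rintegral => x _.
by rewrite /patch indicE; case: ifP => _; rewrite ?mulr1 ?mulr0.
Qed.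

End du_bois_reymond.

(** * Lebesgue and Sobolev spaces *)

Section powR_aux.
Variable R : realType.
Implicit Types a b p : R.

Lemma powR_add_le a b p : 0 <= a -> 0 <= b -> 0 <= p ->
  (a + b) `^ p <= 2 `^ p * (a `^ p + b `^ p).
Proof.
move=> a0 b0 p0; have m0 : 0 <= Num.max a b by rewrite le_max a0.
apply: (@le_trans _ _ ((2 * Num.max a b) `^ p)).
  apply: ge0_ler_powR; rewrite ?nnegrE ?addr_ge0 ?mulr_ge0//.
  by rewrite mulrDl mul1r lerD// le_max lexx ?orbT.
rewrite powRM// ler_wpM2l ?powR_ge0//.
by case: (leP a b) => _; rewrite ?lerDl ?lerDr powR_ge0.
Qed.

Lemma powR_norm_le a b p : 0 <= p -> `|a| <= `|b| -> `|a| `^ p <= `|b| `^ p.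
Proof. by move=> p0 ab; apply: ge0_ler_powR; rewrite ?nnegrE. Qed.

Lemma powRK a p : 0 <= a -> p != 0 -> (a `^ p) `^ p^-1 = a.
Proof. by move=> a0 p0; rewrite -powRrM mulfV// powRr1. Qed.

Lemma powRVK a p : 0 <= a -> p != 0 -> (a `^ p^-1) `^ p = a.
Proof. by move=> a0 p0; rewrite -powRrM mulVf// powRr1. Qed.

End powR_aux.

Section Lp_toolkit.
Variables (R : realType) (n : nat) (Om : set 'rV[R]_n).
Local Notation Rn := 'rV[R]_n.
Local Notation leb := (@lebesgue_rV R n).
Hypothesis mOm : measurable Om.
Implicit Types (u v : Rn -> R) (p : R).

(** The p-th power of the norm, kept as a real number: estimates then need neither p-th roots nor
    extended reals. An infinite integral would read as 0, so the value is meaningful only together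
    with membership in [Lp]. *)
Definition Lp_energy p u : R := (\int[leb]_(x in Om) (`|u x| `^ p))%R.

Lemma restrict_powR p u : p != 0 ->
  (fun x => (`|(EFin \o (u \_ Om)) x| `^ p)%E) = (EFin \o (fun x => `|u x| `^ p)) \_ Om.
Proof.
move=> p0; apply/funext => x; rewrite /patch/=; case: ifP => _; rewrite ?poweR_EFin//=.
by rewrite normr0 powR0.
Qed.

Lemma measurable_powR_norm p u : measurable_fun Om u ->
  measurable_fun Om (EFin \o (fun x => `|u x| `^ p)).
Proof.
move=> mu; apply/measurable_EFinP.
apply: (@measurableT_comp _ _ _ _ _ _ (@powR R ^~ p)) => //.
exact: measurableT_comp.
Qed.

Lemma LpP p u : 1 <= p -> Lp Om p u <->
  measurable_fun Om u /\ leb.-integrable Om (EFin \o (fun x => `|u x| `^ p)).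
Proof.
move=> p1; have p0 : p != 0 by rewrite gt_eqF// (lt_le_trans _ p1).
have E : (\int[leb]_x (`|(EFin \o (u \_ Om)) x| `^ p))%E =
    (\int[leb]_(x in Om) `|(EFin \o (fun x => `|u x| `^ p)%R) x|)%E.
  rewrite (restrict_powR _ p0) -integral_mkcond; apply: eq_integral => x _.
  by rewrite /= (ger0_norm (powR_ge0 _ _)).
split.
- move=> /andP[/[!inE] mu]; rewrite /= /finite_norm unlock => hf.
  have {}mu : measurable_fun Om u by apply/(measurable_restrictT _ mOm).
  split => //; apply/integrableP; split; first exact: measurable_powR_norm.
  by rewrite -E; move: hf; apply: lty_poweRy; rewrite invr_eq0.
- move=> [mu /integrableP[_ hf]]; apply/andP; rewrite !inE; split.
    by apply/(measurable_restrictT _ mOm).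
  by rewrite /= /finite_norm unlock; apply: poweR_lty; rewrite E.
Qed.

Lemma Lp_energy_ge0 p u : 0 <= Lp_energy p u.
Proof. by apply: Rintegral_ge0 => x _; exact: powR_ge0. Qed.

Lemma Lp_energyE p u : leb.-integrable Om (EFin \o (fun x => `|u x| `^ p)) ->
  (Lp_energy p u)%:E = (\int[leb]_(x in Om) (`|u x| `^ p)%:E)%E.
Proof. by move=> h; rewrite /Lp_energy /Rintegral fineK//; exact: integrable_fin_num. Qed.

Lemma Lp_normE p u : 1 <= p -> Lp Om p u ->
  Lp_norm Om p u = ((Lp_energy p u) `^ p^-1)%:E.
Proof.
move=> p1 /(LpP _ p1)[_ hu]; have p0 : p != 0 by rewrite gt_eqF// (lt_le_trans _ p1).
by rewrite /Lp_norm unlock (restrict_powR _ p0) -integral_mkcond -poweR_EFin Lp_energyE.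
Qed.

Lemma Lp_le p u v : 1 <= p -> measurable_fun Om u ->
  leb.-integrable Om (EFin \o v) ->
  (forall x, Om x -> `|u x| `^ p <= v x) -> Lp Om p u /\ Lp_energy p u <= (\int[leb]_(x in Om) v x)%R.
Proof.
move=> p1 mu iv uv.
have iu : leb.-integrable Om (EFin \o (fun x => `|u x| `^ p)).
  apply: (@le_integrable _ _ _ leb _ mOm _ (EFin \o v)) => //.
    exact: measurable_powR_norm.
  move=> x Ox /=; rewrite lee_fin (ger0_norm (powR_ge0 _ _)).
  by apply: le_trans (uv x Ox) _; exact: ler_norm.
split; first by apply/(LpP _ p1).
by apply: le_Rintegral.
Qed.

Lemma integrableZR a u : leb.-integrable Om (EFin \o u) ->
  leb.-integrable Om (EFin \o (fun x => a * u x)).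
Proof. by move=> iu; exact: (integrableZl mOm a iu). Qed.

Lemma integrableDR u v : leb.-integrable Om (EFin \o u) -> leb.-integrable Om (EFin \o v) ->
  leb.-integrable Om (EFin \o (fun x => u x + v x)).
Proof. by move=> iu iv; exact: (integrableD mOm iu iv). Qed.

(** The crude constant 2^p stands in for Minkowski's inequality: only smallness up to a constant
    factor matters in the applications, and p-th powers are preserved. *)
Lemma Lp_lin p a b u v : 1 <= p -> Lp Om p u -> Lp Om p v ->
  Lp Om p (fun x => a * u x + b * v x) /\
  Lp_energy p (fun x => a * u x + b * v x) <=
    2 `^ p * (`|a| `^ p * Lp_energy p u + `|b| `^ p * Lp_energy p v).
Proof.
move=> p1 /(LpP _ p1)[mu iu] /(LpP _ p1)[mv iv].
have p0 : 0 <= p by rewrite (le_trans _ p1).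
have iau := integrableZR (`|a| `^ p) iu.
have ibv := integrableZR (`|b| `^ p) iv.
have iw := integrableZR (2 `^ p) (integrableDR iau ibv).
have [] := @Lp_le p (fun x => a * u x + b * v x) _ p1 _ iw.
- by apply: measurable_funD; apply: measurable_funM.
- move=> x _; apply: le_trans (_ : (`|a * u x| + `|b * v x|) `^ p <= _).
    by apply: ge0_ler_powR; rewrite ?nnegrE ?addr_ge0// ler_normD.
  by rewrite -!powRM// -!normrM; exact: powR_add_le.
move=> h1 /le_trans h2; split => //; apply: h2.
rewrite RintegralZl//; last exact: integrableDR.
by rewrite RintegralD// !RintegralZl.
Qed.

Lemma ae_Lp_energy p u v : measurable_fun Om u -> measurable_fun Om v ->
  {ae leb, forall x, Om x -> u x = v x} -> Lp_energy p u = Lp_energy p v.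
Proof.
move=> mu mv uv; rewrite /Lp_energy /Rintegral; congr fine.
apply: ae_eq_integral => //; [exact: measurable_powR_norm..|].
by apply: filterS uv => x h Ox /=; rewrite h.
Qed.

End Lp_toolkit.

Section enorm_facts.
Variables (R : realType) (n : nat).
Local Notation Rn := 'rV[R]_n.
Implicit Types v w : Rn.

Lemma sum_sqr_ge0 v : 0 <= \sum_(i < n) v ord0 i ^+ 2.
Proof. by apply: sumr_ge0 => i _; exact: sqr_ge0. Qed.

Lemma enorm_ge0 v : 0 <= enorm v.
Proof. exact: sqrtr_ge0. Qed.

Lemma enorm_sqr v : enorm v ^+ 2 = \sum_(i < n) v ord0 i ^+ 2.
Proof. by rewrite sqr_sqrtr// sum_sqr_ge0. Qed.

Lemma coord_le_enorm v i : `|v ord0 i| <= enorm v.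
Proof.
rewrite -sqrtr_sqr ler_sqrt ?sum_sqr_ge0// (bigD1 i)//= lerDl.
by apply: sumr_ge0 => j _; exact: sqr_ge0.
Qed.

Lemma enorm_le_sum v : enorm v <= \sum_(i < n) `|v ord0 i|.
Proof.
have s0 : 0 <= \sum_(i < n) `|v ord0 i| by exact: sumr_ge0.
rewrite -(ler_pXn2r (n := 2))// ?nnegrE ?enorm_ge0// enorm_sqr.
rewrite [leRHS]expr2 mulr_suml; apply: ler_sum => i _.
rewrite -real_normK ?num_real// expr2 ler_wpM2l// (bigD1 i)//= lerDl.
exact: sumr_ge0.
Qed.

Lemma enorm_powR_le v p : 0 < p ->
  enorm v `^ p <= n%:R `^ p * \sum_(i < n) `|v ord0 i| `^ p.
Proof.
move=> p0; have pn0 : p != 0 by rewrite gt_eqF.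
set S := \sum_(i < n) _ `^ p.
have S0 : 0 <= S by apply: sumr_ge0 => i _; exact: powR_ge0.
apply: (@le_trans _ _ ((n%:R * S `^ p^-1) `^ p)); last first.
  by rewrite powRM ?powR_ge0// powRVK.
apply: ge0_ler_powR; rewrite ?nnegrE ?enorm_ge0 ?mulr_ge0 ?powR_ge0//; first exact: ltW.
apply: le_trans (enorm_le_sum v) _.
apply: le_trans (_ : \sum_(i < n) S `^ p^-1 <= _); last first.
  by rewrite sumr_const card_ord mulr_natl.
apply: ler_sum => i _; rewrite -[leLHS](@powRK _ _ p)//.
apply: ge0_ler_powR; rewrite ?nnegrE ?powR_ge0 ?invr_ge0 ?(ltW p0)//.
by rewrite /S (bigD1 i)//= lerDl; apply: sumr_ge0 => j _; exact: powR_ge0.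
Qed.

Lemma enorm_continuous : continuous (@enorm R n).
Proof.
move=> v; apply: continuous_comp; last exact: sqrt_continuous.
have -> : (fun v : Rn => \sum_(i < n) v ord0 i ^+ 2) =
    \sum_(i < n) (fun v : Rn => v ord0 i ^+ 2) :> (Rn -> R).
  by apply/funext => x; rewrite fct_sumE.
apply: (big_ind (fun f : Rn -> R => {for v, continuous f})).
- exact: cst_continuous.
- by move=> f g cf cg; exact: continuousD.
- move=> i _; apply: (@continuous_comp _ _ _ (fun v : Rn => v ord0 i) (fun x => x ^+ 2)).
    exact: coord_continuous.
  exact: exprn_continuous.
Qed.

Lemma measurable_enorm D (G : Rn -> Rn) :
  (forall i, measurable_fun D (fun x => G x ord0 i)) ->
  measurable_fun D (fun x => enorm (G x)).
Proof.
move=> mG; have ms : measurable_fun setT (@Num.sqrt R).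
  by apply: continuous_measurable_fun; exact: sqrt_continuous.
apply: (measurableT_comp ms (g := fun x => \sum_(i < n) G x ord0 i ^+ 2)).
by apply: measurable_sum => i; exact: measurable_funX.
Qed.

End enorm_facts.

(** * Weak gradients *)

Section weak_gradient.
Variables (R : realType) (n : nat) (Om : set 'rV[R]_n).
Local Notation Rn := 'rV[R]_n.
Local Notation leb := (@lebesgue_rV R n).
Hypothesis oOm : open Om.
Implicit Types (u v : Rn -> R) (G H : Rn -> Rn) (p a b : R).

Let mOm : measurable Om. Proof. exact: open_rV_measurable. Qed.

(** An open set is a countable union of compact boxes, and local integrability includes
    measurability on each of them. *)
Lemma loc_integrable_measurable u : loc_integrable Om u -> measurable_fun Om u.
Proof.
move=> iu; have [D [a [b [abO OmE]]]] := open_rV_boxes oOm.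
have {}OmE : Om = \bigcup_k (if `[< D k >] then closed_box (a k) (b k) else set0).
  apply/seteqP; split => x; last first.
    by move=> [k _]; case: asboolP => // Dk; exact: abO.
  rewrite {1}OmE => -[k Dk xk]; exists k => //; rewrite asboolT// => i.
  by have /andP[/ltW -> /ltW ->] := xk i.
rewrite OmE; apply/measurable_fun_bigcup => k.
  by case: asboolP => _; [exact: measurable_closed_box|exact: measurable0].
case: asboolP => Dk; last exact: measurable_fun_set0.
apply/measurable_EFinP; apply: measurable_int (iu _ _ (abO _ Dk)).
exact: closed_box_compact.
Qed.

Lemma loc_integrable_lin a b u v : loc_integrable Om u -> loc_integrable Om v ->
  loc_integrable Om (fun x => a * u x + b * v x).
Proof.
move=> iu iv K cK KO; have mK := compact_rV_measurable cK.
by apply: integrableDR => //; apply: integrableZR => //; [exact: iu|exact: iv].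
Qed.

Lemma ae_ord_forall (P : 'I_n -> Rn -> Prop) :
  (forall i, {ae leb, forall x, P i x}) -> {ae leb, forall x, forall i, P i x}.
Proof.
move=> h; have : {ae leb, forall x, forall k (kn : (k < n)%N), P (Ordinal kn) x}.
  apply/ae_foralln => k; have [kn|nkn] := pselect (k < n)%N; last exact: aeW.
  apply: filterS (h (Ordinal kn)) => x Px kn'.
  by rewrite (_ : Ordinal kn' = Ordinal kn)//; exact: val_inj.
by apply: filterS => x Px [k kn].
Qed.

Lemma test_function_support phi : test_function Om phi ->
  exists K : set Rn, [/\ compact K, K `<=` Om, forall x, ~ K x -> phi x = 0,
    continuous phi & forall i, continuous (partial i phi) /\
      forall x, ~ K x -> partial i phi x = 0].
Proof.
move=> [sphi [K [cK KO phi0]]]; exists K; split => //; first by have [] := sphi [::].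
move=> i; split; first by have [] := sphi [:: i].
move=> x Kx; rewrite /partial.
have [_ ->//] : is_derive x (delta_mx ord0 i) phi 0.
apply: (@near_eq_is_derive _ _ _ (cst 0)).
have oK : open (~` K) by rewrite openC; apply: compact_closed => //; exact: norm_hausdorff.
have := open_nbhs_nbhs (conj oK Kx).
by apply: filterS => y Ky; rewrite /= phi0.
Qed.

Lemma weak_grad_lin a b u v G H : is_weak_grad Om u G -> is_weak_grad Om v H ->
  is_weak_grad Om (fun x => a * u x + b * v x) (fun x => a *: G x + b *: H x).
Proof.
move=> [iu iG uG] [iv iH vH]; split.
- exact: loc_integrable_lin.
- move=> i; rewrite (_ : (fun x => _) = fun x => a * G x ord0 i + b * H x ord0 i).
    exact: loc_integrable_lin.
  by apply/funext => x; rewrite !mxE.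
move=> phi tphi i.
have [K [cK KO phi0 cphi dphi]] := test_function_support tphi.
have [cdphi dphi0] := dphi i.
have I (w psi : Rn -> R) : loc_integrable Om w -> continuous psi ->
    (forall x, ~ K x -> psi x = 0) -> leb.-integrable Om (EFin \o (fun x => w x * psi x)).
  by move=> iw cpsi psi0; apply: integrableS (test_integrable iw cpsi cK KO psi0).
have L (w1 w2 psi : Rn -> R) : loc_integrable Om w1 -> loc_integrable Om w2 ->
    continuous psi -> (forall x, ~ K x -> psi x = 0) ->
    (\int[leb]_(x in Om) ((a * w1 x + b * w2 x) * psi x) =
     a * \int[leb]_(x in Om) (w1 x * psi x) + b * \int[leb]_(x in Om) (w2 x * psi x))%R.
  move=> iw1 iw2 cpsi psi0.
  rewrite -!RintegralZl ?I// -RintegralD//; try by apply: integrableZR => //; exact: I.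
  by apply: eq_Rintegral => x _; ring.
rewrite L// uG// vH//.
rewrite (_ : (fun x => (a *: G x + b *: H x) ord0 i * phi x) =
  fun x => (a * G x ord0 i + b * H x ord0 i) * phi x); last first.
  by apply/funext => x; rewrite !mxE.
by rewrite L//; ring.
Qed.

(** The difference of two weak gradients is a weak gradient of zero, hence orthogonal to all test
    functions. *)
Lemma weak_grad_unique u G H : is_weak_grad Om u G -> is_weak_grad Om u H ->
  {ae leb, forall x, Om x -> G x = H x}.
Proof.
move=> uG uH.
have [iu0 iGH E] := weak_grad_lin 1 (-1) uG uH.
have : {ae leb, forall x, forall i, Om x -> (1 *: G x + -1 *: H x) ord0 i = 0}.
  apply: ae_ord_forall => i; apply: du_bois_reymond => // phi tphi.
  have := E phi tphi i.
  rewrite (_ : (fun x => (1 * u x + -1 * u x) * _) = cst 0); last first.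
    by apply/funext => x /=; ring.
  rewrite Rintegral_cst ?mul0r//.
  by move/eqP; rewrite eq_sym oppr_eq0 => /eqP.
apply: filterS => x h Ox; apply/rowP => i.
by have := h i Ox; rewrite !mxE mul1r mulN1r => /eqP; rewrite subr_eq0 => /eqP.
Qed.

Lemma wgradP u : (exists G, is_weak_grad Om u G) -> is_weak_grad Om u (wgrad Om u).
Proof. exact: xgetPex. Qed.

Lemma wgrad_ae u G : is_weak_grad Om u G -> {ae leb, forall x, Om x -> wgrad Om u x = G x}.
Proof. by move=> uG; apply: weak_grad_unique (uG); apply: wgradP; exists G. Qed.

Definition grad_energy p u : R := Lp_energy Om p (fun x => enorm (wgrad Om u x)).

Lemma Lp_enorm p G : 1 <= p -> (forall i, Lp Om p (fun x => G x ord0 i)) ->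
  Lp Om p (fun x => enorm (G x)).
Proof.
move=> p1 hG; have p0 : 0 < p by rewrite (lt_le_trans _ p1).
have hG' i := (LpP mOm (fun x => G x ord0 i) p1).1 (hG i).
have iS : leb.-integrable Om (EFin \o (fun x => n%:R `^ p * \sum_(i < n) `|G x ord0 i| `^ p)).
  apply: integrableZR => //.
  rewrite (_ : _ \o _ = (fun x => \sum_(i < n) (`|G x ord0 i| `^ p)%:E)%E); last first.
    by apply/funext => x; rewrite /= sumEFin.
  by apply: integrable_sum => // i _; have [] := hG' i.
have mG : measurable_fun Om (fun x => enorm (G x)).
  by apply: measurable_enorm => i; have [] := hG' i.
have [|//] := Lp_le mOm p1 mG iS.
by move=> x _; rewrite (ger0_norm (enorm_ge0 _)); exact: enorm_powR_le.
Qed.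

Lemma Lp_ae p u v : 1 <= p -> Lp Om p u -> measurable_fun Om v ->
  {ae leb, forall x, Om x -> u x = v x} -> Lp Om p v.
Proof.
move=> p1 /(LpP mOm _ p1)[mu iu] mv uv; apply/(LpP mOm _ p1); split => //.
have mv' := measurable_powR_norm p mv; apply/integrableP; split => //.
have /integrableP[mu' hu] := iu.
rewrite -(@ae_eq_integral _ _ _ leb Om (abse \o (EFin \o (fun x => `|v x| `^ p)))
  (abse \o (EFin \o (fun x => `|u x| `^ p))) mOm).
- exact: hu.
- exact: (measurableT_comp (@abse_measurable R setT) mu').
- exact: (measurableT_comp (@abse_measurable R setT) mv').
- by apply: filterS uv => x h Ox; rewrite /= h.
Qed.

Lemma weak_grad_measurable u G i : is_weak_grad Om u G -> measurable_fun Om (fun x => G x ord0 i).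
Proof. by move=> [_ iG _]; exact: loc_integrable_measurable. Qed.

Lemma weak_grad_Sobolev p u G : 1 <= p -> Lp Om p u -> is_weak_grad Om u G ->
  (forall i, Lp Om p (fun x => G x ord0 i)) ->
  Sobolev Om p u /\ grad_energy p u = Lp_energy Om p (fun x => enorm (G x)).
Proof.
move=> p1 pu uG pG; have uW := wgradP (ex_intro _ G uG).
have WG := wgrad_ae uG; split.
  split => //; first by exists G.
  move=> i; apply: (Lp_ae p1 (pG i)); first exact: weak_grad_measurable uW.
  by apply: filterS WG => x h Ox; rewrite h.
apply: ae_Lp_energy => //.
- by apply: measurable_enorm => i; exact: weak_grad_measurable uW.
- by apply: measurable_enorm => i; exact: weak_grad_measurable uG.
- by apply: filterS WG => x h Ox; rewrite h.
Qed.

Lemma Sobolev_lin p a b u v : 1 <= p -> Sobolev Om p u -> Sobolev Om p v ->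
  Sobolev Om p (fun x => a * u x + b * v x) /\
  grad_energy p (fun x => a * u x + b * v x) =
    Lp_energy Om p (fun x => enorm (a *: wgrad Om u x + b *: wgrad Om v x)).
Proof.
move=> p1 [pu eu pGu] [pv ev pGv].
apply: weak_grad_Sobolev => //.
- by have [] := Lp_lin mOm a b p1 pu pv.
- by apply: weak_grad_lin; exact: wgradP.
- move=> i; have [+ _] := Lp_lin mOm a b p1 (pGu i) (pGv i).
  by congr (Lp _ _ _); apply/funext => x; rewrite !mxE.
Qed.

Lemma Sobolev_normE p u : 1 <= p -> Sobolev Om p u ->
  Sobolev_norm Om p u = ((Lp_energy Om p u + grad_energy p u) `^ p^-1)%:E.
Proof.
move=> p1 Su; have [pu eu pGu] := Su; have p0 : p != 0 by rewrite gt_eqF// (lt_le_trans _ p1).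
have pG := Lp_enorm p1 pGu.
rewrite /Sobolev_norm asboolT// /Lp_norm_grad (Lp_normE mOm p1 pu) (Lp_normE mOm p1 pG).
have E w : ((Lp_energy Om p w `^ p^-1)%:E `^ p = (Lp_energy Om p w)%:E)%E.
  by rewrite poweR_EFin (powRVK (Lp_energy_ge0 _ _ _) p0).
exact: (f_equal (fun z => z `^ p^-1)%E (f_equal2 (fun y z => y + z)%E (E u)
  (E (fun x => enorm (wgrad Om u x))))).
Qed.

Lemma Sobolev_norm_lt p u e : 1 <= p -> (Sobolev_norm Om p u < e%:E)%E ->
  Sobolev Om p u /\ Lp_energy Om p u + grad_energy p u < e `^ p.
Proof.
move=> p1 he; have p0 : 0 < p by rewrite (lt_le_trans _ p1).
have Su : Sobolev Om p u.
  by move: he; rewrite /Sobolev_norm; case: asboolP.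
split => //; move: he; rewrite Sobolev_normE// lte_fin => he.
have S0 : 0 <= Lp_energy Om p u + grad_energy p u by rewrite addr_ge0// Lp_energy_ge0.
rewrite -[ltLHS](@powRVK _ _ p) ?gt_eqF//.
apply: gt0_ltr_powR; rewrite ?nnegrE ?powR_ge0//.
by rewrite (le_trans _ (ltW he))// powR_ge0.
Qed.

End weak_gradient.

(** * The Poincare inequality *)

Section integration_by_parts.
Variables (R : realType) (n : nat).
Local Notation Rn := 'rV[R]_n.
Local Notation leb := (@lebesgue_rV R n).

Lemma is_derive_line_at (u : Rn -> R) (x v : Rn) (t d : R) :
  is_derive (t *: v + x) v u d -> is_derive t 1 (fun s : R => u (s *: v + x)) d.
Proof.
move=> /is_derive_line du.
rewrite (_ : (fun s => _) = (fun r : R => u (r *: v + (t *: v + x))) \o (fun s : R => s - t)).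
  have ds : is_derive t (1 : R) (fun s : R => s - t) 1.
    by have := is_deriveB (is_derive_id t (1 : R)) (is_derive_cst t t (1 : R)); rewrite subr0.
  rewrite -[d]mulr1; apply: is_derive1_comp ds.
  by rewrite subrr.
by apply/funext => s /=; rewrite addrA -scalerDl subrK.
Qed.

Lemma derive_lip (u u' : Rn -> R) (x v : Rn) (M h : R) :
  (forall y, is_derive y v u (u' y)) -> (forall y, `|u' y| <= M) -> 0 < h ->
  `|u (h *: v + x) - u x| <= M * h.
Proof.
move=> du bu h0.
have dl t : is_derive t (1 : R) (fun s : R => u (s *: v + x)) (u' (t *: v + x)).
  exact: is_derive_line_at.
have [|c _] := @MVT _ (fun s : R => u (s *: v + x)) (fun s => u' (s *: v + x)) 0 h h0 (fun t _ => dl t).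
  apply: continuous_subspaceT => t; apply: differentiable_continuous.
  by apply/derivable1_diffP; have [] := dl t.
rewrite scale0r add0r subr0 => ->; rewrite normrM (gtr0_norm h0).
by rewrite ler_wpM2r// ltW.
Qed.

Lemma harmonic_dnbhs : @harmonic R @ \oo --> (0 : R)^'.
Proof.
move=> A hA.
have h : \forall k \near \oo, @harmonic R k != 0 -> A (harmonic k) 
  by exact: (@cvg_harmonic R [set x | x != 0 -> A x] hA).
suff : \forall k \near \oo, A (@harmonic R k) by [].
by apply: filterS h => k hk; apply: hk; rewrite invr_eq0 pnatr_eq0.
Qed.

Lemma derive_cvg (u : Rn -> R) (x v : Rn) (d : R) : is_derive x v u d ->
  (k.+1%:R * (u (k.+1%:R^-1 *: v + x) - u x)) @[k --> \oo] --> d.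
Proof.
move=> [du dE]; have : (h^-1 *: ((u \o shift x) (h *: v) - u x)) @[h --> 0^'] --> d.
  by rewrite -dE.
move=> /(cvg_comp _ _ harmonic_dnbhs).
rewrite (_ : _ \o _ = fun k => k.+1%:R * (u (k.+1%:R^-1 *: v + x) - u x))//.
by apply/funext => k /=; rewrite invrK.
Qed.

Lemma loc_integrable_cst (Om : set Rn) (c : R) : loc_integrable Om (fun=> c).
Proof.
move=> K cK _; apply/integrableP; split; first exact: measurable_cst.
under eq_integral do rewrite /=.
rewrite integral_cst; last exact: compact_rV_measurable.
apply: lte_mul_pinfty => //; apply: bounded_rV_fin; first exact: compact_rV_measurable.
exact: compact_bounded.
Qed.

Lemma continuous_compact_support (psi : Rn -> R) (K : set Rn) : continuous psi ->
  compact K -> (forall x, ~ K x -> psi x = 0) -> leb.-integrable setT (EFin \o psi).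
Proof.
move=> cpsi cK psi0.
have := test_integrable (loc_integrable_cst (Om := setT) 1) cpsi cK (@subsetT _ _) psi0.
by congr (integrable _ _ _); apply/funext => x /=; rewrite mul1r.
Qed.

(** By translation invariance every difference quotient of [psi] has zero integral. The quotients
    tend to [psi'] and are dominated by [M] on a bounded box, so the limit has zero integral too; no
    Fubini argument is required. *)
Lemma integral_partial0 (psi psi' : Rn -> R) (i : 'I_n) (K : set Rn) (M : R) :
  continuous psi -> compact K -> (forall x, ~ K x -> psi x = 0) ->
  (forall x, is_derive x (delta_mx ord0 i) psi (psi' x)) -> (forall x, `|psi' x| <= M) ->
  leb.-integrable setT (EFin \o psi') /\ (\int[leb]_x psi' x = 0)%R.
Proof.
move=> cpsi cK psi0 dpsi bpsi.
have M0 : 0 <= M by apply: le_trans (bpsi 0).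
have [N N0 KN] := bounded_rV_box (compact_bounded cK).
(* The increments have length 1/(k+1), at most 1, so the box enlarged by 1 contains the supports of
   all quotients. *)
pose Q : set Rn := closed_box (const_mx (- (N + 1))) (const_mx (N + 1)).
have cQ : compact Q by exact: closed_box_compact.
have mQ : measurable Q by exact: compact_rV_measurable.
pose e : Rn := delta_mx ord0 i.
pose g k x : R := k.+1%:R * (psi (k.+1%:R^-1 *: e + x) - psi x).
have ipsi := continuous_compact_support cpsi cK psi0.
have mg k : measurable_fun setT (g k).
  apply: measurable_funM => //; apply: measurable_funB; apply: continuous_rV_measurable => //.
  move=> x; apply: (@continuous_comp _ _ _ (fun x : Rn => k.+1%:R^-1 *: e + x) psi); last exact: cpsi.
  by apply: (@cvgD _ Rn _ (nbhs x) _ (cst (k.+1%:R^-1 *: e)) id (k.+1%:R^-1 *: e) x); [exact: cvg_cst|exact: cvg_id].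
have cg x : g k x @[k --> \oo] --> psi' x by exact: derive_cvg.
have mpsi' : measurable_fun setT psi'.
  exact: (measurable_fun_cvg (h := g) mg (fun x _ => cg x)).
have ig k : (\int[leb]_x g k x = 0)%R.
  have [ish sE] := integral_shift_rV (k.+1%:R^-1 *: e) ipsi.
  rewrite (_ : g k = fun x => k.+1%:R * ((psi \o shift_rV (k.+1%:R^-1 *: e)) x - psi x)).
    rewrite RintegralZl//; last exact: (integrableB measurableT ish ipsi).
    by rewrite RintegralB// sE subrr mulr0.
  by apply/funext => x; rewrite /g /shift_rV/= [x + _]addrC.
have iQ : leb.-integrable setT (EFin \o (fun x => M * \1_Q x)).
  have /(integrable_mkcond _ mQ) := loc_integrable_cst (Om := setT) M cQ (@subsetT _ _).
  congr (integrable _ _ _); apply/funext => x; rewrite /patch/= indicE.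
  by case: ifP => _; rewrite ?mulr1 ?mulr0.
have gQ x k : `|g k x| <= M * \1_Q x.
  have [Qx|Qx] := pselect (Q x).
    rewrite indicE mem_set// mulr1 /g normrM ger0_norm// -ler_pdivlMl ?ltr0n//.
    by rewrite mulrC; apply: derive_lip dpsi bpsi _; rewrite invr_gt0.
  rewrite indicE memNset// mulr0 /g (psi0 x) ?psi0 ?subrr ?mulr0 ?normr0//.
    move=> /KN xN; apply: Qx => j; have := xN j; rewrite !mxE.
    rewrite -[X in _ + X < _]mul1r.
    set t := k.+1%:R^-1 * _ => /andP[t1 t2].
    have : `|t| <= 1.
      rewrite /t; case: (_ == _); case: (_ == _); rewrite /= ?mulr0 ?normr0// mulr1.
      by rewrite ger0_norm// invf_le1 ?ler1n.
    by rewrite ler_norml => /andP[t3 t4]; apply/andP; split; lra.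
  move=> /KN xN; apply: Qx => j; have := xN j; rewrite !mxE => /andP[t1 t2].
  by apply/andP; split; lra.
have [ipsi' c] := @Rintegral_dominated _ _ _ leb setT g psi' _ measurableT mg mpsi'
   (aeW _ (fun x _ => cg x)) iQ (aeW _ (fun x k _ => gQ x k)).
split=> //; apply/esym; move: c.
rewrite (_ : (fun k => _) = cst 0); last by apply/funext.
by move=> /cvg_unique -/(_ (@norm_hausdorff _ _) _ (cvg_cst 0)).
Qed.

End integration_by_parts.

Section norm_power.
Variable R : realType.
Implicit Types (p t : R).

Definition dnorm_powR p t : R := p * (`|t| `^ (p - 1) * Num.sg t).

Lemma norm_dnorm_powR p t : 1 < p -> `|dnorm_powR p t| <= p * `|t| `^ (p - 1).
Proof.
move=> p1; rewrite normrM (gtr0_norm (lt_trans ltr01 p1)) ler_wpM2l//.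
  by rewrite ltW// (lt_trans ltr01).
rewrite normrM (ger0_norm (powR_ge0 _ _)) ler_piMr ?powR_ge0//.
by rewrite normr_sg; case: (t != 0).
Qed.

Lemma is_derive_norm_powR p t : 1 < p ->
  is_derive t 1 (fun s : R => `|s| `^ p) (dnorm_powR p t).
Proof.
move=> p1; have p0 : p != 0 by rewrite gt_eqF// (lt_trans ltr01).
have q0 : 0 < p - 1 by rewrite subr_gt0.
have [t0|t0|->] := ltgtP t 0.
- apply: (@near_eq_is_derive _ _ _ ((fun s : R => s `^ p) \o (fun s : R => - s))).
    near=> s; have s0 : s < 0 by near: s; exact: lt_nbhsl.
    by rewrite /= ltr0_norm.
  have nt0 : 0 < - t by rewrite oppr_gt0.
  apply: is_derive_eq (is_derive1_comp (is_derive1_powR p nt0) (is_deriveN (is_derive_id t 1))) _.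
  by rewrite /dnorm_powR ltr0_sg// ltr0_norm// mulrA.
- apply: (@near_eq_is_derive _ _ _ (fun s : R => s `^ p)).
    near=> s; have s0 : 0 < s by near: s; exact: lt_nbhsr.
    by rewrite /= gtr0_norm.
  apply: is_derive_eq (is_derive1_powR p t0) _.
  by rewrite /dnorm_powR gtr0_sg// gtr0_norm// mulr1.
- apply/is_derive1_caratheodory.
  exists (fun z => `|z| `^ (p - 1) * Num.sg z); split.
  + move=> z; rewrite normr0 powR0// !subr0 -mulrA -normrEsg mulrC.
    by rewrite mulr_powRB1// (lt_trans ltr01).
  + rewrite /prop_for /continuous_at sgr0 mulr0.
    apply/cvgrPdist_le => e e0; near=> z; rewrite sub0r normrN normrM (ger0_norm (powR_ge0 _ _)).
    apply: (@le_trans _ _ (`|z| `^ (p - 1))).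
      by rewrite ler_piMr ?powR_ge0// normr_sg; case: (z != 0).
    have ze : `|z| <= e `^ (p - 1)^-1.
      by near: z; apply: (@nbhs0_le R R); exact: powR_gt0.
    apply: le_trans (_ : (e `^ (p - 1)^-1) `^ (p - 1) <= _).
      by apply: ge0_ler_powR => //; rewrite ?nnegrE ?powR_ge0// ltW.
    by rewrite -powRrM mulVf ?gt_eqF// powRr1// ltW.
  + by rewrite sgr0 mulr0 /dnorm_powR sgr0 !mulr0.
Unshelve. all: by end_near. Qed.

Lemma norm_powR_continuous p : 1 < p -> continuous (fun s : R => `|s| `^ p).
Proof.
move=> p1 t; apply: differentiable_continuous; apply/derivable1_diffP.
by have [] := is_derive_norm_powR t p1.
Qed.

(* Either [b] is at most a small multiple of [a], or [a] is at most a multiple of [b]. *)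
Lemma young_absorb p M : 1 < p -> 0 < M -> exists2 C : R, 0 <= C &
  forall a b : R, 0 <= a -> 0 <= b -> M * (p * a `^ (p - 1)) * b <= 2^-1 * a `^ p + C * b `^ p.
Proof.
move=> p1 M0; have p0 : 0 < p by rewrite (lt_trans ltr01).
have k0 : 0 < 2 * M * p by rewrite !mulr_gt0.
have q0 : 0 < p - 1 by rewrite subr_gt0.
exists (M * p * (2 * M * p) `^ (p - 1)).
  by rewrite !mulr_ge0 ?powR_ge0 ?ltW.
move=> a b a0 b0; have [ba|ab] := leP (b * (2 * M * p)) a.
  apply: (@le_trans _ _ (2^-1 * a `^ p)); last first.
    by rewrite lerDl !mulr_ge0 ?powR_ge0 ?ltW.
  rewrite -(mulr_powRB1 a0 p0).
  have := ler_wpM2r (powR_ge0 a (p - 1)) ba.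
  by set w := a `^ _ => h; lra.
apply: (@le_trans _ _ (M * p * (2 * M * p) `^ (p - 1) * b `^ p)); last first.
  by rewrite lerDr mulr_ge0 ?powR_ge0.
have h : a `^ (p - 1) <= (2 * M * p) `^ (p - 1) * b `^ (p - 1).
  have E : (2 * M * p * b) `^ (p - 1) = (2 * M * p) `^ (p - 1) * b `^ (p - 1).
    by apply: powRM => //; exact: ltW.
  rewrite -E.
  apply: ge0_ler_powR; rewrite ?nnegrE ?(ltW q0)//.
    by rewrite mulr_ge0// ltW.
  by rewrite mulrC ltW.
rewrite -(mulr_powRB1 b0 p0).
have Mpb : 0 <= M * p * b by apply: mulr_ge0 => //; apply: mulr_ge0; exact: ltW.
have := ler_wpM2l Mpb h; set w := a `^ _; set w1 := (_ * _) `^ _; set w2 := b `^ _.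
have -> : M * p * b * (w1 * w2) = M * p * w1 * (b * w2) by ring.
by have -> : M * p * b * w = M * (p * w) * b by ring.
Qed.

End norm_power.

Section poincare_test.
Variables (R : realType) (n : nat).
Local Notation Rn := 'rV[R]_n.
Local Notation leb := (@lebesgue_rV R n).
Implicit Types (u phi eta : Rn -> R) (Om K : set Rn) (p : R).

Lemma is_derive_comp_line (f : R -> R) u (x v : Rn) (d d' : R) :
  is_derive x v u d -> is_derive (u x) 1 f d' -> is_derive x v (f \o u) (d' * d).
Proof.
move=> /is_derive_line du df; apply/is_derive_line.
apply: (@is_derive1_comp R f (fun t : R => u (t *: v + x))) => //.
by rewrite scale0r add0r.
Qed.

Lemma is_derive_coord (x : Rn) i :
  is_derive x (delta_mx ord0 i) (fun y : Rn => y ord0 i) 1.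
Proof.
apply/is_derive_line.
rewrite (_ : (fun t => _) = fun t : R => t + x ord0 i); last first.
  by apply/funext => t; rewrite !mxE !eqxx mulr1.
by have := is_deriveD (is_derive_id (0 : R) (1 : R)) (is_derive_cst (x ord0 i) (0 : R) (1 : R));
  rewrite addr0.
Qed.

Lemma bounded_support u K : continuous u -> compact K -> (forall x, ~ K x -> u x = 0) ->
  exists2 B : R, 0 <= B & forall x, `|u x| <= B.
Proof.
move=> cu cK u0; have [K0|/set0P K0] := eqVneq K set0.
  by exists 0 => // x; rewrite u0 ?normr0// K0.
have [|c _ hc] := @compact_EVT_max _ _ (fun x => `|u x|) K K0 cK.
  apply: continuous_subspaceT => x; apply: (continuous_comp (cu x)).
  exact: norm_continuous.
exists `|u c| => // x; have [Kx|Kx] := pselect (K x); first by apply: hc; rewrite inE.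
by rewrite u0// normr0.
Qed.

Lemma test_derivable Om phi i x : test_function Om phi ->
  is_derive x (delta_mx ord0 i) phi (partial i phi x).
Proof. by move=> [/(_ [::])[_ h] _]; split=> //; exact: h. Qed.

Definition cgrad phi (x : Rn) : Rn := \row_i partial i phi x.

Lemma continuous_loc_integrable Om u : continuous u -> loc_integrable Om u.
Proof.
move=> cu K cK KO; have mK := compact_rV_measurable cK.
have [K0|/set0P K0] := eqVneq K set0.
  by apply/integrableP; rewrite K0 integral_set0; split=> //; exact: measurable_fun_set0.
have [|c _ hc] := @compact_EVT_max _ _ (fun x => `|u x|) K K0 cK.
  apply: continuous_subspaceT => x; apply: (continuous_comp (cu x)).
  exact: norm_continuous.
apply: (@le_integrable _ _ _ leb _ mK _ (EFin \o cst `|u c|)).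
- by apply/measurable_EFinP; exact: continuous_rV_measurable.
- by move=> x Kx /=; rewrite lee_fin normr_id; apply: hc; rewrite inE.
- exact: loc_integrable_cst KO.
Qed.

Lemma test_weak_grad Om phi : test_function Om phi -> is_weak_grad Om phi (cgrad phi).
Proof.
move=> tphi; have [K [cK KO phi0 cphi dphi]] := test_function_support tphi.
split; first exact: continuous_loc_integrable.
  move=> i; rewrite (_ : (fun x => _) = partial i phi).
    by apply: continuous_loc_integrable; have [] := dphi i.
  by apply/funext => x; rewrite mxE.
move=> eta teta i; have [K' [cK' KO' eta0 ceta deta]] := test_function_support teta.
have [cdphi dphi0] := dphi i; have [cdeta deta0] := deta i.
have [B B0 bphi] := bounded_support cphi cK phi0.
have [B1 B10 beta] := bounded_support ceta cK' eta0.
have [B2 B20 bdphi] := bounded_support cdphi cK dphi0.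
have [B3 B30 bdeta] := bounded_support cdeta cK' deta0.
have [|||||_ E] := @integral_partial0 _ _ (phi * eta)
  (fun x => phi x * partial i eta x + eta x * partial i phi x) i K (B * B3 + B1 * B2).
- by move=> x; apply: continuousM; [exact: cphi|exact: ceta].
- by [].
- by move=> x Kx; rewrite [LHS](_ : _ = phi x * eta x)// phi0// mul0r.
- by move=> x; exact: is_deriveM (test_derivable i x tphi) (test_derivable i x teta).
- move=> x; apply: le_trans (ler_normD _ _) _.
  by rewrite !normrM lerD// ler_pM.
rewrite (Rintegral_test _ KO' deta0) (@Rintegral_test _ _ Om _ eta K')//.
under [X in _ = - X]eq_Rintegral do rewrite mxE.
have I1 := test_integrable (continuous_loc_integrable (Om := Om) cphi) cdeta cK' KO' deta0.
have I2 := test_integrable (continuous_loc_integrable (Om := Om) ceta) cdphi cK KO dphi0.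
move: E; rewrite RintegralD// => /eqP; rewrite addr_eq0 => /eqP ->; congr (- _).
by apply: eq_Rintegral => x _; rewrite mulrC.
Qed.

(** The i-th derivative of x_i |phi|^p has zero integral, so the integral of |phi|^p equals minus
    that of x_i times the derivative of |phi|^p. As |x_i| < [M] on [Om], [young_absorb] bounds this
    by half of the left-hand side plus C |d_i phi|^p; absorbing the half yields the constant 2C. *)
Lemma poincare_test Om p (M : R) (i : 'I_n) : measurable Om -> 1 < p -> 0 < M ->
  Om `<=` open_box (const_mx (- M)) (const_mx M) ->
  exists2 C : R, 0 <= C & forall phi, test_function Om phi ->
    Lp_energy Om p phi <= C * Lp_energy Om p (partial i phi).
Proof.
move=> mOm p1 M0 OM; have [C C0 hC] := young_absorb p1 M0.
have p0 : p != 0 by rewrite gt_eqF// (lt_trans ltr01).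
exists (2 * C); first by rewrite mulr_ge0.
move=> phi tphi; have [K [cK KO phi0 cphi dphi]] := test_function_support tphi.
have [cdphi dphi0] := dphi i.
have [B B0 bphi] := bounded_support cphi cK phi0.
have [B1 B10 bdphi] := bounded_support cdphi cK dphi0.
pose q x := `|phi x| `^ p; pose q' x := `|partial i phi x| `^ p.
have cq : continuous q.
  by move=> x; apply: (@continuous_comp Rn R R phi (fun s : R => `|s| `^ p) x (cphi x)); exact: (norm_powR_continuous p1).
have cq' : continuous q'.
  by move=> x; apply: (@continuous_comp Rn R R (partial i phi) (fun s : R => `|s| `^ p) x (cdphi x)); exact: (norm_powR_continuous p1).
have q0 x : ~ K x -> q x = 0 by move=> Kx; rewrite /q phi0// normr0 powR0.
have q'0 x : ~ K x -> q' x = 0 by move=> Kx; rewrite /q' dphi0// normr0 powR0.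
pose g (x : Rn) := x ord0 i * (dnorm_powR p (phi x) * partial i phi x).
have gle x : `|g x| <= 2^-1 * q x + C * q' x.
  have [Kx|Kx] := pselect (K x); last first.
    by rewrite /g dphi0// !mulr0 normr0 q0// q'0// !mulr0 addr0.
  apply: le_trans (hC `|phi x| `|partial i phi x| (normr_ge0 _) (normr_ge0 _)).
  rewrite /g 2!normrM mulrA ler_wpM2r//; apply: ler_pM => //; last exact: norm_dnorm_powR.
  by have := OM _ (KO _ Kx) i; rewrite !mxE -ltr_norml; exact: ltW.
have qB x : `|q x| <= B `^ p.
  rewrite (ger0_norm (powR_ge0 _ _)); apply: ge0_ler_powR; rewrite ?nnegrE//.
  by rewrite ltW// (lt_trans ltr01).
have q'B x : `|q' x| <= B1 `^ p.
  rewrite (ger0_norm (powR_ge0 _ _)); apply: ge0_ler_powR; rewrite ?nnegrE//.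
  by rewrite ltW// (lt_trans ltr01).
have [|||||ig E] := @integral_partial0 _ _ ((fun x : Rn => x ord0 i) * q)
  (fun x => g x + q x) i K (2^-1 * B `^ p + C * B1 `^ p + B `^ p).
- by move=> x; apply: continuousM; [exact: coord_continuous|exact: cq].
- by [].
- by move=> x Kx; rewrite [LHS](_ : _ = x ord0 i * q x)// q0// mulr0.
- move=> x.
  have dq := is_derive_comp_line (test_derivable i x tphi) (is_derive_norm_powR (phi x) p1).
  apply: is_derive_eq (is_deriveM (is_derive_coord x i) dq) _.
  by rewrite /g /q /GRing.scale/= mulr1.
- move=> x; apply: le_trans (ler_normD _ _) _; rewrite lerD//.
  apply: le_trans (gle x) _; rewrite lerD// ler_wpM2l//.
    exact: le_trans (ler_norm _) (qB x).
  exact: le_trans (ler_norm _) (q'B x).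
have iq := continuous_compact_support cq cK q0.
have iq' := continuous_compact_support cq' cK q'0.
have ig' : leb.-integrable setT (EFin \o g).
  have := integrableB measurableT ig iq; congr (integrable _ _ _).
  by apply/funext => x /=; rewrite -EFinB addrK.
have restr (h : Rn -> R) : (forall x, ~ K x -> h x = 0) ->
    (\int[leb]_(x in Om) h x = \int[leb]_x h x)%R.
  move=> h0; rewrite Rintegral_mkcond; apply: eq_Rintegral => x _; rewrite /patch.
  by case: ifPn => // /negP; rewrite inE => Ox; rewrite h0//; exact: contra_not (KO x) Ox.
rewrite /Lp_energy !restr//.
move: E; rewrite RintegralD// => /eqP; rewrite addr_eq0 => /eqP E.
have : (\int[leb]_x (- g x) <= \int[leb]_x (2^-1 * q x + C * q' x))%R.
  apply: le_Rintegral => //.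
  - have := integrableZR measurableT (-1) ig'; congr (integrable _ _ _).
    by apply/funext => x /=; rewrite mulN1r.
  - by apply: integrableDR => //; apply: integrableZR.
  - by move=> x _; apply: le_trans (gle x); rewrite -normrN; exact: ler_norm.
rewrite RintegralD//; try exact: integrableZR.
rewrite !RintegralZl//.
rewrite (_ : (fun x => - g x) = fun x => -1 * g x); last by apply/funext => x; rewrite mulN1r.
rewrite RintegralZl// E -/q -/q'; lra.
Qed.

End poincare_test.

Section enorm_triangle.
Variables (R : realType) (n : nat).
Local Notation Rn := 'rV[R]_n.
Implicit Types v w : Rn.

Lemma dot_le_enorm v w : \sum_(i < n) v ord0 i * w ord0 i <= enorm v * enorm w.
Proof.
set s := \sum_(i < n) _; set a := enorm v; set b := enorm w.
have a0 : 0 <= a by exact: enorm_ge0.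
have b0 : 0 <= b by exact: enorm_ge0.
have [ab0|ab0] := eqVneq (a * b) 0.
  rewrite ab0 le_eqVlt; apply/orP; left; apply/eqP; apply: big1 => i _.
  move/eqP: ab0; rewrite mulf_eq0 => /orP[/eqP z|/eqP z].
    by have := coord_le_enorm v i; rewrite -/a z normr_le0 => /eqP ->; rewrite mul0r.
  by have := coord_le_enorm w i; rewrite -/b z normr_le0 => /eqP ->; rewrite mulr0.
have ab : 0 < a * b by rewrite lt_def ab0 mulr_ge0.
have : 0 <= \sum_(i < n) (b * v ord0 i - a * w ord0 i) ^+ 2.
  by apply: sumr_ge0 => i _; exact: sqr_ge0.
have -> : \sum_(i < n) (b * v ord0 i - a * w ord0 i) ^+ 2 =
    b ^+ 2 * a ^+ 2 + a ^+ 2 * b ^+ 2 - 2 * (a * b) * s.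
  rewrite [X in b ^+ 2 * X]enorm_sqr [X in a ^+ 2 * X]enorm_sqr /s !mulr_sumr.
  by rewrite -big_split/= -sumrB; apply: eq_bigr => i _; ring.
move=> h; rewrite -(ler_pM2l ab); nra.
Qed.

Lemma enormD v w : enorm (v + w) <= enorm v + enorm w.
Proof.
have h0 : 0 <= enorm v + enorm w by rewrite addr_ge0 ?enorm_ge0.
rewrite -(ler_pXn2r (n := 2))// ?nnegrE ?enorm_ge0//.
rewrite enorm_sqr sqrrD !enorm_sqr.
have -> : \sum_(i < n) (v + w) ord0 i ^+ 2 = \sum_(i < n) v ord0 i ^+ 2 +
   (\sum_(i < n) v ord0 i * w ord0 i) *+ 2 + \sum_(i < n) w ord0 i ^+ 2.
  by rewrite mulr2n -!big_split/=; apply: eq_bigr => i _; rewrite mxE; ring.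
by rewrite lerD2r lerD2l lerMn2r/= dot_le_enorm.
Qed.

Lemma enormZ (a : R) v : enorm (a *: v) = `|a| * enorm v.
Proof.
rewrite /enorm -sqrtr_sqr -sqrtrM ?sqr_ge0//; congr Num.sqrt.
by rewrite mulr_sumr; apply: eq_bigr => i _; rewrite mxE exprMn.
Qed.

Lemma enorm_parallelogram v w :
  enorm (2^-1 *: v + 2^-1 *: w) ^+ 2 =
  (enorm v ^+ 2 + enorm w ^+ 2) / 2 - enorm (v - w) ^+ 2 / 4.
Proof.
rewrite !enorm_sqr -big_split/= !mulr_suml -sumrB; apply: eq_bigr => i _.
by rewrite !mxE; field.
Qed.

End enorm_triangle.

Section smooth_lin.
Variables (R : realType) (n : nat).
Local Notation Rn := 'rV[R]_n.
Implicit Types (u v : Rn -> R).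

Lemma is_derive_lin (a b : R) u v (x e : Rn) : derivable u x e -> derivable v x e ->
  is_derive x e (fun y => a * u y + b * v y) (a * 'D_e u x + b * 'D_e v x).
Proof.
move=> du dv.
exact: is_deriveD (is_deriveZ a (DeriveDef du erefl)) (is_deriveZ b (DeriveDef dv erefl)).
Qed.

Lemma iter_partial_lin (a b : R) u v s : smooth u -> smooth v ->
  iter_partial s (fun x => a * u x + b * v x) =
  fun x => a * iter_partial s u x + b * iter_partial s v x.
Proof.
move=> su sv; elim: s => [//|i s IHs] /=; rewrite IHs; apply/funext => x; rewrite /partial.
have [_ du] := su s; have [_ dv] := sv s.
by have [_ ->] := is_derive_lin a b (du i x) (dv i x).
Qed.

Lemma test_function_lin Om (a b : R) u v : test_function Om u -> test_function Om v ->
  test_function Om (fun x => a * u x + b * v x).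
Proof.
move=> [su [K [cK KO u0]]] [sv [K' [cK' KO' v0]]]; split.
  move=> s; rewrite iter_partial_lin//.
  have [cu du] := su s; have [cv dv] := sv s; split.
    move=> x; apply: (@continuousD _ _ _ (fun x => a * iter_partial s u x)
       (fun x => b * iter_partial s v x)).
      by apply: (@continuousM _ _ (cst a) (iter_partial s u)); [exact: cst_continuous|exact: cu].
    by apply: (@continuousM _ _ (cst b) (iter_partial s v)); [exact: cst_continuous|exact: cv].
  by move=> i x; have [] := is_derive_lin a b (du i x) (dv i x).
exists (K `|` K'); split.
- exact: compactU.
- by move=> x [/KO|/KO'].
- move=> x KK; rewrite u0 ?v0 ?mulr0 ?addr0// => Kx; apply: KK; by [left|right].
Qed.

End smooth_lin.

(** * The closure of the test functions *)

Section Sobolev0.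
Variables (R : realType) (n : nat) (Om : set 'rV[R]_n) (p : R).
Local Notation Rn := 'rV[R]_n.
Local Notation leb := (@lebesgue_rV R n).
Hypothesis oOm : open Om.
Hypothesis p1 : 1 < p.
Implicit Types (u v w phi : Rn -> R) (a b : R).

Let mOm : measurable Om. Proof. exact: open_rV_measurable. Qed.
Let p1' : 1 <= p. Proof. exact: ltW. Qed.
Let p0 : 0 < p. Proof. exact: lt_trans ltr01 p1. Qed.
Let pn0 : p != 0. Proof. by rewrite gt_eqF. Qed.

Lemma grad_energy_ge0 u : 0 <= grad_energy Om p u.
Proof. exact: Lp_energy_ge0. Qed.

Lemma wgrad_enorm_Lp u : Sobolev Om p u -> Lp Om p (fun x => enorm (wgrad Om u x)).
Proof. by move=> [_ _ pG]; exact: Lp_enorm. Qed.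

Lemma grad_energy_lin a b u v : Sobolev Om p u -> Sobolev Om p v ->
  grad_energy Om p (fun x => a * u x + b * v x) <=
  2 `^ p * (`|a| `^ p * grad_energy Om p u + `|b| `^ p * grad_energy Om p v).
Proof.
move=> Su Sv; have [_ ->] := Sobolev_lin oOm a b p1' Su Sv.
have [h1] := Lp_lin mOm `|a| `|b| p1' (wgrad_enorm_Lp Su) (wgrad_enorm_Lp Sv).
rewrite !normr_id; apply: le_trans.
have /(LpP mOm _ p1')[_ ih] := h1.
have [_ _ pGu] := Su; have [_ _ pGv] := Sv.
have mm : measurable_fun Om (fun x => enorm (a *: wgrad Om u x + b *: wgrad Om v x)).
  apply: measurable_enorm => i.
  have [+ _] := Lp_lin mOm a b p1' (pGu i) (pGv i).
  move=> /(LpP mOm _ p1')[+ _]; apply: eq_measurable_fun => x _.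
  by rewrite !mxE.
have [|//] := Lp_le mOm p1' mm ih.
move=> x _; apply: powR_norm_le; first exact: ltW.
rewrite (ger0_norm (enorm_ge0 _)); apply: le_trans (ler_norm _).
by rewrite -!enormZ; exact: enormD.
Qed.

Definition Sobolev_energy u : R := Lp_energy Om p u + grad_energy Om p u.

Lemma Sobolev_energy_ge0 u : 0 <= Sobolev_energy u.
Proof. by rewrite addr_ge0// Lp_energy_ge0. Qed.

Lemma Sobolev_energy_lin a b u v : Sobolev Om p u -> Sobolev Om p v ->
  Sobolev_energy (fun x => a * u x + b * v x) <=
  2 `^ p * (`|a| `^ p * Sobolev_energy u + `|b| `^ p * Sobolev_energy v).
Proof.
move=> Su Sv; have [pu _ _] := Su; have [pv _ _] := Sv.
apply: le_trans (lerD (Lp_lin mOm a b p1' pu pv).2 (grad_energy_lin a b Su Sv)) _.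
have K (A B C D E F G : R) : A * (B * C + D * E) + A * (B * F + D * G) <=
    A * (B * (C + F) + D * (E + G)).
  by rewrite le_eqVlt; apply/orP; left; apply/eqP; ring.
rewrite /Sobolev_energy; exact: K.
Qed.

(** Restates the closure with p-th powers instead of norms. Differences are written as combinations
    with coefficients 1 and -1, here and below, so that the linearity lemmas apply to them as they
    are. *)
Lemma Sobolev0P u : Sobolev0 Om p u <-> Sobolev Om p u /\
  forall e : R, 0 < e -> exists2 phi, test_function Om phi &
    Sobolev Om p (fun x => 1 * u x + -1 * phi x) /\
    Sobolev_energy (fun x => 1 * u x + -1 * phi x) < e.
Proof.
have E v w : (fun x => 1 * v x + -1 * w x) = (v \- w)%R.
  by apply/funext => x; rewrite mul1r mulN1r.
split=> -[Su hu]; split => // e e0.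
  have [phi tphi hphi] := hu _ (powR_gt0 p^-1 e0).
  have [S he] := Sobolev_norm_lt oOm p1' hphi.
  exists phi; first exact: tphi.
  rewrite E; split; first exact: S.
  by rewrite (powRVK (ltW e0) pn0) in he.
have [phi tphi [S he]] := hu _ (powR_gt0 p e0).
exists phi; first exact: tphi.
rewrite -E (Sobolev_normE oOm p1' S) lte_fin.
apply: (@lt_le_trans _ _ ((e `^ p) `^ p^-1)); last by rewrite (powRK (ltW e0) pn0).
by apply: gt0_ltr_powR; rewrite ?invr_gt0// nnegrE ?powR_ge0// Sobolev_energy_ge0.
Qed.

Let lin_small (A B D X Y e : R) : 0 <= A -> 0 <= B -> 0 <= D -> 0 < e ->
  X < e / (A * (B + D) + 1) -> Y < e / (A * (B + D) + 1) -> A * (B * X + D * Y) < e.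
Proof.
move=> A0 B0 D0 e0; set c := _ + 1 => hX hY.
have c0 : 0 < c by rewrite ltr_wpDl// mulr_ge0 ?addr_ge0.
apply: (@le_lt_trans _ _ ((c - 1) * (e / c))).
  rewrite /c addrK -mulrA ler_wpM2l// mulrDl.
  by rewrite lerD// ler_wpM2l// ltW.
by rewrite mulrA ltr_pdivrMr// mulrC ltr_pM2l// ltrBlDr ltrDl.
Qed.

Lemma Sobolev0_lin a b u v : Sobolev0 Om p u -> Sobolev0 Om p v ->
  Sobolev0 Om p (fun x => a * u x + b * v x).
Proof.
move=> /Sobolev0P[Su hu] /Sobolev0P[Sv hv]; apply/Sobolev0P.
split; first by have [] := Sobolev_lin oOm a b p1' Su Sv.
move=> e e0; pose c := 2 `^ p * (`|a| `^ p + `|b| `^ p) + 1.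
have c0 : 0 < c by rewrite ltr_wpDl// mulr_ge0 ?addr_ge0 ?powR_ge0.
have [phi tphi [S1 h1]] := hu (e / c) (divr_gt0 e0 c0).
have [psi tpsi [S2 h2]] := hv (e / c) (divr_gt0 e0 c0).
exists (fun x => a * phi x + b * psi x); first exact: test_function_lin.
have -> : (fun x => 1 * (a * u x + b * v x) + -1 * (a * phi x + b * psi x)) =
    (fun x => a * (1 * u x + -1 * phi x) + b * (1 * v x + -1 * psi x)).
  by apply/funext => x; ring.
split; first by have [] := Sobolev_lin oOm a b p1' S1 S2.
apply: le_lt_trans (Sobolev_energy_lin a b S1 S2) _.
exact: lin_small (powR_ge0 _ _) (powR_ge0 _ _) (powR_ge0 _ _) e0 h1 h2.
Qed.

Let lin_unit (a b X Y Z : R) : `|a| = 1 -> `|b| = 1 ->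
  Z <= 2 `^ p * (`|a| `^ p * X + `|b| `^ p * Y) -> Z <= 2 `^ p * (X + Y).
Proof. by move=> -> ->; rewrite powR1 !mul1r. Qed.

Let normN1 : `|-1 : R| = 1. Proof. by rewrite normrN normr1. Qed.
Let norm1 : `|1 : R| = 1. Proof. exact: normr1. Qed.

(** Classical derivatives of a test function form a weak gradient, which agrees almost everywhere
    with the selected one; a coordinate is then bounded by the Euclidean norm. *)
Lemma partial_energy_le phi (i : 'I_n) : test_function Om phi -> Sobolev Om p phi ->
  Lp Om p (partial i phi) /\ Lp_energy Om p (partial i phi) <= grad_energy Om p phi.
Proof.
move=> tphi Sphi; have tw := test_weak_grad tphi.
have Wae := wgrad_ae oOm tw.
have mi : measurable_fun Om (partial i phi).
  have := weak_grad_measurable oOm i tw; apply: eq_measurable_fun => x _.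
  by rewrite mxE.
have mW j := weak_grad_measurable oOm j (wgradP (ex_intro _ _ tw)).
have ae : {ae leb, forall x, Om x -> wgrad Om phi x ord0 i = partial i phi x}.
  by apply: filterS Wae => x h Ox; rewrite h// mxE.
have [_ _ /(_ i) pG] := Sphi; split; first exact: (Lp_ae oOm p1' pG mi ae).
rewrite /grad_energy -(@ae_Lp_energy _ _ _ mOm p _ _ (mW i) mi ae).
have /(LpP mOm _ p1')[_ iG] := wgrad_enorm_Lp Sphi.
have [|//] := Lp_le mOm p1' (mW i) iG.
move=> x _; apply: powR_norm_le; first exact: ltW.
by rewrite (ger0_norm (enorm_ge0 _)) coord_le_enorm.
Qed.

Lemma Sobolev0_approx u e : Sobolev0 Om p u -> 0 < e ->
  exists2 phi, test_function Om phi &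
    [/\ Sobolev Om p phi, Sobolev Om p (fun x => 1 * u x + -1 * phi x),
      Sobolev_energy (fun x => 1 * u x + -1 * phi x) < e &
      grad_energy Om p phi <= 2 `^ p * (grad_energy Om p u + e)].
Proof.
move=> /Sobolev0P[Su hu] e0; have [phi tphi [S he]] := hu e e0.
have Ephi : phi = (fun x => 1 * u x + -1 * (1 * u x + -1 * phi x)).
  by apply/funext => x; ring.
exists phi => //; split => //.
  by rewrite Ephi; have [] := Sobolev_lin oOm 1 (-1) p1' Su S.
rewrite {1}Ephi; apply: le_trans (lin_unit norm1 normN1 (grad_energy_lin 1 (-1) Su S)) _.
apply: ler_wpM2l; first exact: powR_ge0.
rewrite lerD2l; apply: le_trans (ltW he).
by rewrite lerDr Lp_energy_ge0.
Qed.

(** The inequality for test functions passes to their closure: approximating [u] within e costs a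
    fixed multiple of e and factors 2^p in the constant. *)
Lemma poincare (i : 'I_n) : bounded_set Om ->
  exists2 C : R, 0 <= C & forall u, Sobolev0 Om p u ->
    Lp_energy Om p u <= C * grad_energy Om p u.
Proof.
move=> /bounded_rV_box[M M0 OM]; have [C C0 hC] := poincare_test i mOm p1 M0 OM.
set c := 2 `^ p : R; have c0 : 0 <= c by exact: powR_ge0.
exists (c * (C * c)); first by rewrite !mulr_ge0.
move=> u S0u.
suff h e : 0 < e -> Lp_energy Om p u <= c * (C * c) * grad_energy Om p u + (c * (C * c) + c) * e.
  apply/ler_addgt0Pr => e e0; pose k := c * (C * c) + c + 1.
  have k0 : 0 < k by rewrite ltr_wpDl// addr_ge0// !mulr_ge0.
  apply: le_trans (h (e / k) (divr_gt0 e0 k0)) _; rewrite lerD2l.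
  have ky : k * (e / k) = e by rewrite mulrC divfK// gt_eqF.
  by rewrite -[leRHS]ky ler_wpM2r ?divr_ge0 ?(ltW e0) ?(ltW k0)// /k lerDl.
move=> e0; have [phi tphi [Sphi S he gphi]] := Sobolev0_approx S0u e0.
have Eu : u = (fun x => 1 * (1 * u x + -1 * phi x) + 1 * phi x).
  by apply/funext => x; ring.
have lphi : Lp_energy Om p phi <= C * grad_energy Om p phi.
  apply: le_trans (hC phi tphi) _; apply: ler_wpM2l => //.
  exact: (partial_energy_le i tphi Sphi).2.
rewrite {1}Eu; have [pphi _ _] := Sphi; have [pS _ _] := S.
apply: le_trans (lin_unit norm1 norm1 (Lp_lin mOm 1 1 p1' pS pphi).2) _.
have he' : Lp_energy Om p (fun x => 1 * u x + -1 * phi x) <= e.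
  by apply: le_trans (ltW he); rewrite lerDl grad_energy_ge0.
apply: le_trans (_ : c * (e + C * (c * (grad_energy Om p u + e))) <= _).
  rewrite ler_wpM2l// lerD//; apply: le_trans lphi _; exact: ler_wpM2l.
by rewrite le_eqVlt; apply/orP; left; apply/eqP; ring.
Qed.

End Sobolev0.

(** * Uniform convexity *)

Section strict_convexity.
Variables (R : realType) (n : nat) (p : R).
Local Notation Rn := 'rV[R]_n.
Hypothesis p1 : 1 < p.
Implicit Types v w : Rn.

Let p0 : 0 < p. Proof. exact: lt_trans ltr01 p1. Qed.
Let pn0 : p != 0. Proof. by rewrite gt_eqF. Qed.

(** Young's inequality for the product of x and 1, with exponents p and p / (p - 1), multiplied by
    p. It is the tangent line inequality at 1. *)
Lemma bernoulli_powR (x : R) : 0 <= x -> 1 + p * (x - 1) <= x `^ p.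
Proof.
move=> x0; have q0 : 0 < p - 1 by rewrite subr_gt0.
have q1 : 0 < p / (p - 1) by rewrite divr_gt0.
have e : p^-1 + (p / (p - 1))^-1 = 1 by field; rewrite !gt_eqF.
have := @conjugate_powR _ x 1 p (p / (p - 1)) x0 ler01 p0 q1 e.
rewrite powR1 mulr1 mul1r invf_div; set X := x `^ p => h.
have : p * x <= p * (X / p + (p - 1) / p) by rewrite ler_pM2l.
rewrite (_ : p * (X / p + _) = X + (p - 1)); last by field.
by move=> ?; lra.
Qed.

(* Squaring the non-strict inequality at [sqrt x] makes it strict. *)
Lemma bernoulli_powR_strict (x : R) : 1 < x -> 1 + p * (x - 1) < x `^ p.
Proof.
move=> x1; have x0 : 0 <= x by rewrite ltW// (lt_trans ltr01).
set w := Num.sqrt x; have w0 : 0 <= w by exact: sqrtr_ge0.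
have wx : x = w * w by rewrite -expr2 sqr_sqrtr.
have w1 : 1 < w.
  by rewrite -(ltr_pXn2r (n := 2))// ?nnegrE// expr1n expr2 -wx.
have h := bernoulli_powR w0; rewrite wx powRM//; set W := w `^ p in h *.
have W1 : 0 <= 1 + p * (w - 1) by apply: addr_ge0 => //; apply: mulr_ge0; rewrite ?subr_ge0 ltW.
have h2 : (1 + p * (w - 1)) * (1 + p * (w - 1)) <= W * W by exact: ler_pM.
apply: lt_le_trans h2.
have : 0 < p * (p - 1) * ((w - 1) * (w - 1)) by rewrite !mulr_gt0// subr_gt0.
by move=> ?; lra.
Qed.

(** After division by the midpoint m, the two arguments average to 1, so the linear parts of the
    tangent inequalities at 1 cancel in the sum; the one for t/m > 1 is strict. *)
Lemma powR_strict_convex (s t : R) : 0 <= s -> s < t ->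
  (2^-1 * s + 2^-1 * t) `^ p < 2^-1 * s `^ p + 2^-1 * t `^ p.
Proof.
move=> s0 st; set m := 2^-1 * s + 2^-1 * t.
have m0 : 0 < m by rewrite /m; lra.
have sm : 0 <= s / m by rewrite divr_ge0// ltW.
have tm : 1 < t / m by rewrite ltr_pdivlMr// mul1r /m; lra.
have h1 := bernoulli_powR sm; have h2 := bernoulli_powR_strict tm.
have -> : s `^ p = m `^ p * (s / m) `^ p.
  by rewrite -powRM ?(ltW m0)// mulrC divfK ?gt_eqF.
have -> : t `^ p = m `^ p * (t / m) `^ p.
  by rewrite -powRM ?(ltW m0) ?(ltW (lt_trans ltr01 tm))// mulrC divfK ?gt_eqF.
have M0 : 0 < m `^ p by exact: powR_gt0.
move: h1 h2; set S := (s / m) `^ p; set T := (t / m) `^ p; set M := m `^ p in M0 *.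
move=> h1 h2; have st2 : s / m + t / m = 2 by rewrite /m; field; rewrite gt_eqF// -/m; lra.
have : 2 < S + T by move: h1 h2 st2; set a := s / m; set b := t / m; nra.
by move=> ?; nra.
Qed.

Lemma enorm0 : enorm (0 : Rn) = 0.
Proof. by rewrite -[X in enorm X](scale0r (0 : Rn)) enormZ normr0 mul0r. Qed.

Lemma enorm0_eq v : enorm v = 0 -> v = 0.
Proof.
move=> v0; apply/rowP => i; have := coord_le_enorm v i.
by rewrite v0 normr_le0 => /eqP ->; rewrite mxE.
Qed.

(** If the norms differ, the strictness comes from the power. If they agree, the parallelogram
    identity makes the midpoint of distinct vectors strictly shorter. *)
Lemma enorm_strict_convex v w : v != w ->
  enorm (2^-1 *: v + 2^-1 *: w) `^ p < 2^-1 * enorm v `^ p + 2^-1 * enorm w `^ p.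
Proof.
move=> vw; have h2 : 0 <= 2^-1 :> R by [].
have tri : enorm (2^-1 *: v + 2^-1 *: w) <= 2^-1 * enorm v + 2^-1 * enorm w.
  by apply: le_trans (enormD _ _) _; rewrite !enormZ ger0_norm.
have tri' : enorm (2^-1 *: v + 2^-1 *: w) `^ p <= (2^-1 * enorm v + 2^-1 * enorm w) `^ p.
  apply: ge0_ler_powR; rewrite ?nnegrE ?enorm_ge0 ?addr_ge0 ?mulr_ge0 ?enorm_ge0//.
  exact: ltW.
have [lt|lt|e] := ltgtP (enorm v) (enorm w).
- by apply: le_lt_trans tri' _; apply: powR_strict_convex; rewrite ?enorm_ge0.
- apply: le_lt_trans tri' _; rewrite addrC [ltRHS]addrC.
  by apply: powR_strict_convex; rewrite ?enorm_ge0.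
rewrite e -mulrDl -[X in _ < X * _](_ : 1 = _) ?mul1r; last by field.
apply: gt0_ltr_powR => //; rewrite ?nnegrE ?enorm_ge0//.
rewrite -(ltr_pXn2r (n := 2))// ?nnegrE ?enorm_ge0// enorm_parallelogram e.
have : 0 < enorm (v - w) ^+ 2.
  rewrite exprn_gt0// lt_def enorm_ge0 andbT; apply/eqP => /enorm0_eq/eqP.
  by rewrite subr_eq0 (negbTE vw).
by move=> ?; lra.
Qed.

Definition convexity_gap v w : R :=
  2^-1 * enorm v `^ p + 2^-1 * enorm w `^ p - enorm (2^-1 *: v + 2^-1 *: w) `^ p.

Lemma convexity_gap_ge0 v w : 0 <= convexity_gap v w.
Proof.
have [<-|vw] := eqVneq v w; last by rewrite subr_ge0 ltW// enorm_strict_convex.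
have E : 2^-1 *: v + 2^-1 *: v = v.
  by rewrite -scalerDl (_ : 2^-1 + 2^-1 = 1) ?scale1r//; field.
by rewrite /convexity_gap E; move: (_ `^ _) => x; lra.
Qed.

Lemma enorm_powR_continuous : continuous (fun v : Rn => enorm v `^ p).
Proof.
have -> : (fun v : Rn => enorm v `^ p) = (fun s : R => `|s| `^ p) \o @enorm R n.
  by apply/funext => v /=; rewrite ger0_norm// enorm_ge0.
move=> v; apply: (@continuous_comp Rn R R); first exact: enorm_continuous.
exact: norm_powR_continuous.
Qed.

Lemma enorm_powRZ (a : R) v : 0 <= a -> enorm (a *: v) `^ p = a `^ p * enorm v `^ p.
Proof. by move=> a0; rewrite enormZ (ger0_norm a0) powRM// enorm_ge0. Qed.

(* Both sides are homogeneous, and on the unit sphere the gap is bounded away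
   from zero by compactness as long as [v] and [w] are far apart. *)
Lemma uniform_convexity (e : R) : 0 < e -> exists2 C : R, 0 <= C & forall v w,
  enorm (v - w) `^ p <= C * convexity_gap v w + e * (enorm v `^ p + enorm w `^ p).
Proof.
move=> e0.
pose N (z : Rn * Rn) := enorm z.1 `^ p + enorm z.2 `^ p.
pose D (z : Rn * Rn) := enorm (z.1 - z.2) `^ p.
pose G (z : Rn * Rn) := convexity_gap z.1 z.2.
have cc (f : Rn * Rn -> Rn) : continuous f -> continuous (fun z => enorm (f z) `^ p).
  move=> cf z; apply: (@continuous_comp _ Rn R f (fun v => enorm v `^ p)); first exact: cf.
  exact: enorm_powR_continuous.
have c1 : continuous (fun z : Rn * Rn => z.1) by move=> z; exact: cvg_fst.
have c2 : continuous (fun z : Rn * Rn => z.2) by move=> z; exact: cvg_snd.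
have cN : continuous N by move=> z; exact: (cvgD (cc _ c1 z) (cc _ c2 z)).
have cD : continuous D.
  by apply: (cc (fun z => z.1 - z.2)) => z; exact: (cvgB (c1 z) (c2 z)).
have c3 : continuous (fun z : Rn * Rn => 2^-1 *: z.1 + 2^-1 *: z.2).
  by move=> z; exact: (cvgD (cvgZ (cvg_cst _) (c1 z)) (cvgZ (cvg_cst _) (c2 z))).
have cG : continuous G.
  move=> z; exact: (cvgB (cvgD (cvgM (cvg_cst _) (cc _ c1 z)) (cvgM (cvg_cst _) (cc _ c2 z)))
    (cc _ c3 z)).
pose B : set Rn := closed_box (const_mx (-1)) (const_mx 1).
pose S := (B `*` B) `&` (N @^-1` [set x | x = 1] `&` D @^-1` [set x | e <= x]).
have cS : compact S.
  apply: compact_closedI; first by apply: compact_setX; exact: closed_box_compact.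
  apply: closedI.
    by apply: preimage_closed; [move=> z _; exact: cN|exact: closed_eq].
  by apply: preimage_closed; [move=> z _; exact: cD|exact: closed_ge].
have [k k0 hk] : exists2 k : R, 0 < k & forall z, S z -> k <= G z.
  have [S0|/set0P S0] := eqVneq S set0; first by exists 1 => // z; rewrite S0.
  have [|c cS' hc] := @compact_EVT_min _ _ G S S0 cS.
    exact: continuous_subspaceT.
  exists (G c); last by move=> z Sz; apply: hc; rewrite inE.
  move: cS'; rewrite inE => -[_ [_ /= eD]]; rewrite subr_gt0.
  apply: enorm_strict_convex; apply/eqP => E.
  have := lt_le_trans e0 eD; rewrite /D E subrr.
  by rewrite enorm0 powR0// ltxx.
(* On [S] one has D <= 2^p and G >= k. Pairs of the unit sphere outside [S] satisfy D < e and are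
   paid for by the error term. *)
exists (2 `^ p / k); first by rewrite divr_ge0 ?powR_ge0// ltW.
have D2 z : D z <= 2 `^ p * N z.
  apply: le_trans (powR_add_le (enorm_ge0 _) (enorm_ge0 _) (ltW p0)).
  apply: ge0_ler_powR; rewrite ?nnegrE ?addr_ge0 ?enorm_ge0 ?(ltW p0)//.
  apply: le_trans (enormD _ _) _; rewrite lerD2l -scaleN1r enormZ.
  by rewrite normrN normr1 mul1r.
have norm1 z : N z = 1 -> D z <= 2 `^ p / k * G z + e * N z.
  move=> Nz; have G0 : 0 <= G z by exact: convexity_gap_ge0.
  have [eD|De] := leP e (D z); last first.
    rewrite Nz mulr1; apply: le_trans (ltW De) _.
    by rewrite lerDr mulr_ge0// divr_ge0 ?powR_ge0// ltW.
  have Bz v : enorm v `^ p <= 1 -> B v.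
    move=> v1 i; rewrite !mxE -ler_norml; apply: le_trans (coord_le_enorm _ _) _.
    rewrite -(@powRK _ (enorm v) p) ?enorm_ge0//.
    apply: (@le_trans _ _ (1 `^ p^-1)); last by rewrite powR1.
    by apply: ge0_ler_powR; rewrite ?nnegrE ?powR_ge0 ?invr_ge0 ?(ltW p0).
  have Sz : S z.
    split => //; split; apply: Bz; rewrite -Nz /N.
      by rewrite lerDl powR_ge0.
    by rewrite lerDr powR_ge0.
  have := hk z Sz => kG.
  apply: le_trans (D2 z) _; rewrite Nz !mulr1.
  apply: (@le_trans _ _ (2 `^ p / k * G z)); last by rewrite lerDl ltW.
  by rewrite -mulrA ler_peMr ?powR_ge0// mulrC ler_pdivlMr// mul1r.
move=> v w; have N0 : 0 <= N (v, w) by rewrite addr_ge0 ?powR_ge0.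
have [Nz|Nz] := eqVneq (N (v, w)) 0.
  have := D2 (v, w); rewrite Nz mulr0 => h; apply: le_trans h _.
  by rewrite addr_ge0// mulr_ge0 ?convexity_gap_ge0 ?divr_ge0 ?powR_ge0// ltW.
(* Since [N], [D] and [G] are homogeneous of degree p, division by [r] moves the pair to the sphere
   [N = 1]. *)
pose r := N (v, w) `^ p^-1; have r0 : 0 < r by rewrite powR_gt0// lt_def Nz.
have rp : r `^ p = N (v, w) by rewrite powRVK.
pose v' := r^-1 *: v; pose w' := r^-1 *: w.
have vE : v = r *: v' by rewrite scalerA divff ?gt_eqF// scale1r.
have wE : w = r *: w' by rewrite scalerA divff ?gt_eqF// scale1r.
clearbody v' w'.
have Gh : G (v, w) = r `^ p * G (v', w').
  rewrite /G /convexity_gap /= vE wE.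
  have -> : 2^-1 *: (r *: v') + 2^-1 *: (r *: w') = r *: (2^-1 *: v' + 2^-1 *: w').
    by rewrite scalerDr !scalerA (mulrC r).
  rewrite !enorm_powRZ ?(ltW r0)//.
  by move: (r `^ p) (enorm v' `^ p) (enorm w' `^ p) (enorm _ `^ p) => *; ring.
have Dh : D (v, w) = r `^ p * D (v', w').
  by rewrite /D /= {1}vE {1}wE -scalerBr enorm_powRZ// ltW.
have Nh : N (v, w) = r `^ p * N (v', w').
  by rewrite /N /= {1}vE {1}wE !enorm_powRZ ?(ltW r0)// mulrDr.
have N1 : N (v', w') = 1.
  have : r `^ p * N (v', w') = r `^ p * 1 by rewrite -Nh rp mulr1.
  by move/mulfI; apply; rewrite rp.
rewrite -[leLHS]/(D (v, w)) -[convexity_gap v w]/(G (v, w)) -[X in e * X]/(N (v, w)).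
rewrite Dh Gh Nh; have := ler_wpM2l (powR_ge0 r p) (norm1 (v', w') N1).
by move: (r `^ p) (2 `^ p) (D _) (G _) (N _) => a b c d' f; congr (_ <= _); ring.
Qed.

End strict_convexity.

(** * Limits of Sobolev functions *)

Section fast_convergence.
Variables (R : realType) (n : nat) (Om : set 'rV[R]_n).
Local Notation Rn := 'rV[R]_n.
Local Notation leb := (@lebesgue_rV R n).
Hypothesis mOm : measurable Om.
Implicit Types (u v w : Rn -> R) (q : R).

(** Chosen such that the energies of 2^k v_k are at most 2^-(k+1), which sum up to at most 1. *)
Definition fast_rate q (k : nat) : R := ((2 ^+ k) `^ q)^-1 * (2 ^ k.+1)%:R^-1.

Lemma fast_rate_gt0 q k : 0 < fast_rate q k.
Proof. by rewrite mulr_gt0// invr_gt0 ?ltr0n ?expn_gt0// powR_gt0 exprn_gt0. Qed.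

(** The majorant [B] is the q-th root of the series of the terms |2^k v_k|^q: its energy is at most
    1 by monotone convergence, and each term is below the sum wherever the latter is finite, that is
    almost everywhere. *)
Lemma fast_Lp q (v : nat -> Rn -> R) : 1 <= q -> (forall k, Lp Om q (v k)) ->
  (forall k, Lp_energy Om q (v k) <= fast_rate q k) ->
  exists B : Rn -> R, [/\ Lp Om q B, forall x, 0 <= B x &
    {ae leb, forall x, Om x -> forall k, `|v k x| <= (2 ^+ k)^-1 * B x}].
Proof.
move=> q1 pv ev; have q0 : 0 < q by rewrite (lt_le_trans _ q1).
have qn0 : q != 0 by rewrite gt_eqF.
have q0' := ltW q0.
pose h k (x : Rn) : R := (2 ^+ k) `^ q * `|v k x| `^ q.
have mv k : measurable_fun Om (v k) by have [] := (LpP mOm (v k) q1).1 (pv k).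
have iv k : leb.-integrable Om (EFin \o (fun x => `|v k x| `^ q)).
  by have [] := (LpP mOm (v k) q1).1 (pv k).
have ih k : leb.-integrable Om (EFin \o h k) by apply: integrableZR (iv k).
have mh k : measurable_fun Om (EFin \o h k) by exact: measurable_int (ih k).
have h0 k x : (0 <= (EFin \o h k) x)%E by rewrite /= lee_fin mulr_ge0 ?powR_ge0.
pose S x := (\sum_(0 <= k <oo) (EFin \o h k) x)%E.
have S0 x : (0 <= S x)%E by apply: nneseries_ge0 => k _ _; exact: h0.
have mS : measurable_fun Om S.
  have := @ge0_emeasurable_sum _ _ R Om (fun k => EFin \o h k) xpredT (fun k x _ _ => h0 k x) (fun k _ => mh k).
  exact: eq_measurable_fun.
have hS k x : ((h k x)%:E <= S x)%E.
  apply: le_trans (nneseries_lim_ge k.+1 (fun m _ _ => h0 m x)).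
  rewrite big_nat_recr//= leeDr//; apply: sume_ge0 => m _; exact: h0.
have iS : leb.-integrable Om S.
  apply/integrableP; split => //.
  rewrite (eq_integral S); last by move=> x _; rewrite gee0_abs.
  rewrite integral_nneseries//.
  apply: (@le_lt_trans _ _ 1%:E); last exact: ltry.
  apply: le_trans (epsilon_trick0 xpredT ler01).
  apply: lee_nneseries => [k _ _|k _]; first by apply: integral_ge0 => x _; exact: h0.
  have E : (\int[leb]_(x in Om) (h k x))%R = (2 ^+ k) `^ q * Lp_energy Om q (v k).
    by rewrite RintegralZl.
  rewrite -[leLHS]fineK; last exact: integrable_fin_num (ih k).
  rewrite lee_fin -[leLHS]/(\int[leb]_(x in Om) (h k x))%R E.
  rewrite -ler_pdivlMl ?powR_gt0 ?exprn_gt0// mul1r; exact: ev.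
exists (fun x => fine (S x) `^ q^-1); split; last 2 first.
- by move=> x; exact: powR_ge0.
- have := integrable_ae mOm iS; apply: filterS => x Sx Ox k.
  have hk : h k x <= fine (S x) by rewrite -lee_fin (fineK (Sx Ox)); exact: hS.
  have k0 : 0 < 2 ^+ k :> R by rewrite exprn_gt0.
  rewrite -ler_pdivrMl ?invr_gt0// invrK.
  have vk0 : 0 <= 2 ^+ k * `|v k x| by apply: mulr_ge0 => //; exact: ltW.
  rewrite -[leLHS](powRK vk0 qn0); apply: ge0_ler_powR; rewrite ?nnegrE ?powR_ge0 ?fine_ge0 ?invr_ge0//.
  by rewrite (powRM _ (ltW k0)).
have mB : measurable_fun Om (fun x => fine (S x) `^ q^-1).
  apply: (@measurableT_comp _ _ _ _ _ _ (@powR R ^~ q^-1)) => //.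
  exact: (measurableT_comp (f := fine) _ mS).
apply/(LpP mOm _ q1); split => //.
have fS : leb.-integrable Om (EFin \o (fun x => fine (S x))).
  apply: (@le_integrable _ _ _ leb _ mOm _ S) => //.
    by apply/measurable_EFinP; exact: (measurableT_comp (f := fine) _ mS).
  by move=> x Ox /=; have := S0 x; case: (S x) => [s||] //= _; rewrite ?normr0 ?leey.
move: fS; congr (integrable _ _ _); apply/funext => x /=; congr EFin.
by rewrite (ger0_norm (powR_ge0 _ _)) powRVK//; exact/fine_ge0.
Qed.

Lemma geometric_telescope (a : nat -> R) (b : R) : 0 <= b ->
  (forall k, `|a k.+1 - a k| <= (2 ^+ k)^-1 * b) ->
  (forall k, `|a k| <= `|a 0%N| + 2 * b) /\ cvg (a @ \oo).
Proof.
move=> b0 ha.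
have S k : \sum_(i < k) (2 ^+ i)^-1 * b <= 2 * b.
  rewrite -mulr_suml ler_wpM2r//.
  suff -> : \sum_(i < k) (2 ^+ i)^-1 = 2 - 2 * (2 ^+ k)^-1 :> R.
    by rewrite gerBl mulr_ge0// invr_ge0 exprn_ge0.
  elim: k => [|k IHk]; first by rewrite big_ord0 expr0 invr1 mulr1 subrr.
  rewrite big_ord_recr/= IHk exprS; field.
  by rewrite expf_neq0.
have aE k : a k = a 0%N + \sum_(i < k) (a i.+1 - a i).
  elim: k => [|k IHk]; first by rewrite big_ord0 addr0.
  by rewrite big_ord_recr/= addrA -IHk addrC subrK.
split.
  move=> k; rewrite aE; apply: le_trans (ler_normD _ _) _; rewrite lerD2l.
  apply: le_trans (ler_norm_sum _ _ _) _; apply: le_trans (S k).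
  by apply: ler_sum => i _; exact: ha.
have -> : a = (fun k => a 0%N + series (fun i => a i.+1 - a i) k).
  by apply/funext => k; rewrite {1}aE /series/= big_mkord.
apply: is_cvgD; first exact: is_cvg_cst.
apply: normed_cvg; apply: nondecreasing_is_cvgn.
  by apply: nondecreasing_series => i _ _ /=.
exists (2 * b) => _ [k _ <-]; apply: le_trans (S k).
apply: (@le_trans _ _ (\sum_(i < k) `|a i.+1 - a i|)).
  by rewrite -(big_mkord xpredT (fun i => `|a i.+1 - a i|)).
by apply: ler_sum => i _; exact: ha.
Qed.

(** The pointwise half of the Riesz-Fischer theorem: besides convergence almost everywhere it
    provides an Lp majorant of the whole sequence, so that dominated convergence can be used
    afterwards. *)
Lemma fast_Lp_telescope q (w : nat -> Rn -> R) : 1 <= q -> (forall k, Lp Om q (w k)) ->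
  (forall k, Lp_energy Om q (fun x => 1 * w k.+1 x + -1 * w k x) <= fast_rate q k) ->
  exists H : Rn -> R, [/\ Lp Om q H, forall x, 0 <= H x &
    {ae leb, forall x, Om x -> cvg (w k x @[k --> \oo]) /\ forall k, `|w k x| <= H x}].
Proof.
move=> q1 pw ew.
have pv k := (Lp_lin mOm 1 (-1) q1 (pw k.+1) (pw k)).1.
have [B [pB B0 hB]] := fast_Lp q1 pv ew.
have pH : Lp Om q (fun x => 1 * `|w 0%N x| + 2 * B x).
  apply: (Lp_lin mOm 1 2 q1 _ pB).1.
  have [mw iw] := (LpP mOm _ q1).1 (pw 0%N); apply/(LpP mOm _ q1); split.
    exact: measurableT_comp.
  by move: iw; congr (integrable _ _ _); apply/funext => x /=; rewrite normr_id.
exists (fun x => 1 * `|w 0%N x| + 2 * B x); split => //.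
  by move=> x; rewrite mul1r addr_ge0// mulr_ge0.
apply: filterS hB => x hx Ox.
have [|h1 h2] := @geometric_telescope (fun k => w k x) (B x) (B0 x).
  by move=> k; have := hx Ox k; rewrite mul1r mulN1r.
by split => // k; rewrite mul1r.
Qed.

Lemma Lp_energy_dominated q (w : nat -> Rn -> R) u H : 1 <= q ->
  (forall k, measurable_fun Om (w k)) -> measurable_fun Om u -> Lp Om q H ->
  {ae leb, forall x, Om x -> w k x @[k --> \oo] --> u x} ->
  {ae leb, forall x, Om x -> forall k, `|w k x| <= H x} ->
  Lp Om q u /\ Lp_energy Om q (w k) @[k --> \oo] --> Lp_energy Om q u.
Proof.
move=> q1 mw mu pH cw wH; have q0 : 0 <= q by rewrite (le_trans _ q1).
have [mH iH] := (LpP mOm _ q1).1 pH.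
have [|||||iu cu] := @Rintegral_dominated _ _ _ leb Om (fun k x => `|w k x| `^ q)
    (fun x => `|u x| `^ q) (fun x => `|H x| `^ q) mOm.
- by move=> k; apply/measurable_EFinP; exact: measurable_powR_norm.
- by apply/measurable_EFinP; exact: measurable_powR_norm.
- apply: filterS cw => x cx Ox.
  have [q1'|q1'] := ltP 1 q.
    exact: (cvg_comp _ _ (cx Ox) (@norm_powR_continuous R q q1' (u x))).
  have -> : q = 1 by apply/eqP; rewrite eq_le q1 q1'.
  rewrite (_ : (fun k => _) = fun k => `|w k x|); last by apply/funext => k; rewrite powRr1.
  by rewrite powRr1//; apply: cvg_norm; exact: cx.
- exact: iH.
- apply: filterS wH => x hx k Ox; rewrite (ger0_norm (powR_ge0 _ _)).
  by apply: powR_norm_le => //; apply: le_trans (hx Ox k) (ler_norm _).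
by split => //; apply/(LpP mOm _ q1).
Qed.

End fast_convergence.

Section Sobolev_limit.
Variables (R : realType) (n : nat) (Om : set 'rV[R]_n) (p : R).
Local Notation Rn := 'rV[R]_n.
Local Notation leb := (@lebesgue_rV R n).
Hypothesis oOm : open Om.
Hypothesis p1 : 1 <= p.
Implicit Types (u v w phi : Rn -> R) (a b : R).

Let mOm : measurable Om. Proof. exact: open_rV_measurable. Qed.

Lemma enorm_le (v w : Rn) : (forall i, `|v ord0 i| <= `|w ord0 i|) -> enorm v <= enorm w.
Proof.
move=> vw; rewrite ler_sqrt ?sum_sqr_ge0//; apply: ler_sum => i _.
rewrite -[leLHS]real_normK ?num_real// -[leRHS]real_normK ?num_real//.
by rewrite ler_pXn2r ?nnegrE.
Qed.

Lemma Lp_loc_integrable u : Lp Om p u -> loc_integrable Om u.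
Proof.
move=> /(LpP mOm _ p1)[mu iu] K cK KO; have mK := compact_rV_measurable cK.
have i1 : leb.-integrable K (EFin \o (fun x => 1 + `|u x| `^ p)).
  apply: integrableDR => //; first exact: (loc_integrable_cst 1 cK KO).
  exact: integrableS iu.
apply: (@le_integrable _ _ _ leb _ mK _ (EFin \o (fun x => 1 + `|u x| `^ p))) => //.
  by apply/measurable_EFinP; exact: measurable_funS mu.
move=> x Kx /=; rewrite lee_fin [leRHS]ger0_norm ?addr_ge0 ?powR_ge0//.
have [u1|u1] := leP `|u x| 1; first by apply: le_trans u1 _; rewrite lerDl powR_ge0.
apply: (@le_trans _ _ (`|u x| `^ 1)); first by rewrite powRr1.
by apply: (le_trans (ler_powR (ltW u1) p1)); rewrite lerDr.
Qed.

Lemma Lp_energy_coord_le (w : Rn -> R) (G : Rn -> Rn) i : measurable_fun Om w ->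
  Lp Om p (fun x => enorm (G x)) -> (forall x, w x = G x ord0 i) ->
  Lp_energy Om p w <= Lp_energy Om p (fun x => enorm (G x)).
Proof.
move=> mw /(LpP mOm _ p1)[_ iG] wG.
have [|//] := Lp_le mOm p1 mw iG.
move=> x _; apply: powR_norm_le; first by rewrite (le_trans _ p1).
by rewrite wG (ger0_norm (enorm_ge0 _)) coord_le_enorm.
Qed.

(** Dominated convergence on both sides of the integration by parts identity; local majorants are
    enough because test functions are bounded with compact support. *)
Lemma weak_grad_limit (w : nat -> Rn -> R) (W : Rn -> R) (G : nat -> Rn -> Rn)
    (GW : Rn -> Rn) (H : Rn -> R) (Hi : 'I_n -> Rn -> R) :
  (forall k, is_weak_grad Om (w k) (G k)) ->
  loc_integrable Om H -> (forall i, loc_integrable Om (Hi i)) ->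
  loc_integrable Om W -> (forall i, loc_integrable Om (fun x => GW x ord0 i)) ->
  {ae leb, forall x, Om x -> w k x @[k --> \oo] --> W x /\ forall k, `|w k x| <= H x} ->
  (forall i, {ae leb, forall x, Om x ->
    G k x ord0 i @[k --> \oo] --> GW x ord0 i /\ forall k, `|G k x ord0 i| <= Hi i x}) ->
  is_weak_grad Om W GW.
Proof.
move=> wG iH iHi iW iG cw cG; split => // phi tphi i.
have [K [cK KO phi0 cphi dphi]] := test_function_support tphi.
have [cdphi dphi0] := dphi i.
have L (g : nat -> Rn -> R) g' h (psi : Rn -> R) :
    (forall k, loc_integrable Om (g k)) -> loc_integrable Om g' -> loc_integrable Om h ->
    continuous psi -> (forall x, ~ K x -> psi x = 0) ->
    {ae leb, forall x, Om x -> g k x @[k --> \oo] --> g' x /\ forall k, `|g k x| <= h x} ->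
    (\int[leb]_(x in Om) (g k x * psi x))%R @[k --> \oo] --> (\int[leb]_(x in Om) (g' x * psi x))%R.
  move=> ig ig' ih cpsi psi0 ae.
  have mpsi : measurable_fun Om psi by exact: continuous_rV_measurable.
  have ihp : leb.-integrable Om (EFin \o (fun x => h x * `|psi x|)).
    apply: (@integrableS _ _ _ leb setT) => //.
    apply: (@test_integrable _ _ Om h (fun x => `|psi x|) K) => //.
      by move=> x; exact: (cvg_norm (cpsi x)).
    by move=> x Kx; rewrite psi0// normr0.
  have m1 k : measurable_fun Om (fun x => g k x * psi x).
    by apply: measurable_funM => //; exact: loc_integrable_measurable.
  have m2 : measurable_fun Om (fun x => g' x * psi x).
    by apply: measurable_funM => //; exact: loc_integrable_measurable.
  have c1 : {ae leb, forall x, Om x -> (g k x * psi x) @[k --> \oo] --> g' x * psi x}.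
    by apply: filterS ae => x hx Ox; apply: cvgM; [exact: (hx Ox).1|exact: cvg_cst].
  have c2 : {ae leb, forall x, forall k, Om x -> `|g k x * psi x| <= h x * `|psi x|}.
    by apply: filterS ae => x hx k Ox; rewrite normrM ler_wpM2r//; exact: (hx Ox).2.
  by have [] := Rintegral_dominated mOm m1 m2 c1 ihp c2.
have wi k : loc_integrable Om (w k) by have [] := wG k.
have Gi k : loc_integrable Om (fun x => G k x ord0 i) by have [] := wG k.
have L1 := L _ _ _ _ wi iW iH cdphi dphi0 cw.
have L2 := L _ _ _ _ Gi (iG i) (iHi i) cphi phi0 (cG i).
move: L1; rewrite (_ : (fun k => _) =
    fun k => - \int[leb]_(x in Om) (G k x ord0 i * phi x))%R; last first.
  by apply/funext => k; have [_ _ ->] := wG k.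
by move=> /cvg_unique; apply; [exact: norm_hausdorff|exact: cvgN].
Qed.

(** The limit [W] is prescribed almost everywhere instead of constructed, because it will be an L^2
    limit known beforehand. Its gradient is obtained coordinate by coordinate from the rapidly
    converging gradients, with majorants that also give the convergence of the energies. *)
Lemma Sobolev_limit (w : nat -> Rn -> R) (W : Rn -> R) :
  (forall k, Sobolev Om p (w k)) ->
  (forall k, Lp_energy Om p (fun x => 1 * w k.+1 x + -1 * w k x) <= fast_rate p k) ->
  (forall k, grad_energy Om p (fun x => 1 * w k.+1 x + -1 * w k x) <= fast_rate p k) ->
  measurable_fun Om W -> {ae leb, forall x, Om x -> w k x @[k --> \oo] --> W x} ->
  [/\ Sobolev Om p W, Lp_energy Om p (w k) @[k --> \oo] --> Lp_energy Om p W &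
      grad_energy Om p (w k) @[k --> \oo] --> grad_energy Om p W].
Proof.
move=> Sw lw gw mW cW.
have pw k : Lp Om p (w k) by have [] := Sw k.
have [H [pH H0 hH]] := fast_Lp_telescope mOm p1 pw lw.
pose G k := wgrad Om (w k).
have wG k : is_weak_grad Om (w k) (G k) by apply: wgradP; have [] := Sw k.
have pG k i : Lp Om p (fun x => G k x ord0 i) by have [] := Sw k.
have mG k i : measurable_fun Om (fun x => G k x ord0 i) by exact: weak_grad_measurable (wG k).
have gi i k : Lp_energy Om p (fun x => 1 * G k.+1 x ord0 i + -1 * G k x ord0 i) <= fast_rate p k.
  apply: le_trans (gw k).
  have [_ ->] := Sobolev_lin oOm 1 (-1) p1 (Sw k.+1) (Sw k).
  apply: (@Lp_energy_coord_le _ _ i).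
  - by have /(LpP mOm _ p1)[] := (Lp_lin mOm 1 (-1) p1 (pG k.+1 i) (pG k i)).1.
  - apply: Lp_enorm => // j; have := (Lp_lin mOm 1 (-1) p1 (pG k.+1 j) (pG k j)).1.
    by congr (Lp _ _ _); apply/funext => x; rewrite !mxE.
  - by move=> x; rewrite !mxE.
have /choice[Hi hHi] : forall i, exists H : Rn -> R, [/\ Lp Om p H, forall x, 0 <= H x &
    {ae leb, forall x, Om x -> cvg (G k x ord0 i @[k --> \oo]) /\ forall k, `|G k x ord0 i| <= H x}].
  move=> i; exact: (@fast_Lp_telescope _ _ _ mOm p (fun k x => G k x ord0 i) p1
    (fun k => pG k i) (gi i)).
have aeG : {ae leb, forall x, forall i, Om x ->
    cvg (G k x ord0 i @[k --> \oo]) /\ forall k, `|G k x ord0 i| <= Hi i x}.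
  by apply: ae_ord_forall => i; have [] := hHi i.
have [N [mN N0 hN]] := aeG.
have {}hN x : ~ N x -> Om x -> forall i, cvg (G k x ord0 i @[k --> \oo]).
  move=> Nx Ox i; have : ~ (~` [set x | forall i, Om x ->
    cvg (G k x ord0 i @[k --> \oo]) /\ forall k, `|G k x ord0 i| <= Hi i x]) x.
    exact: contra_not (hN x) Nx.
  by move=> /contrapT /(_ i Ox)[].
(* Cutting off on the null set [N] turns convergence almost everywhere into convergence everywhere
   on [Om], from which the measurability of the limit follows. *)
pose GW (x : Rn) : Rn := \row_i (lim (G k x ord0 i @[k --> \oo]) * \1_(~` N) x).
have cGW x : ~ N x -> Om x -> forall i, G k x ord0 i @[k --> \oo] --> GW x ord0 i.
  move=> Nx Ox i; rewrite mxE indicE mem_set// mulr1; exact: hN.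
have aeN : {ae leb, forall x, ~ N x} 
  by apply: negligible_aeP; exists N; split => //; exact: subset_refl.
have mGW i : measurable_fun Om (fun x => GW x ord0 i).
  apply: (@measurable_fun_cvg _ _ _ _ (fun k x => G k x ord0 i * \1_(~` N) x)).
    move=> k; apply: measurable_funM => //; apply: measurable_indic; exact: measurableC.
  move=> x Ox; have [Nx|Nx] := pselect (N x).
    rewrite /GW mxE indicE memNset; last by [].
    by rewrite !mulr0 (_ : (fun k => _) = cst 0);
      [exact: cvg_cst|by apply/funext => k; rewrite mulr0].
  rewrite [GW x ord0 i](_ : _ = GW x ord0 i * \1_(~` N) x).
    by apply: cvgM; [exact: cGW|exact: cvg_cst].
  by rewrite !mxE indicE mem_set// !mulr1.
have aeGW i : {ae leb, forall x, Om x ->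
    G k x ord0 i @[k --> \oo] --> GW x ord0 i /\ forall k, `|G k x ord0 i| <= Hi i x}.
  apply: filterS2 aeN aeG => x Nx hx Ox; split; first exact: cGW.
  exact: (hx i Ox).2.
have [pW cEW] : Lp Om p W /\ Lp_energy Om p (w k) @[k --> \oo] --> Lp_energy Om p W.
  apply: (@Lp_energy_dominated _ _ _ mOm _ _ _ H) => //.
    by move=> k; have /(LpP mOm _ p1)[] := pw k.
  by apply: filterS hH => x hx Ox; exact: (hx Ox).2.
have pGW i : Lp Om p (fun x => GW x ord0 i).
  have [pHi _ _] := hHi i.
  have [] := @Lp_energy_dominated _ _ _ mOm p (fun k x => G k x ord0 i)
    (fun x => GW x ord0 i) (Hi i) p1 _ (mGW i) pHi _ _ => //.
    by apply: filterS (aeGW i) => x hx Ox; exact: (hx Ox).1.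
  by apply: filterS (aeGW i) => x hx Ox; exact: (hx Ox).2.
have WGW : is_weak_grad Om W GW.
  apply: (@weak_grad_limit w W G GW H Hi) => //; try exact: Lp_loc_integrable.
  - by move=> i; apply: Lp_loc_integrable; have [] := hHi i.
  - by move=> i; exact: Lp_loc_integrable.
  - by apply: filterS2 cW hH => x c h Ox; split; [exact: c|exact: (h Ox).2].
have [SW gW] := weak_grad_Sobolev oOm p1 pW WGW pGW.
suff cE : Lp_energy Om p (fun x => enorm (G k x)) @[k --> \oo] -->
    Lp_energy Om p (fun x => enorm (GW x)).
  by split; [exact: SW|exact: cEW|rewrite -gW in cE; exact: cE].
have pHH : Lp Om p (fun x => enorm (\row_i Hi i x : Rn)).
  apply: (Lp_enorm oOm p1) => i.
  have -> : (fun x => (\row_i Hi i x : Rn) ord0 i) = Hi i by apply/funext => x; rewrite mxE.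
  by have [pHi _ _] := hHi i; exact: pHi.
have mE k : measurable_fun Om (fun x => enorm (G k x)) by exact: measurable_enorm.
have mEW : measurable_fun Om (fun x => enorm (GW x)) by exact: measurable_enorm.
have cE : {ae leb, forall x, Om x -> enorm (G k x) @[k --> \oo] --> enorm (GW x)}.
  apply: filterS aeN => x Nx Ox.
  have cs : \sum_(i < n) G k x ord0 i ^+ 2 @[k --> \oo] --> \sum_(i < n) GW x ord0 i ^+ 2.
    have C := @cvg_big R 'I_n +%R 0 xpredT add_continuous nat \oo (index_enum _)
      (fun i k => G k x ord0 i ^+ 2) (fun i => GW x ord0 i ^+ 2) _.
    apply: C => i _; exact: (cvg_comp _ _ (cGW x Nx Ox i) (@exprn_continuous R 2 _)).
  exact: (cvg_comp _ _ cs (@sqrt_continuous R _)).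
have bE : {ae leb, forall x, Om x -> forall k,
    `|enorm (G k x)| <= enorm (\row_i Hi i x : Rn)}.
  apply: filterS aeG => x hx Ox k; rewrite (ger0_norm (enorm_ge0 _)).
  apply: enorm_le => i; rewrite mxE.
  exact: le_trans ((hx i Ox).2 k) (ler_norm _).
exact: (Lp_energy_dominated mOm p1 mE mEW pHH cE bE).2.
Qed.

End Sobolev_limit.

(** * Uniform convexity of the gradient energy and its behaviour under L^2 limits *)

Section gradient_gap.
Variables (R : realType) (n : nat) (Om : set 'rV[R]_n) (p : R).
Local Notation Rn := 'rV[R]_n.
Local Notation leb := (@lebesgue_rV R n).
Hypothesis oOm : open Om.
Hypothesis p1 : 1 < p.
Implicit Types (u v w : Rn -> R).

Let mOm : measurable Om. Proof. exact: open_rV_measurable. Qed.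
Let p1' : 1 <= p. Proof. exact: ltW. Qed.

Definition midfun u v : Rn -> R := fun x => 2^-1 * u x + 2^-1 * v x.

Definition gradient_gap u v : R :=
  2^-1 * grad_energy Om p u + 2^-1 * grad_energy Om p v - grad_energy Om p (midfun u v).

Let enorm_int (G : Rn -> Rn) : Lp Om p (fun x => enorm (G x)) ->
  leb.-integrable Om (EFin \o (fun x => enorm (G x) `^ p)).
Proof.
move=> /(LpP mOm _ p1')[_]; congr (integrable _ _ _); apply/funext => x /=.
by rewrite (ger0_norm (enorm_ge0 _)).
Qed.

Let enorm_energy (G : Rn -> Rn) :
  Lp_energy Om p (fun x => enorm (G x)) = (\int[leb]_(x in Om) (enorm (G x) `^ p))%R.
Proof. by apply: eq_Rintegral => x _; rewrite (ger0_norm (enorm_ge0 _)). Qed.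

Let lin_Lp (a b : R) u v : Sobolev Om p u -> Sobolev Om p v ->
  Lp Om p (fun x => enorm (a *: wgrad Om u x + b *: wgrad Om v x)).
Proof.
move=> [_ _ pu] [_ _ pv]; apply: (Lp_enorm oOm p1') => i.
have := (Lp_lin mOm a b p1' (pu i) (pv i)).1.
by congr (Lp _ _ _); apply/funext => x; rewrite !mxE.
Qed.

Lemma gradient_gapE u v : Sobolev Om p u -> Sobolev Om p v ->
  leb.-integrable Om (EFin \o (fun x => convexity_gap p (wgrad Om u x) (wgrad Om v x))) /\
  gradient_gap u v = (\int[leb]_(x in Om) convexity_gap p (wgrad Om u x) (wgrad Om v x))%R.
Proof.
move=> Su Sv; have [_ E] := Sobolev_lin oOm 2^-1 2^-1 p1' Su Sv.
have iu := enorm_int (wgrad_enorm_Lp oOm p1 Su).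
have iv := enorm_int (wgrad_enorm_Lp oOm p1 Sv).
have im := enorm_int (lin_Lp 2^-1 2^-1 Su Sv).
have iu2 := integrableZR mOm 2^-1 iu; have iv2 := integrableZR mOm 2^-1 iv.
have iuv := integrableDR mOm iu2 iv2.
have ig : leb.-integrable Om (EFin \o (fun x => convexity_gap p (wgrad Om u x) (wgrad Om v x))).
  by have := integrableB mOm iuv im; congr (integrable _ _ _); apply/funext.
split; first exact: ig.
have Em : grad_energy Om p (midfun u v) = _ := etrans E (enorm_energy _).
have Eu : grad_energy Om p u = _ := enorm_energy (wgrad Om u).
have Ev : grad_energy Om p v = _ := enorm_energy (wgrad Om v).
apply: (etrans _ (esym (RintegralB mOm iuv im))).
apply: (f_equal2 (fun x y => x - y) _ Em).
apply: (etrans _ (esym (RintegralD mOm iu2 iv2))).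
apply: (f_equal2 (fun x y => x + y)).
  exact: (etrans (f_equal (fun z => 2^-1 * z) Eu) (esym (RintegralZl 2^-1 mOm iu))).
exact: (etrans (f_equal (fun z => 2^-1 * z) Ev) (esym (RintegralZl 2^-1 mOm iv))).
Qed.

Lemma gradient_gap_ge0 u v : Sobolev Om p u -> Sobolev Om p v -> 0 <= gradient_gap u v.
Proof.
move=> Su Sv; have [_ ->] := gradient_gapE Su Sv.
by apply: Rintegral_ge0 => x _; exact: convexity_gap_ge0.
Qed.

Lemma gradient_uniform_convexity (e : R) : 0 < e -> exists2 C : R, 0 <= C &
  forall u v, Sobolev Om p u -> Sobolev Om p v ->
  grad_energy Om p (fun x => 1 * u x + -1 * v x) <=
  C * gradient_gap u v + e * (grad_energy Om p u + grad_energy Om p v).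
Proof.
move=> e0; have [C C0 hC] := uniform_convexity n p1 e0; exists C => // u v Su Sv.
have [ig ->] := gradient_gapE Su Sv.
have [_ ->] := Sobolev_lin oOm 1 (-1) p1' Su Sv.
have iu := enorm_int (wgrad_enorm_Lp oOm p1 Su).
have iv := enorm_int (wgrad_enorm_Lp oOm p1 Sv).
have id := enorm_int (lin_Lp 1 (-1) Su Sv).
have iuv := integrableDR mOm iu iv.
have Eu : grad_energy Om p u = _ := enorm_energy (wgrad Om u).
have Ev : grad_energy Om p v = _ := enorm_energy (wgrad Om v).
have ig' := integrableZR mOm C ig; have iuv' := integrableZR mOm e iuv.
have Z1 := RintegralZl C mOm ig; have Z2 := RintegralZl e mOm iuv.
have D1 := RintegralD mOm iu iv; have D2 := RintegralD mOm ig' iuv'.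
rewrite enorm_energy Eu Ev.
apply: (le_trans (y := (\int[leb]_(x in Om) (C * convexity_gap p (wgrad Om u x) (wgrad Om v x) +
    e * (enorm (wgrad Om u x) `^ p + enorm (wgrad Om v x) `^ p)))%R)).
  apply: (le_Rintegral mOm id (integrableDR mOm ig' iuv')) => x _ /=.
  by rewrite scale1r scaleN1r; exact: hC.
by rewrite le_eqVlt; apply/orP; left; apply/eqP; exact: ((etrans D2 (f_equal2 (fun x y => x + y) Z1
  (etrans Z2 (f_equal (fun z => e * z) D1))))).
Qed.

Lemma fast_rate_le (q : R) k m : 0 <= q -> (k <= m)%N -> fast_rate q m <= fast_rate q k.
Proof.
move=> q0 km; rewrite /fast_rate.
have t0 j : 0 < 2 ^+ j :> R by rewrite exprn_gt0.
apply: ler_pM.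
- by rewrite invr_ge0 powR_ge0.
- by rewrite invr_ge0.
- rewrite lef_pV2 ?posrE ?powR_gt0//.
  by apply: ge0_ler_powR; rewrite ?nnegrE ?(ltW (t0 _))// ler_weXn2l// ler1n.
- by rewrite lef_pV2 ?posrE ?ltr0n ?expn_gt0// ler_nat leq_exp2l.
Qed.

Lemma Lp_energy2_mid (W w w' : Rn -> R) (e : R) : Lp Om 2 W -> Lp Om 2 w -> Lp Om 2 w' ->
  Lp_energy Om 2 (fun x => 1 * W x + -1 * w x) <= e ->
  Lp_energy Om 2 (fun x => 1 * W x + -1 * w' x) <= e ->
  Lp_energy Om 2 (fun x => 1 * W x + -1 * midfun w w' x) <= e.
Proof.
have one2 : 1 <= 2 :> R by rewrite ler1n.
move=> pW pw pw' hw hw'.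
have [m1 i1] := (LpP mOm _ one2).1 (Lp_lin mOm 1 (-1) one2 pW pw).1.
have [m2 i2] := (LpP mOm _ one2).1 (Lp_lin mOm 1 (-1) one2 pW pw').1.
have pm := (Lp_lin mOm 2^-1 2^-1 one2 pw pw').1.
have [m3 _] := (LpP mOm _ one2).1 (Lp_lin mOm 1 (-1) one2 pW pm).1.
have i1' := integrableZR mOm 2^-1 i1; have i2' := integrableZR mOm 2^-1 i2.
have [|_] := Lp_le mOm one2 m3 (integrableDR mOm i1' i2').
  move=> x _; rewrite !powR_mulrn ?normr_ge0// !real_normK ?num_real//.
  rewrite /midfun; set a := W x; set b := w x; set c := w' x.
  have : 0 <= (b - c) ^+ 2 by exact: sqr_ge0.
  by move=> ?; nra.
move=> /le_trans; apply; rewrite (RintegralD mOm i1' i2').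
rewrite (RintegralZl 2^-1 mOm i1) (RintegralZl 2^-1 mOm i2).
move: hw hw'; rewrite /Lp_energy.
by move: (Rintegral _ _ _) (Rintegral _ _ _) => a b *; lra.
Qed.

(* Limits in [L^2] lose no gradient energy: the approximants whose energy is nearly
   minimal in the limit form a Cauchy sequence by uniform convexity. *)
Lemma Sobolev0_closure (C r : R) (W : Rn -> R) :
  0 <= C -> (forall u, Sobolev0 Om p u -> Lp_energy Om p u <= C * grad_energy Om p u) ->
  Lp Om 2 W ->
  (forall e : R, 0 < e -> exists w, [/\ Sobolev0 Om p w, Lp Om 2 w,
     grad_energy Om p w <= r & Lp_energy Om 2 (fun x => 1 * W x + -1 * w x) <= e]) ->
  [/\ Sobolev Om p W, grad_energy Om p W <= r & Lp_energy Om p W <= C * r].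
Proof.
move=> C0 hC pW hW; have one2 : 1 <= 2 :> R by rewrite ler1n.
(* The admissible approximants at stage [k]. These sets shrink as [k] grows and are stable under
   midpoints, which lets uniform convexity act inside them. *)
pose K k w := [/\ Sobolev0 Om p w, Lp Om 2 w, grad_energy Om p w <= r &
  Lp_energy Om 2 (fun x => 1 * W x + -1 * w x) <= fast_rate 2 k].
have Kex k : exists w, K k w by apply: hW; exact: fast_rate_gt0.
have Kle k m w : (k <= m)%N -> K m w -> K k w.
  by move=> km [? ? ? h]; split => //; apply: le_trans h _; exact: fast_rate_le.
have KS k w : K k w -> Sobolev Om p w by move=> [[]].
have Kmid k w w' : K k w -> K k w' -> K k (midfun w w').
  move=> Kw Kw'; have [Sw pw gw hw] := Kw; have [Sw' pw' gw' hw'] := Kw'; split.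
  - exact: Sobolev0_lin.
  - exact: (Lp_lin mOm 2^-1 2^-1 one2 pw pw').1.
  - have := gradient_gap_ge0 (KS _ _ Kw) (KS _ _ Kw'); rewrite /gradient_gap.
    move: gw gw'; move: (grad_energy Om p w) (grad_energy Om p w').
    by move: (grad_energy _ _ _) => a b c *; lra.
  - exact: Lp_energy2_mid.
(* [T] collects the lower bounds of the gradient energy on some stage, so its supremum [d] is the
   limit of the infima over the stages. *)
pose T := [set t : R | exists k, forall w, K k w -> t <= grad_energy Om p w].
have T0 : T !=set0 by exists 0; exists 0%N => w _; exact: grad_energy_ge0.
have Tub : ubound T r.
  by move=> t [k hk]; have [w Kw] := Kex k; apply: le_trans (hk w Kw) _; have [] := Kw.
have Tsup : has_sup T by split => //; exists r.
pose d := sup T.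
pose A m w := K m w /\ grad_energy Om p w <= d + m.+1%:R^-1.
have Aex m : exists w, A m w.
  apply: contrapT => nA.
  suff /(ub_le_sup (ex_intro _ r Tub)) : T (d + m.+1%:R^-1).
    by rewrite -/d gerDl leNgt invr_gt0 ltr0n.
  exists m => w Kw; rewrite leNgt; apply/negP => lt; apply: nA; exists w; split => //.
  exact: ltW.
have inv_le k m : (k <= m)%N -> m.+1%:R^-1 <= k.+1%:R^-1 :> R.
  by move=> km; rewrite lef_pV2 ?posrE ?ltr0n// ler_nat ltnS.
have Ale k m w : (k <= m)%N -> A m w -> A k w.
  move=> km [Kw gw]; split; first exact: Kle Kw.
  by apply: le_trans gw _; rewrite lerD2l inv_le.
have r0 : 0 <= r by have [w [_ _ gw _]] := Kex 0%N; apply: le_trans gw; exact: grad_energy_ge0.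
(* Two elements of [A] at a late stage have energies at most d + eta, while their midpoint lies in
   [K k] and has energy above d - eta. The gap is thus at most 2 eta; eta and the error coefficient
   are chosen so that each of the two terms contributes at most e/2. *)
have diam (e : R) : 0 < e -> exists m, forall w w', A m w -> A m w' ->
    grad_energy Om p (fun x => 1 * w x + -1 * w' x) <= e.
  move=> e0; have r40 : 0 < 4 * (r + 1) by rewrite mulr_gt0// ltr_wpDl.
  have [B B0 hB] := gradient_uniform_convexity (divr_gt0 e0 r40).
  have B40 : 0 < 4 * (B + 1) by rewrite mulr_gt0// ltr_wpDl.
  pose eta := e / (4 * (B + 1)); have eta0 : 0 < eta by exact: divr_gt0.
  have [t [k hk] dt] := sup_adherent eta0 Tsup.
  have [j hj] : exists j : nat, j.+1%:R^-1 <= eta.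
    exists (Num.truncn eta^-1); rewrite -[leRHS]invrK lef_pV2 ?posrE ?invr_gt0 ?ltr0n//.
    by rewrite ltW// truncnS_gt.
  exists (maxn k j) => w w' Aw Aw'; have [Kw gw] := Aw; have [Kw' gw'] := Aw'.
  apply: le_trans (hB w w' (KS _ _ Kw) (KS _ _ Kw')) _.
  have hm : t <= grad_energy Om p (midfun w w').
    by apply: hk; apply: Kle (Kmid _ _ _ Kw Kw'); exact: leq_maxl.
  have hj' : (maxn k j).+1%:R^-1 <= eta by apply: le_trans hj; apply: inv_le; exact: leq_maxr.
  have [_ _ gwr _] := Kw; have [_ _ gwr' _] := Kw'.
  have eE : eta * (4 * (B + 1)) = e by rewrite /eta divfK// gt_eqF.
  have rE : e / (4 * (r + 1)) * (4 * (r + 1)) = e by rewrite divfK// gt_eqF.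
  have q0 : 0 < e / (4 * (r + 1)) by exact: divr_gt0.
  rewrite /gradient_gap; rewrite -/d in dt.
  move: gw gw' gwr gwr' hm hj' eE rE q0 dt.
  move: (grad_energy _ _ (midfun _ _)) (grad_energy _ _ w) (grad_energy _ _ w').
  move: (_ / (4 * (r + 1))) ((maxn k j).+1%:R^-1) => q y gm g1 g2 *.
  have h1 : B * (2^-1 * g1 + 2^-1 * g2 - gm) <= B * (2 * eta) by apply: ler_wpM2l => //; lra.
  have h2 : q * (g1 + g2) <= q * (2 * r) by apply: ler_wpM2l; lra.
  nra.
(* The division by C + 1 makes the Lp energies of the differences fast as well, through the Poincare
   inequality with constant [C]. *)
have rate0 j : 0 < fast_rate p j / (C + 1).
  by rewrite divr_gt0 ?fast_rate_gt0// ltr_wpDl.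
have /choice[m hm] : forall j, exists m, forall w w', A m w -> A m w' ->
    grad_energy Om p (fun x => 1 * w x + -1 * w' x) <= fast_rate p j / (C + 1).
  by move=> j; exact: diam.
(* The sum makes the stages increasing and at least [m j]; the extra [j] makes the L^2 distance to
   [W] decrease at the fast rate, which identifies the pointwise limit. *)
pose M j := (\sum_(i < j.+1) m i + j)%N.
have mM j : (m j <= M j)%N by rewrite /M big_ord_recr/= -addnA addnCA leq_addr.
have MS j : (M j <= M j.+1)%N.
  by rewrite /M [in leqRHS]big_ord_recr/= -addnA leq_add2l (leq_trans (leqnSn j))// leq_addl.
have jM j : (j <= M j)%N by rewrite /M leq_addl.
have /choice[w hw] : forall j, exists w, A (M j) w by move=> j; exact: Aex.
have Kw j : K (M j) (w j) by have [] := hw j.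
have Sw j : Sobolev Om p (w j) by exact: KS (Kw j).
have dg j : grad_energy Om p (fun x => 1 * w j.+1 x + -1 * w j x) <= fast_rate p j / (C + 1).
  by apply: hm; [apply: Ale (hw j.+1); exact: leq_trans (mM j) (MS j)|exact: Ale (hw j)].
have C1 : 0 < C + 1 by rewrite ltr_wpDl.
have gw j : grad_energy Om p (fun x => 1 * w j.+1 x + -1 * w j x) <= fast_rate p j.
  by apply: le_trans (dg j) _; rewrite ler_pdivrMr// ler_peMr ?lerDr// ltW// fast_rate_gt0.
have lw j : Lp_energy Om p (fun x => 1 * w j.+1 x + -1 * w j x) <= fast_rate p j.
  have S0 : Sobolev0 Om p (fun x => 1 * w j.+1 x + -1 * w j x).
    have [? _ _ _] := Kw j; have [? _ _ _] := Kw j.+1; exact: Sobolev0_lin.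
  apply: le_trans (hC _ S0) _; apply: le_trans (ler_wpM2l C0 (dg j)) _.
  rewrite mulrA ler_pdivrMr// mulrC ler_wpM2l ?lerDl// ltW//; exact: fast_rate_gt0.
have pw2 j : Lp Om 2 (w j) by have [] := Kw j.
have [B [_ B0 hB]] := @fast_Lp _ _ _ mOm 2 (fun j x => 1 * W x + -1 * w j x) one2
  (fun j => (Lp_lin mOm 1 (-1) one2 pW (pw2 j)).1)
  (fun j => le_trans (let: And4 _ _ _ h := Kw j in h) (fast_rate_le (ltW (lt_le_trans ltr01 one2)) (jM j))).
have cW : {ae leb, forall x, Om x -> w j x @[j --> \oo] --> W x}.
  apply: filterS hB => x hx Ox; apply/cvgrPdist_le => e e0.
  have c2 : (2 ^+ j)^-1 * B x @[j --> \oo] --> (0 : R).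
    rewrite -[X in _ --> X](mul0r (B x)); apply: cvgM; last exact: cvg_cst.
    rewrite (_ : (fun j => _) = fun j => (2^-1 : R) ^+ j); last first.
      by apply/funext => j; rewrite exprVn.
    by apply: cvg_expr; rewrite ger0_norm// invf_lt1// ltr1n.
  near=> j; apply: (@le_trans _ _ ((2 ^+ j)^-1 * B x)).
    by have := hx Ox j; rewrite mul1r mulN1r.
  by near: j; apply: (cvgr_le _ c2).
have mW : measurable_fun Om W by have /(LpP mOm _ one2)[] := pW.
have [SW cl cg] := Sobolev_limit oOm p1' Sw lw gw mW cW.
split => //.
  rewrite -(cvg_lim (@norm_hausdorff _ _) cg); apply: limr_le; first by apply: cvgP cg.
  by apply: nearW => j; have [] := Kw j.
rewrite -(cvg_lim (@norm_hausdorff _ _) cl); apply: limr_le; first by apply: cvgP cl.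
apply: nearW => j; have [S0 _ gr _] := Kw j; apply: le_trans (hC _ S0) _; exact: ler_wpM2l.
Unshelve. all: by end_near. Qed.

End gradient_gap.

(** * Convexity of the energy *)

Section energy_convexity.
Variables (R : realType) (n : nat) (Om : set 'rV[R]_n) (p lam delta : R).
Local Notation Rn := 'rV[R]_n.
Local Notation leb := (@lebesgue_rV R n).
Variable f : Rn -> R.
Hypothesis oOm : open Om.
Hypothesis p1 : 1 < p.
Hypothesis lam0 : 0 < lam.
Implicit Types (u mu nu : Rn -> R).

Let mOm : measurable Om. Proof. exact: open_rV_measurable. Qed.
Let p1' : 1 <= p. Proof. exact: ltW. Qed.
Let pn0 : p != 0. Proof. by rewrite gt_eqF// (lt_trans ltr01). Qed.
Let one2 : 1 <= 2 :> R. Proof. by rewrite ler1n. Qed.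
Local Notation M0 := (M0 Om p).
Local Notation E := (energy Om p f lam delta).

Lemma weak_grad0 : is_weak_grad Om (cst (0 : R)) (cst (0 : Rn)).
Proof.
split; [exact: loc_integrable_cst| |].
  move=> i; rewrite (_ : (fun x => _) = cst 0); first exact: loc_integrable_cst.
  by apply/funext => x; rewrite mxE.
move=> phi _ i.
rewrite (_ : (fun x => (0 : R) * _) = cst 0); last by apply/funext => x; rewrite mul0r.
rewrite (_ : (fun x => (cst 0 x : Rn) ord0 i * _) = cst 0); last first.
  by apply/funext => x; rewrite mxE mul0r.
by rewrite Rintegral_cst// mul0r oppr0.
Qed.

Lemma Lp_cst0 (q : R) : 1 <= q -> Lp Om q (cst (0 : R)).
Proof.
move=> q1; apply/(LpP mOm _ q1); split; first exact: measurable_cst.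
rewrite (_ : _ \o _ = cst 0%E); first exact: integrable0.
by apply/funext => x /=; rewrite normr0 powR0// gt_eqF// (lt_le_trans ltr01).
Qed.

Lemma Sobolev_cst0 : Sobolev Om 2 (cst (0 : R)).
Proof.
have [] // := weak_grad_Sobolev oOm one2 (Lp_cst0 one2) weak_grad0.
move=> i; rewrite (_ : (fun x => _) = cst 0); first exact: Lp_cst0.
by apply/funext => x; rewrite mxE.
Qed.

Lemma M0_Sobolev mu : M0 mu -> Sobolev Om p mu.
Proof. by move=> [[]]. Qed.

Lemma M0_measurable mu : M0 mu -> measurable_fun Om mu.
Proof. by move=> /M0_Sobolev[/(LpP mOm _ p1')[]]. Qed.

Lemma M0_ge0 mu : M0 mu -> {ae leb, forall x, Om x -> mu x = `|mu x|}.
Proof.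
move=> [_ [v [_ vmu v0]]]; apply: filterS vmu => x h Ox.
by rewrite ger0_norm// -h// v0.
Qed.

Lemma M0_mid mu nu : M0 mu -> M0 nu -> M0 (midfun mu nu).
Proof.
move=> [Smu [v [cv vmu v0]]] [Snu [w [cw wnu w0]]]; split; first exact: Sobolev0_lin.
exists (midfun v w); split.
- move=> x Ox; apply: (@continuousD _ _ _ (fun x => 2^-1 * v x) (fun x => 2^-1 * w x)).
    by apply: (@continuousM _ _ (cst 2^-1) v); [exact: cst_continuous|exact: cv].
  by apply: (@continuousM _ _ (cst 2^-1) w); [exact: cst_continuous|exact: cw].
- by apply: filterS2 vmu wnu => x h1 h2 Ox; rewrite /midfun h1// h2.
- by move=> x Ox; rewrite addr_ge0// mulr_ge0 ?v0 ?w0.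
Qed.

Definition dirichlet mu u : \bar R :=
  (\int[leb]_(x in Om) ((mu x + lam) * enorm (wgrad Om u x) ^+ 2)%:E)%E.

Definition dual_term mu : \bar R :=
  ereal_sup [set ((2 * \int[leb]_(x in Om) (f x * u x))%R%:E - dirichlet mu u)%E
    | u in H1_mean0 Om].

Lemma energyE mu : M0 mu -> E mu =
  (dual_term mu + \int[leb]_(x in Om) (mu x)%:E + (delta * grad_energy Om p mu)%:E)%E.
Proof.
move=> Mmu; rewrite /energy asboolT//; congr (_ + _)%E.
have SL := wgrad_enorm_Lp oOm p1 (M0_Sobolev Mmu).
have -> : (Lp_norm_grad Om p mu `^ p)%E = (grad_energy Om p mu)%:E.
  rewrite /Lp_norm_grad (Lp_normE mOm p1' SL) poweR_EFin powRVK//.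
  exact: Lp_energy_ge0.
by rewrite EFinM.
Qed.

Lemma measurable_dirichlet mu u : measurable_fun Om mu -> Sobolev Om 2 u ->
  measurable_fun Om (fun x => ((mu x + lam) * enorm (wgrad Om u x) ^+ 2)%:E).
Proof.
move=> mmu [_ _ pG]; apply/measurable_EFinP; apply: measurable_funM.
  exact: measurable_funD.
apply: measurable_funX; apply: measurable_enorm => i.
by have /(LpP mOm _ one2)[] := pG i.
Qed.

(** An element of [M0] is nonnegative only almost everywhere. Passing to its absolute value makes
    the integrand nonnegative everywhere, so the integral calculus of nonnegative functions applies
    even to infinite values. *)
Lemma dirichlet_abs mu u : M0 mu -> Sobolev Om 2 u ->
  dirichlet mu u = dirichlet (fun x => `|mu x|) u.
Proof.
move=> Mmu Su; have mmu := M0_measurable Mmu; apply: ae_eq_integral => //.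
- exact: measurable_dirichlet.
- by apply: measurable_dirichlet => //; exact: measurableT_comp.
- by apply: filterS (M0_ge0 Mmu) => x h Ox /=; rewrite {1}(h Ox).
Qed.

Let dirichlet_abs_ge0 mu u x :
  (0 <= ((`|mu x| + lam) * enorm (wgrad Om u x) ^+ 2)%:E)%E.
Proof. by rewrite lee_fin mulr_ge0 ?addr_ge0 ?sqr_ge0// ltW. Qed.

Lemma dirichlet_ge0 mu u : M0 mu -> Sobolev Om 2 u -> (0 <= dirichlet mu u)%E.
Proof. by move=> Mmu Su; rewrite dirichlet_abs//; apply: integral_ge0 => x _. Qed.

Lemma dirichlet_mid mu nu u : M0 mu -> M0 nu -> Sobolev Om 2 u ->
  dirichlet (midfun mu nu) u =
  (2^-1%:E * dirichlet mu u + 2^-1%:E * dirichlet nu u)%E.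
Proof.
move=> Mmu Mnu Su; rewrite (dirichlet_abs Mmu Su) (dirichlet_abs Mnu Su).
have mmu := M0_measurable Mmu; have mnu := M0_measurable Mnu.
have m1 : measurable_fun Om (fun x => `|mu x|) by exact: measurableT_comp.
have m2 : measurable_fun Om (fun x => `|nu x|) by exact: measurableT_comp.
have h2 : (0 <= 2^-1 :> R) by [].
have d1 := measurable_dirichlet m1 Su; have d2 := measurable_dirichlet m2 Su.
rewrite /dirichlet -!ge0_integralZl_EFin//; try by move=> x _; exact: dirichlet_abs_ge0.
rewrite -ge0_integralD//; try by move=> x _; rewrite mule_ge0 ?dirichlet_abs_ge0 ?lee_fin.
  apply: ae_eq_integral => //.
  - by apply: measurable_dirichlet => //; exact: M0_measurable (M0_mid Mmu Mnu).
  - by apply: emeasurable_funD; apply: measurable_funeM.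
  - apply: filterS2 (M0_ge0 Mmu) (M0_ge0 Mnu) => x h1 h3 Ox /=.
    rewrite -!EFinM -EFinD /midfun {1}(h1 Ox) {1}(h3 Ox).
    by congr EFin; field.
- exact: measurable_funeM.
- exact: measurable_funeM.
Qed.

(** The competitor u = 0 gives the value zero. *)
Lemma dual_term_ge0 mu : M0 mu -> (0 <= dual_term mu)%E.
Proof.
move=> Mmu; apply: ereal_sup_ubound; exists (cst 0).
  split; first exact: Sobolev_cst0.
  by rewrite Rintegral_cst// mul0r.
rewrite (_ : (fun x => f x * _) = cst 0); last by apply/funext => x; rewrite mulr0.
rewrite Rintegral_cst// mul0r mulr0.
have -> : dirichlet mu (cst 0) = 0%E.
  rewrite -(integral0 leb Om); apply: ae_eq_integral => //.
  - by apply: measurable_dirichlet; [exact: M0_measurable|exact: Sobolev_cst0].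
  - apply: filterS (wgrad_ae oOm weak_grad0) => x h Ox.
    by rewrite h//= enorm0 expr0n/= mulr0.
by rewrite sube0.
Qed.

Lemma mass_ge0 mu : M0 mu -> (0 <= \int[leb]_(x in Om) (mu x)%:E)%E /\
  (\int[leb]_(x in Om) (mu x)%:E = \int[leb]_(x in Om) `|mu x|%:E)%E.
Proof.
move=> Mmu; have mmu := M0_measurable Mmu.
have H : (\int[leb]_(x in Om) (mu x)%:E = \int[leb]_(x in Om) `|mu x|%:E)%E.
  apply: ae_eq_integral => //; try by apply/measurable_EFinP.
    by apply/measurable_EFinP; exact: measurableT_comp.
  by apply: filterS (M0_ge0 Mmu) => x h Ox; rewrite {1}(h Ox).
by split => //; rewrite H; apply: integral_ge0 => x _; rewrite lee_fin.
Qed.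

Lemma energy_fin mu : M0 mu -> (E mu < +oo)%E -> exists a b : R,
  [/\ dual_term mu = a%:E, (\int[leb]_(x in Om) (mu x)%:E = b%:E)%E &
      E mu = (a + b + delta * grad_energy Om p mu)%:E].
Proof.
move=> Mmu; rewrite (energyE Mmu).
have := dual_term_ge0 Mmu; have [+ _] := mass_ge0 Mmu.
case: (dual_term mu) => [a| |] //; case: (\int[leb]_(x in Om) _)%E => [b| |] //= _ _ _.
by exists a, b.
Qed.

Let half_le (X s t a b : R) : X - s <= a -> X - t <= b ->
  X - (2^-1 * s + 2^-1 * t) <= 2^-1 * a + 2^-1 * b.
Proof. by move=> *; lra. Qed.

Let gap_le (c a1 a2 b1 b2 x y z : R) : c <= 2^-1 * a1 + 2^-1 * b1 ->
  c + (2^-1 * a2 + 2^-1 * b2) + delta * z + delta * (2^-1 * x + 2^-1 * y - z) <=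
  2^-1 * (a1 + a2 + delta * x) + 2^-1 * (b1 + b2 + delta * y).
Proof. by move=> *; lra. Qed.

(** For fixed [u] the expression under the supremum is affine in mu, so the dual term is convex; the
    mass is linear. The defect of convexity is therefore at least that of the gradient term. *)
Lemma energy_mid mu nu (a b : R) : M0 mu -> M0 nu -> E mu = a%:E -> E nu = b%:E ->
  M0 (midfun mu nu) /\
  exists2 c : R, E (midfun mu nu) = c%:E &
    c + delta * gradient_gap Om p mu nu <= 2^-1 * a + 2^-1 * b.
Proof.
move=> Mmu Mnu Ea Eb; have Mm := M0_mid Mmu Mnu; split => //.
have [|a1 [a2 [A1 A2 A3]]] := energy_fin Mmu; first by rewrite Ea ltry.
have [|b1 [b2 [B1 B2 B3]]] := energy_fin Mnu; first by rewrite Eb ltry.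
have {A3}aE : a = a1 + a2 + delta * grad_energy Om p mu by move: A3; rewrite Ea => -[].
have {B3}bE : b = b1 + b2 + delta * grad_energy Om p nu by move: B3; rewrite Eb => -[].
have mass : (\int[leb]_(x in Om) (midfun mu nu x)%:E = (2^-1 * a2 + 2^-1 * b2)%:E)%E.
  have [_ absm] := mass_ge0 Mm; have [_ absu] := mass_ge0 Mmu; have [_ absn] := mass_ge0 Mnu.
  have mmu := M0_measurable Mmu; have mnu := M0_measurable Mnu.
  have n1 : measurable_fun Om (fun x => `|mu x|%:E).
    by apply/measurable_EFinP; exact: measurableT_comp.
  have n2 : measurable_fun Om (fun x => `|nu x|%:E).
    by apply/measurable_EFinP; exact: measurableT_comp.
  have h2 : (0 <= 2^-1 :> R) by [].
  rewrite EFinD !EFinM -A2 -B2 absu absn.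
  rewrite -!ge0_integralZl_EFin//.
  rewrite -ge0_integralD//; last 2 first.
  - exact: measurable_funeM.
  - exact: measurable_funeM.
  apply: ae_eq_integral => //.
  - by apply/measurable_EFinP; exact: M0_measurable.
  - by apply: emeasurable_funD; apply: measurable_funeM.
  - apply: filterS2 (M0_ge0 Mmu) (M0_ge0 Mnu) => x h1 h3 Ox /=.
    by rewrite -!EFinM -EFinD /midfun {1}(h1 Ox) {1}(h3 Ox).
have dual : (dual_term (midfun mu nu) <= (2^-1 * a1 + 2^-1 * b1)%:E)%E.
  apply: ge_ereal_sup => _ [u Hu <-]; have [Su _] := Hu.
  rewrite dirichlet_mid//.
  have ha : ((2 * \int[leb]_(x in Om) (f x * u x))%R%:E - dirichlet mu u <= a1%:E)%E.
    by rewrite -A1; apply: ereal_sup_ubound; exists u.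
  have hb : ((2 * \int[leb]_(x in Om) (f x * u x))%R%:E - dirichlet nu u <= b1%:E)%E.
    by rewrite -B1; apply: ereal_sup_ubound; exists u.
  have := dirichlet_ge0 Mmu Su; have := dirichlet_ge0 Mnu Su.
  (* An infinite Dirichlet integral at either end makes the one at the midpoint infinite, and the
     value under the supremum is then minus infinity. *)
  move: ha hb; move: (2 * _)%R => X.
  case: (dirichlet mu u) => [s| |]; case: (dirichlet nu u) => [t| |] //=.
  - by rewrite !lee_fin => h1 h2 _ _; exact: half_le h1 h2.
  - by move=> _ _ _ _; rewrite gt0_muley ?lte_fin// addey// leNye.
  - by move=> _ _ _ _; rewrite gt0_muley ?lte_fin// addye// leNye.
  - by move=> _ _ _ _; rewrite gt0_muley ?lte_fin// addye// leNye.
have dge0 := dual_term_ge0 Mm.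
rewrite (energyE Mm) mass; move: dual dge0; case: (dual_term _) => [c| |] //.
rewrite !lee_fin => hc _; exists (c + (2^-1 * a2 + 2^-1 * b2) + delta * grad_energy Om p (midfun mu nu)).
  by rewrite -!EFinD.
by rewrite aE bE; exact: gap_le.
Qed.

End energy_convexity.

(** * Gradient flows in Hilbert spaces *)

Section creeping.
Variable R : realType.
Local Notation mu := (@lebesgue_measure R).
Implicit Types (a b t u v : R) (l : seq (R * R)) (D : R -> R -> R) (g : R -> R).

(** The list runs from right to left, because creeping puts the newest interval at its head. *)
Definition disjoint_family l := pairwise (fun x y : R * R => y.2 <= x.1) l.

(* Absolute continuity of a curve on [0, T], [D u v] being the distance between
   its positions at times [u] and [v] *)
Definition ac_dist (T : R) D := forall e : R, 0 < e -> exists2 d : R, 0 < d &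
  forall l, (forall x, x \in l -> [/\ 0 <= x.1, x.1 <= x.2 & x.2 <= T]) ->
    disjoint_family l -> \sum_(x <- l) (x.2 - x.1) < d -> \sum_(x <- l) D x.1 x.2 < e.

Lemma ac_distZ (T K : R) D : 0 <= K -> ac_dist T D -> ac_dist T (fun u v => K * D u v).
Proof.
move=> K0 aD e e0; have K1 : 0 < K + 1 by rewrite ltr_wpDl.
have [d d0 hd] := aD (e / (K + 1)) (divr_gt0 e0 K1); exists d => // l l1 l2 l3.
rewrite -mulr_sumr; have := hd l l1 l2 l3; rewrite ltr_pdivlMr//.
set s := \sum_(_ <- _) _ => h; have [s0|s0] := leP 0 s; first by nra.
by apply: le_lt_trans e0; rewrite mulr_ge0_le0// ltW.
Qed.

Lemma ac_distD (T : R) D D' : ac_dist T D -> ac_dist T D' ->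
  ac_dist T (fun u v => D u v + D' u v).
Proof.
move=> aD aD' e e0; have e2 : 0 < e / 2 by rewrite divr_gt0.
have [d d0 hd] := aD _ e2; have [d' d0' hd'] := aD' _ e2.
exists (Num.min d d'); first by rewrite lt_min d0.
move=> l l1 l2; rewrite lt_min => /andP[l3 l4].
by rewrite big_split/= (splitr e) ltrD// ?hd ?hd'.
Qed.

Lemma ac_dist_shift (T h : R) D : 0 <= h -> ac_dist (T + h) D ->
  ac_dist T (fun u v => D (u + h) (v + h)).
Proof.
move=> h0 aD e e0; have [d d0 hd] := aD e e0; exists d => // l l1 l2 l3.
have := hd [seq (x.1 + h, x.2 + h) | x <- l]; rewrite !big_map /=; apply.
- move=> _ /mapP[x xl ->] /=; have [x1 x2 x3] := l1 x xl.
  by split; rewrite ?lerD2r// addr_ge0.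
- rewrite /disjoint_family pairwise_map; move: l2; congr (_ = true).
  by apply: eq_pairwise => x y /=; rewrite lerD2r.
- by move: l3; congr (_ < _); apply: eq_bigr => x _; ring.
Qed.

(** Real induction. The supremum of the good points is itself good, being reached from good points
    on its left, and it is exceeded by good points unless it equals [T]. *)
Lemma local_global (a T : R) (P : R -> Prop) : a <= T -> P a ->
  (forall t, a <= t -> t <= T -> exists2 r : R, 0 < r &
    forall u v, a <= u -> u <= t -> t <= v -> v <= T -> t - r < u -> v < t + r ->
      P u -> P v) -> P T.
Proof.
move=> T0 P0 loc; pose S := [set t | [/\ a <= t, t <= T & P t]].
have S0 : S a by split.
have hS : has_sup S by split; [exists a|exists T => t []].
pose s := sup S.
have s0 : a <= s by exact: ub_le_sup hS.2 _ S0.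
have sT : s <= T by apply: ge_sup; [exact: hS.1|move=> t []].
have [r r0 hr] := loc s s0 sT.
have [u [u0 uT Pu] us] := sup_adherent r0 hS.
have us' : u <= s by apply: ub_le_sup; [exact: hS.2|split].
have Ps : P s by apply: (hr u s) => //; rewrite ltrDl.
have [<-//|sT'] := eqVneq s T.
have {}sT' : s < T by rewrite lt_neqAle sT'.
pose v := Num.min T (s + r / 2).
have r2 : 0 < r / 2 by rewrite divr_gt0.
have sv : s < v by rewrite lt_min sT' ltrDl.
have vT : v <= T by rewrite ge_min lexx.
have vr : v < s + r.
  by rewrite gt_min [X in _ || X](_ : _ = true) ?orbT// ltrD2l gtr_pMr// invf_lt1// ltr1n.
have Pv : P v by apply: (hr s v) => //; [exact: ltW|rewrite ltrBlDr ltrDl].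
suff : v <= s by rewrite leNgt sv.
by apply: ub_le_sup; [exact: hS.2|split => //; apply: le_trans s0 (ltW sv)].
Qed.

Let step_slope (a b c d be e x y z : R) : a - b <= (be + e) * (x - z) + d -> c - a <= (be + e) * (y - x) ->
  c - b <= (be + e) * (y - z) + d.
Proof. by nra. Qed.

Let step_open (a b c d be e x y z D : R) : 0 < e -> x <= y ->
  a - b <= (be + e) * (x - z) + d -> `|c - a| <= D ->
  c - b <= (be + e) * (y - z) + (D + `|be| * (y - x) + d).
Proof.
move=> e0 xy h1 h2; have h3 := ler_norm (c - a); have h4 := ler_norm (- be).
by rewrite normrN in h4; nra.
Qed.

Let final_estimate (be e1 e T A B : R) : 0 < T + 1 + `|be| -> e1 * (T + 1 + `|be|) = e ->
  A < e1 -> B < e1 -> (be + e1) * T + (A + `|be| * B) <= be * T + e.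
Proof. by move=> k <- a b; have := normr_ge0 be; nra. Qed.

(* The exceptional null set is covered by an open set [U] of small measure: the
   variation of [g] over intervals inside [U] is controlled by absolute continuity,
   elsewhere the slope bound is used, and the two estimates are glued by creeping
   along the interval. *)
Lemma creep (a T beta : R) D g : 0 <= a -> a <= T -> ac_dist T D ->
  (forall u v, a <= u -> u <= v -> v <= T -> `|g v - g u| <= D u v) ->
  {ae mu, forall t : R, a < t -> t < T -> forall e : R, 0 < e -> exists2 r : R, 0 < r &
     forall u v, a <= u -> u <= t -> t <= v -> v <= T -> t - r < u -> v < t + r ->
       g v - g u <= (beta + e) * (v - u)} ->
  g T - g a <= beta * (T - a).
Proof.
move=> a0 T0 aD gD slope; have [->|Tn0] := eqVneq T a; first by rewrite !subrr mulr0.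
have {Tn0}T0' : a < T by rewrite lt_def Tn0.
apply/ler_addgt0Pr => e e0; pose e' := e / (T - a + 1 + `|beta|).
have k0 : 0 < T - a + 1 + `|beta| by rewrite ltr_wpDr// ltr_wpDl// subr_ge0.
have e'0 : 0 < e' by exact: divr_gt0.
have [d0 d00 hd] := aD e' e'0.
(* The first bound controls the variation of [g] over the intervals inside [U], the second their
   contribution to the [beta] term. *)
pose d := Num.min d0 e'; have dP : 0 < d by rewrite lt_min d00.
have [N [mN N0 sN]] := slope.
(* the endpoints are thrown into the exceptional set *)
pose N' := N `|` [set a] `|` [set T].
have mN' : measurable N' by apply: measurableU => //; exact: measurableU.
have N'0 : mu N' = 0%E.
  apply: null_set_setU => //; first exact: measurableU.
    apply: null_set_setU => //; exact: lebesgue_measure_set1.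
  exact: lebesgue_measure_set1.
have N'oo : (mu N' < +oo)%E by apply: le_lt_trans (ltry 0); have := N'0 => /= ->.
have N'le : (mu N' <= 0)%E by have := N'0 => /= ->.
have [U [oU NU Ud]] := lebesgue_regularity_outer mN' N'oo dP.
have mU : measurable U by exact: open_measurable.
have {}Ud : (mu U < d%:E)%E.
  apply: le_lt_trans Ud; rewrite -{1}(setDUK NU) (le_trans (measureU2 _ _ _))//.
  - exact: measurableD.
  - by rewrite -[leRHS]add0e; apply: leeD => //.
(* [l] records the intervals crossed inside [U], whose total length the measure of [U] bounds. The
   summand with |beta| makes up for slope being credited over them when [beta] is negative. *)
pose P t := exists l, [/\ forall x, x \in l -> [/\ a <= x.1, x.1 <= x.2 & x.2 <= t],
  disjoint_family l, ((\sum_(x <- l) (x.2 - x.1))%:E <= mu (U `&` `[a, t]%classic))%E &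
  g t - g a <= (beta + e') * (t - a) + \sum_(x <- l) (D x.1 x.2 + `|beta| * (x.2 - x.1))].
suff [l [l1 l2 l3 l4]] : P T.
  have l5 : \sum_(x <- l) (x.2 - x.1) < d.
    rewrite -lte_fin; apply: (le_lt_trans l3); apply: le_lt_trans Ud.
    by apply: le_measure; rewrite ?inE//; exact: measurableI.
  move: l5; rewrite lt_min => /andP[l5 l6].
  apply: (le_trans l4); rewrite big_split/= -mulr_sumr.
  apply: final_estimate => //; last first.
    by apply: hd => // x /l1[h1 h2 h3]; split => //; exact: le_trans h1.
  by rewrite mulfVK// gt_eqF.
apply: (@local_global a) => //.
  exists [::]; split => //; first by rewrite big_nil.
  by rewrite big_nil !subrr mulr0 addr0.
move=> t t0 tT; have [Ut|nUt] := pselect (U t).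
  have /nbhs_ballP[r/= r0 rU] := open_nbhs_nbhs (conj oU Ut).
  exists r => // u v u0 ut tv vT ru rv [l [l1 l2 l3 l4]].
  have uv : u <= v by exact: le_trans tv.
  exists ((u, v) :: l); split.
  - move=> x; rewrite inE => /predU1P[->|/l1[h1 h2 h3]]//; split => //.
    exact: le_trans uv.
  - rewrite /disjoint_family/= [X in _ && X]l2 andbT.
    by apply/allP => x /l1[].
  - rewrite big_cons/= EFinD.
    have sub : U `&` `[a, u]%classic `|` `]u, v]%classic `<=` U `&` `[a, v]%classic.
      move=> x [[Ux]|] /=; rewrite !in_itv/= => /andP[h1 h2].
        by split => //; rewrite h1 (le_trans h2).
      split; last by rewrite h2 (le_trans u0 (ltW h1)).
      by apply: rU; rewrite /ball/= ltr_norml; apply/andP; split; lra.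
    have muv : measurable `]u, v]%classic by exact: measurable_itv.
    have mUu : measurable (U `&` `[a, u]%classic) by apply: measurableI => //; exact: measurable_itv.
    apply: (@le_trans _ _ (mu (U `&` `[a, u]%classic `|` `]u, v]%classic))); last first.
      by apply: le_measure; rewrite ?inE//; [exact: measurableU|apply: measurableI => //; exact: measurable_itv].
    rewrite measureU//; last first.
      apply/seteqP; split => // x [[_]] /=; rewrite !in_itv/= => /andP[_ h1] /andP[h2 _].
      by move: h1; rewrite leNgt h2.
    rewrite addeC; apply: leeD; first exact: l3.
    have := lebesgue_measure_itv `]u, v] => /=; rewrite lte_fin => ->.
    by have [//|h] := ltP u v; rewrite lee_fin; lra.
  - by rewrite big_cons/=; apply: step_open l4 _ => //; exact: gD.
have nNt : ~ N' t by move=> /NU.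
have t00 : a < t.
  by rewrite lt_def t0 andbT; apply/eqP => h; apply: nNt; left; right.
have tTT : t < T.
  by rewrite lt_neqAle tT andbT; apply/eqP => h; apply: nNt; right.
have [r r0 hr] := contrapT (fun h => nNt (or_introl (or_introl (sN t h)))) t00 tTT e' e'0.
exists r => // u v u0 ut tv vT ru rv [l [l1 l2 l3 l4]].
have uv : u <= v by exact: le_trans tv.
exists l; split => //.
- by move=> x /l1[h1 h2 h3]; split => //; exact: le_trans uv.
- apply: (le_trans l3); apply: le_measure; rewrite ?inE; do ?[apply: measurableI => //; exact: measurable_itv].
  by apply: setIS => x /=; rewrite !in_itv/= => /andP[-> /le_trans]; apply.
- by apply: step_slope l4 _; exact: hr.
Qed.

End creeping.

Section lebesgue_line.
Variable R : realType.
Local Notation mu := (@lebesgue_measure R).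

Definition shift_line (h : R) : measurableTypeR R -> measurableTypeR R := fun x => x + h.

Lemma measurable_shift_line h : measurable_fun setT (shift_line h).
Proof. by apply: measurable_funD; [exact: measurable_id|exact: measurable_cst]. Qed.

HB.instance Definition _ h := isMeasurableFun.Build _ _ _ _ (shift_line h)
  (measurable_shift_line h).

Lemma lebesgue_measure_shift (h : R) (A : set R) : measurable A ->
  pushforward mu (shift_line h) A = mu A.
Proof.
move=> mA; apply/esym/lebesgue_measure_unique => //= _ [[a b]] _ <-.
rewrite /pushforward (_ : _ @^-1` _ = `]a - h, b - h]%classic); last first.
  by apply/seteqP; split => x /=; rewrite !in_itv/= ltrBlDr lerBrDr.
rewrite !lebesgue_measure_itv/= !lte_fin ltrD2r.
by case: ifP => // _; rewrite -!EFinB; congr EFin; rewrite opprB addrA subrK.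
Qed.

Lemma ae_shift (h : R) (P : R -> Prop) : {ae mu, forall t, P t} ->
  {ae mu, forall t, P (t + h)}.
Proof.
move=> [N [mN N0 sN]]; exists (shift_line h @^-1` N); split.
- by rewrite -[X in measurable X]setTI; exact: measurable_shift_line.
- by rewrite -N0; exact: (lebesgue_measure_shift h mN).
- by move=> x /= nP; apply: sN.
Qed.

Lemma ae_dense (a b : R) (P : R -> Prop) : {ae mu, forall t, P t} -> a < b ->
  exists t, [/\ a < t, t < b & P t].
Proof.
move=> [N [mN N0 sN]] ab; apply: contrapT => no.
have sub : `]a, b[%classic `<=` N.
  move=> x; rewrite /= in_itv/= => /andP[ax xb]; apply: sN => /= Px.
  by apply: no; exists x.
have : (mu `]a, b[%classic <= mu N)%E.
  by apply: le_measure => //; rewrite inE//; exact: measurable_itv.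
rewrite [X in (_ <= X)%E -> _]N0 => h.
have := lebesgue_measure_itv `]a, b[; rewrite /= lte_fin ab => h'.
by move: h; rewrite h' lee_fin subr_le0 leNgt ab.
Qed.

End lebesgue_line.

Section hilbert_flow.
Variables (R : realType) (H : lmodType R) (L : set H) (dot : H -> H -> R).
Local Notation mu := (@lebesgue_measure R).
Hypothesis Llin : forall a b u v, L u -> L v -> L (a *: u + b *: v).
Hypothesis dotC : forall u v, dot u v = dot v u.
Hypothesis dot_lin : forall a b u v w, L u -> L v -> L w ->
  dot (a *: u + b *: v) w = a * dot u w + b * dot v w.
Hypothesis dot_ge0 : forall u, L u -> 0 <= dot u u.

Let sub_exchange (x y z t : H) : (x - y) - (z - t) = (x - z) + (t - y).
Proof. by rewrite opprB addrACA [RHS]addrACA [- z - _]addrC. Qed.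

(** Only a seminorm: functions are not identified when equal almost everywhere, so [dot] is merely
    positive semidefinite, and it is bilinear on [L] alone, where products are integrable. *)
Definition dot_norm u := Num.sqrt (dot u u).
Local Notation nrm := dot_norm.

Let LD u v : L u -> L v -> L (u + v).
Proof. by move=> Lu Lv; have := Llin 1 1 Lu Lv; rewrite !scale1r. Qed.

Let LB u v : L u -> L v -> L (u - v).
Proof. by move=> Lu Lv; have := Llin 1 (-1) Lu Lv; rewrite scale1r scaleN1r. Qed.

Let LZ a u : L u -> L (a *: u).
Proof. by move=> Lu; have := Llin a 0 Lu Lu; rewrite scale0r addr0. Qed.

Let LN u : L u -> L (- u).
Proof. by move=> Lu; rewrite -scaleN1r; exact: LZ. Qed.

Let dotD u v w : L u -> L v -> L w -> dot (u + v) w = dot u w + dot v w.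
Proof. by move=> Lu Lv Lw; have := dot_lin 1 1 Lu Lv Lw; rewrite !scale1r !mul1r. Qed.

Let dotB u v w : L u -> L v -> L w -> dot (u - v) w = dot u w - dot v w.
Proof.
by move=> Lu Lv Lw; have := dot_lin 1 (-1) Lu Lv Lw; rewrite scale1r scaleN1r mul1r mulN1r.
Qed.

Let dotZ a u w : L u -> L w -> dot (a *: u) w = a * dot u w.
Proof.
by move=> Lu Lw; have := dot_lin a 0 Lu Lu Lw; rewrite scale0r addr0 mul0r addr0.
Qed.

Let dotN u w : L u -> L w -> dot (- u) w = - dot u w.
Proof. by move=> Lu Lw; rewrite -scaleN1r dotZ// mulN1r. Qed.

Let nrm_ge0 u : 0 <= nrm u. Proof. exact: sqrtr_ge0. Qed.

Let nrm_sqr u : L u -> nrm u ^+ 2 = dot u u.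
Proof. by move=> Lu; rewrite sqr_sqrtr// dot_ge0. Qed.

Let sqr_discr (x y z : R) : (forall a b, 0 <= a ^+ 2 * x + 2 * a * b * y + b ^+ 2 * z) ->
  y ^+ 2 <= x * z.
Proof.
move=> h; have [z0|zn0] := eqVneq z 0.
  rewrite z0 mulr0; have [->|yn0] := eqVneq y 0; first by rewrite expr0n.
  have := h 1 (- (x + 1) / (2 * y)); rewrite z0 (_ : _ + _ = -1); last by field; rewrite yn0.
  by rewrite lerNr oppr0 ler10.
have z1 : 0 < z by rewrite lt_def zn0; have := h 0 1; rewrite expr0n !mul0r mulr0 !mul0r !add0r expr1n mul1r.
have := h z (- y); rewrite (_ : _ + _ = z * (x * z - y ^+ 2)); last by ring.
by rewrite pmulr_rge0// subr_ge0.
Qed.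

Lemma dot_le_norm u v : L u -> L v -> `|dot u v| <= nrm u * nrm v.
Proof.
move=> Lu Lv; rewrite -(@ler_pXn2r _ 2)// ?nnegrE ?mulr_ge0//.
rewrite exprMn !nrm_sqr// real_normK ?num_real//; apply: sqr_discr => a b.
have Lw : L (a *: u + b *: v) by exact: Llin.
have := dot_ge0 Lw; rewrite dot_lin// [dot u _]dotC [dot v (_ + _)]dotC !dot_lin// [dot v u]dotC.
by congr (_ <= _); ring.
Qed.

Lemma dot_normD u v : L u -> L v -> nrm (u + v) <= nrm u + nrm v.
Proof.
move=> Lu Lv; rewrite -(@ler_pXn2r _ 2)// ?nnegrE ?addr_ge0//.
have Luv := LD Lu Lv.
rewrite sqrrD !nrm_sqr// dotD// [dot u _]dotC [dot v (_ + _)]dotC !dotD// [dot v u]dotC.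
have := le_trans (ler_norm _) (dot_le_norm Lu Lv).
by move: (dot u u) (dot v v) (dot u v) (nrm u * nrm v) => a b c d h; lra.
Qed.

Lemma dot_normZ a u : L u -> nrm (a *: u) = `|a| * nrm u.
Proof.
move=> Lu; have Lau := LZ a Lu.
rewrite /nrm dotZ// dotC dotZ// mulrA -expr2 sqrtrM ?sqr_ge0//.
by rewrite sqrtr_sqr.
Qed.

Let nrmN u : L u -> nrm (- u) = nrm u.
Proof. by move=> Lu; rewrite -scaleN1r dot_normZ// normrN1 mul1r. Qed.

Let nrmBC u v : L u -> L v -> nrm (u - v) = nrm (v - u).
Proof. by move=> Lu Lv; rewrite -opprB nrmN//; exact: LB. Qed.

(* Only the values at nonnegative times of a curve matter. *)
Definition curve_derivative (c : R -> H) (t : R) (v : H) := forall e : R, 0 < e ->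
  exists2 r : R, 0 < r & forall h, `|h| < r -> 0 <= t + h ->
    nrm (c (t + h) - c t - h *: v) <= e * `|h|.

Lemma ac_dist_le (T : R) (D D' : R -> R -> R) :
  (forall u v, 0 <= u -> u <= v -> v <= T -> D u v <= D' u v) ->
  ac_dist T D' -> ac_dist T D.
Proof.
move=> DD' aD e e0; have [d d0 hd] := aD e e0; exists d => // l l1 l2 l3.
apply: le_lt_trans (hd l l1 l2 l3); rewrite big_seq [leRHS]big_seq.
by apply: ler_sum => x /l1[]; exact: DD'.
Qed.

Section curve.
Variables (T : R) (b : R -> H).
Hypothesis T0 : 0 <= T.
Hypothesis Lb : forall t, 0 <= t -> L (b t).
Hypothesis acb : ac_dist T (fun u v => nrm (b v - b u)).

(** Absolute continuity bounds increments over intervals shorter than some [d] by 1, and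
    [local_global] chains such intervals. *)
Lemma ac_curve_bounded : exists2 K : R, 0 <= K & forall t, 0 <= t -> t <= T -> nrm (b t) <= K.
Proof.
have [d d0 hd] := acb ltr01.
have step u v : 0 <= u -> u <= v -> v <= T -> v - u < d -> nrm (b v) <= nrm (b u) + 1.
  move=> u0 uv vT vud; rewrite -[b v](subrKC (b u)).
  have Lu := Lb u0; have Lv := Lb (le_trans u0 uv).
  apply: (le_trans (dot_normD Lu (LB Lv Lu))); rewrite lerD2l ltW//.
  have := hd [:: (u, v)]; rewrite !big_seq1; apply => //.
  by move=> x; rewrite inE => /eqP ->.
suff [K hK] : exists K : R, forall t, 0 <= t -> t <= T -> nrm (b t) <= K.
  by exists (Num.max K 0) => [|t t0 tT]; rewrite le_max ?lexx ?orbT// hK.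
apply: (@local_global _ 0 T (fun s => exists K : R, forall t, 0 <= t -> t <= s -> nrm (b t) <= K)) => //.
  by exists (nrm (b 0)) => t t0 t0'; rewrite (_ : t = 0)//; apply/eqP; rewrite eq_le t0 t0'.
move=> t t0 tT; exists (d / 2); first by rewrite divr_gt0.
move=> u v u0 ut tv vT ru rv [K hK]; exists (K + 1) => s s0 sv.
have [su|us] := leP s u; first by rewrite (le_trans (hK s s0 su))// lerDl.
apply: le_trans (step u s u0 (ltW us) (le_trans sv vT) _) _; last by rewrite lerD2r hK.
by lra.
Qed.

Let slope_forward (x y z s e h N K be : R) : 0 <= h -> z <= N * h -> 0 <= z ->
  y <= s + K * (e * h) -> s <= h * be -> h * N ^+ 2 <= e -> 0 <= N ->
  x = 2 * y + z ^+ 2 -> x <= (2 * be + (2 * K + 1) * e) * h.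
Proof.
move=> h0 zN z0 ys sb hN N0 ->.
have : z ^+ 2 <= e * h.
  apply: (@le_trans _ _ ((N * h) ^+ 2)); first by rewrite ler_pXn2r// nnegrE mulr_ge0.
  by rewrite exprMn [h ^+ 2]expr2 mulrA ler_wpM2r// mulrC.
by nra.
Qed.

Let slope_backward (x1 x2 x3 x4 x5 k K e be : R) : - (K * (e * k)) <= x1 - - k * x2 ->
  k * x2 <= k * be -> 0 <= e * k -> 0 <= x3 -> x4 - x5 = 2 * x1 + x3 ->
  x5 - x4 <= (2 * be + (2 * K + 1) * e) * k.
Proof. by lra. Qed.

Lemma dot_sqr_diff u v : L u -> L v ->
  dot v v - dot u u = 2 * dot (v - u) u + nrm (v - u) ^+ 2.
Proof.
move=> Lu Lv; have Lw := LB Lv Lu; rewrite nrm_sqr// !dotB//.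
by rewrite [dot v (v - u)]dotC [dot u (v - u)]dotC !dotB// [dot u v]dotC; ring.
Qed.

(** The squared norm has derivative 2 [dot z (b t)]. Increments are estimated across [t], from [u]
    before it to [v] after it, as [creep] requires; on the left the quadratic remainder has a
    favourable sign. *)
Lemma sqr_slope t be z : 0 <= t -> L z -> curve_derivative b t z -> dot z (b t) <= be ->
  forall e : R, 0 < e -> exists2 r : R, 0 < r &
    forall u v, 0 <= u -> u <= t -> t <= v -> t - r < u -> v < t + r ->
      dot (b v) (b v) - dot (b u) (b u) <= (2 * be + e) * (v - u).
Proof.
move=> t0 Lz dz zbe e e0; have Lt := Lb t0.
set K := nrm (b t); pose e1 := e / (2 * K + 1).
have K0 : 0 <= K by exact: nrm_ge0.
have e10 : 0 < e1 by rewrite divr_gt0// ltr_wpDl// mulr_ge0.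
have eE : (2 * K + 1) * e1 = e by rewrite mulrC mulfVK// gt_eqF// ltr_wpDl// mulr_ge0.
have [r r0 hr] := dz e1 e10.
(* [N] bounds the difference quotients of [b] near [t]; over times shorter than e1 / N^2 the
   quadratic remainder is at most e1 times the elapsed time. *)
pose N := nrm z + e1; have N0 : 0 < N by rewrite ltr_wpDl.
pose r' := Num.min r (e1 / N ^+ 2).
have r'0 : 0 < r' by rewrite lt_min r0 divr_gt0// exprn_gt0.
exists r' => // u v u0 ut tv ru rv.
have incr h : `|h| < r' -> 0 <= t + h -> [/\ nrm (b (t + h) - b t) <= N * `|h|,
    `|dot (b (t + h) - b t) (b t) - h * dot z (b t)| <= K * (e1 * `|h|) &
    `|h| * N ^+ 2 <= e1].
  rewrite lt_min => /andP[h1 h2] h3; have Lth := Lb h3.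
  have Lrho : L (b (t + h) - b t - h *: z) by apply: LB; [exact: LB|exact: LZ].
  have rho := hr h h1 h3; split.
  - rewrite -[X in nrm X](subrKC (h *: z)) (le_trans (dot_normD _ _))//; first exact: LZ.
    by rewrite dot_normZ// /N mulrDl [`|h| * _]mulrC lerD2l.
  - rewrite -dotZ// -dotB//; [|exact: LB|exact: LZ].
    by rewrite (le_trans (dot_le_norm _ _))// mulrC ler_wpM2l.
  - by move/ltW: h2; rewrite ler_pdivlMr// exprn_gt0.
pose h := v - t; pose k := t - u.
have h0 : 0 <= h by rewrite subr_ge0.
have k0 : 0 <= k by rewrite subr_ge0.
have hr' : h < r' by rewrite /h; lra.
have kr' : k < r' by rewrite /k; lra.
have thv : t + h = v by rewrite /h subrKC.
have tku : t + - k = u by rewrite /k; ring.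
have [] := incr h; [by rewrite ger0_norm|by rewrite thv (le_trans t0)|].
have [] := incr (- k); [by rewrite normrN ger0_norm|by rewrite tku|].
rewrite thv tku normrN (ger0_norm h0) (ger0_norm k0) => a1 a2 a3 b1 b2 b3.
have Lu := Lb u0; have Lv : L (b v) by apply: Lb; exact: le_trans tv.
have fwd : dot (b v) (b v) - dot (b t) (b t) <= (2 * be + e) * h.
  rewrite -eE; apply: (@slope_forward _ _ (nrm (b v - b t)) (h * dot z (b t))) b1 _ _ _ b3 _ (dot_sqr_diff Lt Lv) => //.
  - by move: b2; rewrite ler_norml => /andP[_]; rewrite lerBlDl.
  - exact: ler_wpM2l.
  - exact: ltW.
have bwd : dot (b t) (b t) - dot (b u) (b u) <= (2 * be + e) * k.
  rewrite -eE; move: a2; rewrite ler_norml => /andP[a2 _].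
  apply: slope_backward a2 _ _ (sqr_ge0 _) (dot_sqr_diff Lt Lu); first exact: ler_wpM2l.
  exact: mulr_ge0 (ltW e10) k0.
have -> : v - u = h + k by rewrite /h /k; ring.
by rewrite mulrDr; lra.
Qed.

(** Plays the part of the fundamental theorem of calculus for the squared norm of an absolutely
    continuous curve. *)
Lemma creep_sqr (a be : R) : 0 <= a -> a <= T ->
  {ae mu, forall t, a < t -> t < T -> exists z,
     [/\ L z, curve_derivative b t z & dot z (b t) <= be]} ->
  dot (b T) (b T) - dot (b a) (b a) <= 2 * be * (T - a).
Proof.
move=> a0 aT slope; have [K K0 hK] := ac_curve_bounded.
apply: (@creep _ a T (2 * be) (fun u v => (2 * K) * nrm (b v - b u)) (fun t => dot (b t) (b t))) => //.
- by apply: ac_distZ => //; exact: mulr_ge0.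
- move=> u v au uv vT; have u0 := le_trans a0 au; have v0 := le_trans u0 uv.
  have Lu := Lb u0; have Lv := Lb v0; have Lw := LB Lv Lu.
  have -> : dot (b v) (b v) - dot (b u) (b u) = dot (b v - b u) (b v + b u).
    have Ls := LD Lv Lu; rewrite dotB// [dot (b v) (_ + _)]dotC [dot (b u) (_ + _)]dotC !dotD//.
    by rewrite [dot (b u) (b v)]dotC; ring.
  rewrite (le_trans (dot_le_norm _ _))//; first exact: LD.
  rewrite mulrC ler_wpM2r// (le_trans (dot_normD _ _))//.
  by rewrite mulr_natl mulr2n lerD// hK// (le_trans uv).
- apply: (@filterS _ _ (ae_filter_ringOfSetsType _) _ _ _ slope) => t h at_ tT e e0.
  have [z [Lz dz zbe]] := h at_ tT.
  have t0 := le_trans a0 (ltW at_).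
  have [r r0 hr] := sqr_slope t0 Lz dz zbe e0; exists r => // u v au ut tv _.
  by apply: hr => //; exact: le_trans au.
Qed.

End curve.

Section flow.
Variables (c : R -> H) (A : set R) (xi : R -> H) (e : R -> R) (w : H) (es : R).
Hypothesis Lc : forall t, 0 <= t -> L (c t).
Hypothesis acc : forall T, 0 < T -> ac_dist T (fun u v => nrm (c v - c u)).
Hypothesis aeA : {ae mu, forall t, 0 < t -> A t}.
Hypothesis Lxi : forall t, A t -> L (xi t).
Hypothesis dc : forall t, A t -> curve_derivative c t (- xi t).
Hypothesis Lw : L w.
Hypothesis es_le : forall t, A t -> es <= e t.
Hypothesis sub_w : forall t, A t -> dot (xi t) (w - c t) <= es - e t.
Hypothesis sub_c : forall s t, 0 <= s -> A s -> A t -> dot (xi t) (c s - c t) <= e s - e t.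

(* The subdifferential is monotone, so that two solutions, here the flow and its
   time translate, get closer. *)
Lemma flow_contraction (h s t : R) : 0 <= h -> 0 <= s -> s <= t ->
  nrm (c (t + h) - c t) <= nrm (c (s + h) - c s).
Proof.
move=> h0 s0 st; have [<-//|st'] := eqVneq s t; have t0 : 0 < t by rewrite (le_lt_trans s0)// lt_neqAle st'.
rewrite /nrm ler_wsqrtr// -subr_le0.
pose b x := c (x + h) - c x.
rewrite -[leRHS](mul0r (t - s)) -[X in X * _](mulr0 2).
apply: (@creep_sqr t b) => //.
- exact: ltW.
- by move=> x x0; apply: LB; apply: Lc => //; exact: addr_ge0.
- apply: (@ac_dist_le _ _ (fun u v => nrm (c (v + h) - c (u + h)) + nrm (c v - c u))).
    move=> u v u0 uv vt; have v0 := le_trans u0 uv.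
    have Lu := Lc u0; have Lv := Lc v0; have Luh := Lc (addr_ge0 u0 h0); have Lvh := Lc (addr_ge0 v0 h0).
    rewrite /b sub_exchange.
    by rewrite (le_trans (dot_normD _ _))//; [exact: LB|exact: LB|rewrite [nrm (c u - _)]nrmBC].
  apply: ac_distD; last exact: acc.
  by apply: (@ac_dist_shift _ t h (fun u v => nrm (c v - c u))) => //; apply: acc; rewrite ltr_wpDr.
- have aeB := ae_shift h aeA.
  apply: (@filterS2 _ _ (ae_filter_ringOfSetsType _) _ _ _ _ aeA aeB) => x hx hxh sx xt; have x0 : 0 < x by exact: le_lt_trans sx.
  have Ax := hx x0; have xh0 : 0 < x + h by rewrite ltr_wpDr.
  have Axh := hxh xh0; have Lx := Lc (ltW x0); have Lxh := Lc (ltW xh0).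
  exists (xi x - xi (x + h)); split; first by apply: LB; exact: Lxi.
    move=> d d0; have d2 : 0 < d / 2 by rewrite divr_gt0.
    have [r r0 hr] := dc Ax d2; have [r' r'0 hr'] := dc Axh d2.
    exists (Num.min r r'); first by rewrite lt_min r0.
    move=> k; rewrite lt_min => /andP[kr kr'] xk.
    have xhk : 0 <= x + h + k by rewrite addrAC addr_ge0.
    have := hr k kr xk; have := hr' k kr' xhk; set y' := (X in nrm X); set y := (X in _ -> nrm X <= _ -> _) => a1 a2.
    have Ly : L y by apply: LB; [apply: LB => //; exact: Lc|apply: LZ; apply: LN; exact: Lxi].
    have Ly' : L y' by apply: LB; [apply: LB => //; exact: Lc|apply: LZ; apply: LN; exact: Lxi].
    rewrite (_ : b (x + k) - b x - k *: _ = y' - y); last first.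
      rewrite /b /y /y' scalerBr !scalerN !opprK [x + k + h]addrAC [in RHS]opprD [RHS]addrACA.
      by congr (_ + _); [rewrite sub_exchange [in RHS]opprB|rewrite opprB].
    rewrite (le_trans (dot_normD Ly' (LN Ly)))// nrmN// (splitr d) mulrDl.
    exact: lerD.
  rewrite /b; have Lb := LB Lxh Lx; have Lxx := Lxi Ax; have Lxxh := Lxi Axh.
  have := sub_c (ltW xh0) Axh Ax; have := sub_c (ltW x0) Ax Axh.
  rewrite dotB// -[c x - _]opprB -[dot _ (- _)]dotC dotN// dotC; lra.
Qed.

Lemma flow_dist (t u be : R) : 0 <= u -> u <= t ->
  {ae mu, forall s : R, u < s -> s < t -> dot (- xi s) (c s - w) <= be} ->
  dot (c t - w) (c t - w) - dot (c u - w) (c u - w) <= 2 * be * (t - u).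
Proof.
move=> u0 ut hbe; have [->|ut'] := eqVneq t u; first by rewrite !subrr mulr0.
have t0 : 0 < t by rewrite (le_lt_trans u0)// lt_neqAle eq_sym ut'.
apply: (@creep_sqr t (fun s => c s - w)) => //.
- exact: ltW.
- by move=> s s0; apply: LB => //; exact: Lc.
- apply: ac_dist_le (acc t0) => x y x0 xy yt.
  by rewrite opprB addrA subrK.
- apply: (@filterS2 _ _ (ae_filter_ringOfSetsType _) _ _ _ _ aeA hbe) => s As hs us st.
  have s0 := le_lt_trans u0 us; have {}As := As s0.
  exists (- xi s); split; [by apply: LN; exact: Lxi| |exact: hs].
  move=> d d0; have [r r0 hr] := dc As d0; exists r => // h hr' sh.
  rewrite (_ : c (s + h) - w - (c s - w) = c (s + h) - c s); first exact: hr.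
  by rewrite opprB addrA subrK.
Qed.

Let energy_gap (xs : R) s : 0 <= s -> A s -> xs <= e s - es -> dot (- xi s) (c s - w) <= - xs.
Proof.
move=> s0 As h; have Ls := Lc s0; have Lx := Lxi As.
have := sub_w As; rewrite -opprB dotC dotN//; last exact: LB.
by rewrite dotN// 1?dotC//; [lra|exact: LB].
Qed.

(** If the energy exceeded es + eta at a late time t, the subgradient inequality at t and the bounds
    on speed and subgradients would keep it above es + eta/2 on [t - tau, t]. The squared distance
    to [w] would then drop by eta tau over this interval, more than its distance to its infimum
    allows. *)
Lemma flow_energy (eta : R) : 0 < eta ->
  exists2 T : R, 0 <= T & forall t, A t -> T <= t -> e t <= es + eta.
Proof.
move=> eta0.
have [s [s0 _ As]] := ae_dense aeA ltr01.
have {}As := As s0.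
have [r r0 hr] := dc As ltr01.
(* Near the differentiability time [s] the difference quotients are at most |xi s| + 1; the
   contraction carries this bound to all later times and, by differentiation, bounds the
   subgradients by M + 1. *)
pose M := nrm (xi s) + 1.
have M0 : 0 < M by rewrite ltr_wpDl// nrm_ge0.
have lip t h : s <= t -> 0 <= h -> h < r -> nrm (c (t + h) - c t) <= M * h.
  move=> st h0 hr'; apply: (le_trans (flow_contraction h0 (ltW s0) st)).
  have sh0 : 0 <= s + h by rewrite addr_ge0// ltW.
  have := hr h; rewrite ger0_norm// => /(_ hr' sh0).
  have Lx : L (h *: - xi s) by apply: LZ; apply: LN; exact: Lxi.
  have Ld : L (c (s + h) - c s) by apply: LB; apply: Lc => //; exact: ltW.
  rewrite -{2}(subrKC (h *: - xi s) (c (s + h) - c s)) => h1.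
  apply: (le_trans (dot_normD Lx (LB Ld Lx))).
  rewrite dot_normZ; last by apply: LN; exact: Lxi.
  rewrite nrmN; last exact: Lxi.
  by rewrite ger0_norm// /M mulrDl [h * _]mulrC lerD2l.
have xiM t : A t -> s <= t -> nrm (xi t) <= M + 1.
  move=> At st; have t0 := lt_le_trans s0 st.
  have [r' r'0 hr'] := dc At ltr01.
  pose h := Num.min r r' / 2.
  have m0 : 0 < Num.min r r' by rewrite lt_min r0.
  have h0 : 0 < h by rewrite divr_gt0.
  have hm : h < Num.min r r' by rewrite ltr_pdivrMr// ltr_pMr// ltr1n.
  move: hm; rewrite lt_min => /andP[hr1 hr2].
  have th0 : 0 <= t + h by rewrite addr_ge0// ltW.
  have := hr' h; rewrite gtr0_norm// => /(_ hr2 th0); rewrite scalerN opprK => h1.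
  have h2 := lip t h st (ltW h0) hr1.
  have Lx := Lxi At; have Ld : L (c (t + h) - c t) by apply: LB; apply: Lc => //; exact: ltW.
  have Lhx := LZ h Lx.
  have : nrm (h *: xi t) <= (M + 1) * h.
    rewrite -[X in nrm X](addKr (c (t + h) - c t)) (le_trans (dot_normD (LN Ld) (LD Ld Lhx)))//.
    by rewrite nrmN// mulrDl lerD.
  by rewrite dot_normZ// gtr0_norm// mulrC ler_pM2r.
pose S := [set x | exists2 t, 0 <= t & x = dot (c t - w) (c t - w)].
have S0 : S !=set0 by exists (dot (c 0 - w) (c 0 - w)); exists 0.
have lS : has_lbound S.
  by exists 0 => _ [t t0 ->]; apply: dot_ge0; apply: LB => //; exact: Lc.
(* Short enough for the Lipschitz bound, and such that the energy falls by at most (M + 1) M tau <=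
   eta/2 when going back from t by at most tau. *)
pose tau := Num.min (r / 2) (eta / 2 / ((M + 1) * M)).
have MM : 0 < (M + 1) * M by rewrite mulr_gt0// ltr_wpDl// ltW.
have tau0 : 0 < tau by rewrite lt_min !divr_gt0.
have taur : tau < r by rewrite gt_min ltr_pdivrMr// ltr_pMr// ltr1n.
have tauM : (M + 1) * M * tau <= eta / 2 by rewrite mulrC -ler_pdivlMr// ge_min lexx orbT.
(* At [T1] the squared distance is within eta tau of its infimum over all times. *)
have [_ [T1 T10 ->] hT1] := inf_adherent (mulr_gt0 eta0 tau0) (conj S0 lS).
(* Past this time, the whole interval [t - tau, t] lies after both [s] and [T1]. *)
exists (T1 + s + tau) => [|t At Tt]; first by rewrite !addr_ge0// ltW.
rewrite leNgt; apply/negP => et.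
pose u := t - tau.
have us : s <= u by rewrite lerBrDr (le_trans _ Tt)// lerD2r lerDr.
have uT1 : T1 <= u by rewrite lerBrDr (le_trans _ Tt)// lerD2r lerDl ltW.
have u0 := le_trans T10 uT1.
have ut : u <= t by rewrite gerBl ltW.
have t0 := le_trans u0 ut.
have drop : dot (c t - w) (c t - w) - dot (c u - w) (c u - w) <= 2 * (- (eta / 2)) * (t - u).
  apply: flow_dist => //; apply: (@filterS _ _ (ae_filter_ringOfSetsType _) _ _ _ aeA) => x Ax ux xt.
  have x0 := le_lt_trans u0 ux; have {}Ax := Ax x0.
  apply: energy_gap => //; first exact: ltW.
  have sx : s <= x by exact: le_trans us (ltW ux).
  have h1 := sub_c (ltW x0) Ax At.
  have Lx := Lc (ltW x0); have Lt := Lc t0; have Lxt := Lxi At.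
  have := dot_le_norm Lxt (LB Lx Lt); rewrite ler_norml => /andP[h2 _].
  have h3 : nrm (c x - c t) <= M * tau.
    rewrite nrmBC// -[t](subrKC x); apply: (le_trans (lip x (t - x) sx _ _)).
    - by rewrite subr_ge0 ltW.
    - by rewrite (le_lt_trans _ taur)// lerBlDr -lerBlDl ltW.
    - by rewrite ler_pM2l// lerBlDr -lerBlDl ltW.
  have h4 : nrm (xi t) * nrm (c x - c t) <= eta / 2.
    apply: le_trans tauM; rewrite -mulrA; apply: ler_pM => //; apply: xiM => //.
    exact: le_trans us ut.
  by lra.
(* Since the energy never goes below [es], the distance to [w] cannot grow between [T1] and [u]. *)
have mono : dot (c u - w) (c u - w) - dot (c T1 - w) (c T1 - w) <= 2 * 0 * (u - T1).
  apply: flow_dist => //; apply: (@filterS _ _ (ae_filter_ringOfSetsType _) _ _ _ aeA) => x Ax ux xt.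
  have x0 := le_lt_trans T10 ux; have {}Ax := Ax x0.
  rewrite -oppr0; apply: energy_gap => //; first exact: ltW.
  by rewrite subr_ge0 es_le.
have : inf S <= dot (c t - w) (c t - w) by apply: ge_inf => //; exists t.
have : t - u = tau by rewrite /u; ring.
move: drop mono => + + tu; rewrite tu => h1 h2 h3.
by move: h1 h2 h3 hT1; move: (dot _ _) (dot _ _) (dot _ _) (inf S) => x1 x2 x3 x4; lra.
Qed.

End flow.
End hilbert_flow.

(** * The abstract flow estimates in L^2 *)

Section L2_flow.
Variables (R : realType) (n : nat) (Om : set 'rV[R]_n).
Local Notation Rn := 'rV[R]_n.
Local Notation leb := (@lebesgue_rV R n).
Hypothesis mOm : measurable Om.
Implicit Types (u v w : Rn -> R) (c : R -> Rn -> R).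
Local Notation L2 := (Rn -> R^o).

Let one2 : 1 <= 2 :> R. Proof. by rewrite ler1n. Qed.

Let powR2 u x : `|u x| `^ 2 = u x * u x.
Proof. by rewrite (powR_mulrn 2)// real_normK ?num_real// expr2. Qed.

Lemma Lp2_mul u v : Lp Om 2 u -> Lp Om 2 v ->
  leb.-integrable Om (EFin \o (fun x => u x * v x)).
Proof.
move=> /(LpP mOm _ one2)[mu iu] /(LpP mOm _ one2)[mv iv].
apply: (@le_integrable _ _ _ leb _ mOm _ _ _ _ (integrableDR mOm iu iv)).
  by apply/measurable_EFinP; exact: measurable_funM.
move=> x Ox /=; rewrite lee_fin !powR2 [leRHS]ger0_norm; last first.
  by rewrite addr_ge0// -expr2 sqr_ge0.
move: (u x) (v x) => a b; rewrite ler_norml; apply/andP.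
have h1 := sqr_ge0 (a + b); have h2 := sqr_ge0 (a - b).
have h3 := sqr_ge0 a; have h4 := sqr_ge0 b.
by split; nra.
Qed.

Lemma dotL2C u v : dotL2 Om u v = dotL2 Om v u.
Proof. by rewrite /dotL2; congr (Rintegral _ _ _); apply/funext => x; rewrite mulrC. Qed.

Lemma dotL2_lin (a b : R) (u v w : L2) : Lp Om 2 u -> Lp Om 2 v -> Lp Om 2 w ->
  dotL2 Om (a *: u + b *: v) w = a * dotL2 Om u w + b * dotL2 Om v w.
Proof.
move=> Lu Lv Lw; have iu := Lp2_mul Lu Lw; have iv := Lp2_mul Lv Lw.
rewrite /dotL2 -!RintegralZl// -RintegralD//; [|exact: integrableZR|exact: integrableZR].
congr (Rintegral _ _ _); apply/funext => x.
by rewrite -[(a *: u + b *: v) x]/(a * u x + b * v x) mulrDl !mulrA.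
Qed.

Lemma dotL2_ge0 u : 0 <= dotL2 Om u u.
Proof. by apply: Rintegral_ge0 => x _; rewrite -expr2 sqr_ge0. Qed.

Lemma Lp_energy2 u : Lp_energy Om 2 u = dotL2 Om u u.
Proof. by rewrite /Lp_energy /dotL2; congr (Rintegral _ _ _); apply/funext => x; rewrite powR2. Qed.

Lemma Lp2_lin (a b : R) (u v : L2) : Lp Om 2 u -> Lp Om 2 v -> Lp Om 2 (a *: u + b *: v).
Proof. by move=> Lu Lv; exact: (Lp_lin mOm a b one2 Lu Lv).1. Qed.

Local Notation nrm := (@dot_norm R L2 (dotL2 Om)).

Lemma Lp2_norm u : Lp Om 2 u -> Lp_norm Om 2 u = (nrm u)%:E.
Proof. by move=> Lu; rewrite Lp_normE// Lp_energy2 powR12_sqrt// dotL2_ge0. Qed.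

Let Lp2B (u v : L2) : Lp Om 2 u -> Lp Om 2 v -> Lp Om 2 (u - v).
Proof. by move=> Lu Lv; have := Lp2_lin 1 (-1) Lu Lv; rewrite scale1r scaleN1r. Qed.

Let Lp2Z a (u : L2) : Lp Om 2 u -> Lp Om 2 (a *: u).
Proof. by move=> Lu; have := Lp2_lin a 0 Lu Lu; rewrite scale0r addr0. Qed.

Lemma abs_continuousL2_dist (T : R) c : (forall t, 0 <= t -> Lp Om 2 (c t)) ->
  abs_continuousL2 Om T c -> ac_dist T (fun r s => nrm (c s - c r)).
Proof.
move=> Lc acc e e0; have [d d0 hd] := acc e e0; exists d => // l l1 l2 l3.
pose z : R * R := (0, 0).
have := hd (size l) (fun i => (nth z l i).1) (fun i => (nth z l i).2).
have H1 (i : 'I_(size l)) : [/\ 0 <= (nth z l i).1, (nth z l i).1 <= (nth z l i).2 &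
    (nth z l i).2 <= T] by apply: l1; exact: mem_nth.
rewrite (eq_bigr (fun i : 'I_(size l) => (nrm (c (nth z l i).2 - c (nth z l i).1))%:E)); last first.
  move=> i _; have [h1 h2 h3] := H1 i; apply: Lp2_norm.
  by apply: Lp2B; apply: Lc => //; exact: le_trans h2.
rewrite sumEFin lte_fin => h; rewrite (big_nth z) big_mkord; apply: h => //.
- move=> i j ij; have /pairwiseP -/(_ z) pw := l2.
  have [ij'|ij'|/val_inj ij'] := ltngtP i j.
  + by right; apply: pw => //; rewrite inE.
  + by left; apply: pw => //; rewrite inE.
  + by rewrite ij' eqxx in ij.
- by move: l3; rewrite (big_nth z) big_mkord.
Qed.

Lemma is_deriveL2_curve c (t : R) v : (forall t, 0 <= t -> Lp Om 2 (c t)) -> 0 <= t ->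
  is_deriveL2 Om c t v -> @curve_derivative R L2 (dotL2 Om) c t v.
Proof.
move=> Lc t0 [Lv cv] e e0.
have : \forall h \near (0 : R)^', (Lp_norm Om 2 (fun x => h^-1 * (c (t + h) x - c t x) - v x)%R < e%:E)%E.
  by move: cv => /(_ [set y | (y < e%:E)%E]); apply; apply: open_nbhs_nbhs; split => //; exact: open_ereal_lt_ereal.
move=> /nbhs_ballP[r/= r0 hr]; exists r => // h hr' th0.
have [->|h0] := eqVneq h 0.
  rewrite addr0 subrr scale0r subrr normr0 mulr0 /dot_norm.
  have L0 : Lp Om 2 (0 : L2) by have := Lp2Z 0 Lv; rewrite scale0r.
  have := dotL2_lin 0 0 L0 L0 L0; rewrite !scale0r addr0 !mul0r addr0 => ->.
  by rewrite sqrtr0.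
pose g : L2 := h^-1 *: (c (t + h) - c t) - v.
have Lg : Lp Om 2 g by apply: Lp2B => //; apply: Lp2Z; apply: Lp2B; exact: Lc.
have := hr h; rewrite /ball/= sub0r normrN => /(_ hr' h0).
rewrite -[X in Lp_norm _ _ X]/(g : Rn -> R) Lp2_norm// lte_fin => ge.
rewrite (_ : c (t + h) - c t - h *: v = h *: g); last first.
  by rewrite /g scalerBr scalerA mulfV// scale1r.
rewrite (@dot_normZ _ _ _ _ Lp2_lin dotL2C dotL2_lin)// mulrC.
by rewrite ler_wpM2r// ltW.
Qed.

Lemma gradient_flow_energy (E : (Rn -> R) -> \bar R) mu0 c ms :
  is_gradient_flow Om E mu0 c -> Lp Om 2 ms ->
  (forall u, (E u < +oo)%E -> E u \is a fin_num) -> (forall u, (E ms <= E u)%E) ->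
  exists A : set R, [/\ {ae @lebesgue_measure R, forall t : R, 0 < t -> A t},
    forall t, A t -> 0 < t /\ (E (c t) < +oo)%E &
    forall eta : R, 0 < eta -> exists2 T : R, 0 <= T &
      forall t, A t -> T <= t -> (E (c t) <= E ms + eta%:E)%E].
Proof.
move=> [Lc acc good _] Lms Efin Emin.
pose Q t xi := subdiff Om E (c t) xi /\ is_deriveL2 Om c t (\- xi)%R.
(* The times at which the differential inclusion holds. The energy is finite there, so the
   subgradient inequalities become inequalities between reals. *)
pose A : set R := [set t | 0 < t /\ exists xi, Q t xi].
have aeA : {ae @lebesgue_measure R, forall t : R, 0 < t -> A t}.
  apply: (@filterS _ _ (ae_filter_ringOfSetsType _) _ _ _ good) => t ht t0; split => //.
  by have [xi [[h1 _] h2]] := ht t0; exists xi.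
have Aoo t : A t -> (E (c t) < +oo)%E by move=> [_ [xi [[_ h _] _]]].
exists A; split => //; first by move=> t At; split; [exact: At.1|exact: Aoo].
pose xi t : L2 := xget 0 [set x | Q t x].
have xiP t : A t -> Q t (xi t) by move=> [_ /cid[x hx]]; rewrite /xi; case: xgetP => // /(_ x).
pose e t := fine (E (c t)).
have eE t : A t -> (e t)%:E = E (c t) by move=> At; rewrite /e fineK// Efin// Aoo.
have [t0 [_ _ At0]] := ae_dense aeA (@ltr01 R).
have [t1 [t10 _ At1]] := ae_dense aeA (@ltr01 R).
have {t0 At0}At1 := At1 t10.
have msfin : E ms \is a fin_num by apply: Efin; exact: le_lt_trans (Emin _) (Aoo _ At1).
pose es := fine (E ms); have esE : es%:E = E ms by rewrite fineK.
move=> eta eta0.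
have [||||||T T0 hT] := @flow_energy R L2 (Lp Om 2) (dotL2 Om) Lp2_lin dotL2C dotL2_lin
  (fun u _ => dotL2_ge0 u) c A xi e ms es Lc _ aeA _ _ Lms _ _ _ eta eta0.
- by move=> T T0; apply: abs_continuousL2_dist => //; exact: acc.
- by move=> t /xiP[[]].
- by move=> t At; have [_ h] := xiP t At; apply: is_deriveL2_curve => //; exact: ltW At.1.
- by move=> t At; rewrite -lee_fin eE// esE.
- move=> t At; have [[_ _ h] _] := xiP t At.
  by have := h ms Lms; rewrite -eE// -esE -EFinB lee_fin.
- move=> s t s0 As At; have [[_ _ h] _] := xiP t At.
  by have := h (c s) (Lc s s0); rewrite -!eE// -EFinB lee_fin.
exists T => // t At Tt.
by rewrite -esE -eE// -EFinD lee_fin hT.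
Qed.

End L2_flow.

(** * Square integrability of the minimizer *)

Lemma cst_integrable (R : realType) (n : nat) (Om : set 'rV[R]_n) (a : R) :
  measurable Om -> bounded_set Om -> (@lebesgue_rV R n).-integrable Om (EFin \o cst a).
Proof.
move=> mOm bOm; apply/integrableP; split; first exact: (measurable_cst (a%:E : \bar R)).
under eq_integral do rewrite /=.
by rewrite integral_cst// lte_mul_pinfty//=; exact: bounded_rV_fin.
Qed.

Section line_measure.
Variable R : realType.
Local Notation R1 := 'rV[R]_1.
Local Notation leb := (@lebesgue_rV R 1).
Local Notation mu := (@lebesgue_measure R).

Definition row1 (s : measurableTypeR R) : R1 := const_mx s.

Lemma measurable_row1 : measurable_fun setT row1.
Proof.
have mt : measurable_fun setT (@tuple_of_row R 1 \o row1).
  apply/measurable_fun_tnthP => i; apply: eq_measurable_fun (@measurable_id _ _ setT) => s _ /=.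
  by rewrite tnth_mktuple mxE.
by move=> _ _ [B mB <-]; have := mt measurableT _ mB; rewrite !setTI.
Qed.

HB.instance Definition _ := isMeasurableFun.Build _ _ _ _ row1 measurable_row1.

Lemma lebesgue_rV1 (A : set R1) : measurable A -> leb A = pushforward mu row1 A.
Proof.
apply: measure_rV_unique; last exact: open_box_fin.
move=> a b; rewrite -[LHS]/(lebesgue_rV (open_box a b)) open_boxE (lebesgue_rV_box (A := fun i => `]a ord0 i, b ord0 i[%classic))//.
rewrite big_ord1 /pushforward; congr (mu _).
apply/seteqP; split => s /=; rewrite in_itv/=.
  by move=> h i; rewrite in_itv mxE !ord1.
by move=> /(_ ord0); rewrite in_itv mxE.
Qed.

(** The fundamental theorem of calculus on the segment from a point left of the support up to
    [x]. *)
Lemma test_function_sup (Om : set R1) (phi : R1 -> R) (x : R1) : measurable Om ->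
  test_function Om phi ->
  (`|phi x|%:E <= \int[leb]_(y in Om) `|partial ord0 phi y|%:E)%E.
Proof.
move=> mOm tphi; have [K [cK KO phi0 cphi dphi]] := test_function_support tphi.
have [cd d0] := dphi ord0.
have [M M0 KM] := bounded_rV_box (compact_bounded cK).
pose F s := phi (row1 s); pose f s := partial ord0 phi (row1 s).
have row1E s : row1 s = s *: delta_mx ord0 ord0 + 0 :> R1.
  by apply/rowP => i; rewrite !mxE !ord1 eqxx mulr1 addr0.
have dF s : is_derive s (1 : R) F (f s).
  rewrite (_ : F = fun t : R => phi (t *: delta_mx ord0 ord0 + 0)); last first.
    by apply/funext => t; rewrite /F row1E.
  by apply: is_derive_line_at; rewrite -row1E; exact: test_derivable tphi.
have crow1 : continuous (row1 : R -> R1).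
  rewrite (_ : (row1 : R -> R1) = fun s : R => s *: (delta_mx ord0 ord0 : R1)); last first.
    by apply/funext => s; rewrite row1E addr0.
  exact: scalel_continuous.
have cf : continuous f.
  by move=> s; exact: (continuous_comp (crow1 s) (cd (row1 s))).
have cF : continuous F.
  by move=> s; exact: (continuous_comp (crow1 s) (cphi (row1 s))).
set s0 := x ord0 ord0.
have xE : x = row1 s0 by apply/rowP => i; rewrite mxE !ord1.
(* Left of [x], so that the segment is proper, and at most -M, hence outside the box that contains
   the support. *)
pose a := Num.min (s0 - 1) (- M).
have as0 : a < s0 by rewrite gt_min ltrBlDr ltrDl ltr01.
have Fa : F a = 0.
  apply: phi0 => /KM /(_ ord0); rewrite !mxE => /andP[+ _].
  by rewrite ltNge /a ge_min lexx orbT.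
have FTC := @continuous_FTC2 R f F a s0 as0.
have {}FTC : (\int[mu]_(t in `[a, s0]) (f t)%:E)%E = (F s0)%:E.
  rewrite FTC ?Fa ?sube0//.
  - exact: continuous_subspaceT.
  - split.
    + by move=> t _; have [] := dF t.
    + by apply: cvg_at_right_filter; exact: cF.
    + by apply: cvg_at_left_filter; exact: cF.
  - by move=> t _; rewrite derive1E; have [_ ->] := dF t.
have mf D : measurable D -> measurable_fun D (fun s : measurableTypeR R => (f s)%:E).
  by move=> mD; apply/measurable_EFinP; apply: measurable_funTS; exact: continuous_measurable_fun.
rewrite xE -[X in (X <= _)%E]/(`|(F s0)%:E|)%E -FTC.
have mI : measurable (`[a, s0] : set (measurableTypeR R)) by exact: measurable_itv.
apply: (le_trans (le_abse_integral _ mI (mf _ mI))).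
have mg : measurable_fun setT (fun y : R1 => `|partial ord0 phi y|%:E).
  apply/measurable_EFinP; apply: continuous_rV_measurable => y.
  by apply: (continuous_comp (cd y)); exact: norm_continuous.
rewrite [leRHS]integral_mkcond.
rewrite (_ : (_ \_ Om) = fun y => `|partial ord0 phi y|%:E); last first.
  apply/funext => y; rewrite /patch; case: ifPn => //; rewrite notin_setE => nO.
  by rewrite d0 ?normr0// => /KO.
rewrite (@eq_measure_integral _ _ _ _ (pushforward mu row1)); last first.
  by move=> A mA _; exact: lebesgue_rV1.
rewrite ge0_integral_pushforward//.
apply: (@ge0_subset_integral _ _ R mu _ setT mI measurableT (fun s => `|(f s)%:E|)%E) => //.
by apply: measurableT_comp => //; exact: mf.
Qed.

End line_measure.

Section bounded_one_dimension.
Variables (R : realType) (Om : set 'rV[R]_1) (p : R).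
Local Notation R1 := 'rV[R]_1.
Local Notation leb := (@lebesgue_rV R 1).
Hypothesis oOm : open Om.
Hypothesis p1 : 1 < p.
Hypothesis bOm : bounded_set Om.

Let mOm : measurable Om. Proof. exact: open_rV_measurable. Qed.
Let p1' : 1 <= p. Proof. exact: ltW. Qed.

Let le1powR (t : R) : `|t| <= 1 + `|t| `^ p.
Proof.
have [t1|t1] := leP `|t| 1; first by rewrite (le_trans t1)// lerDl powR_ge0.
have t0 : 0 < `|t| by apply: lt_trans t1.
apply: (@le_trans _ _ (`|t| `^ p)); last by rewrite lerDr.
by rewrite -{1}[`|t|]powRr1// ler_powR// ltW.
Qed.

(** Approximating test functions are uniformly bounded by the integrals of |phi'|, each at most the
    measure of [Om] plus a gradient energy. Along a fast sequence they converge to [u] almost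
    everywhere. *)
Lemma Sobolev0_bounded u : Sobolev0 Om p u ->
  exists K : R, {ae leb, forall x, Om x -> `|u x| <= K}.
Proof.
move=> Su; have [V fV] : exists V : R, leb Om = V%:E.
  have h := bounded_rV_fin mOm bOm; exists (fine (leb Om)); rewrite fineK//.
  by rewrite ge0_fin_numE.
(* The bound 1 keeps the gradient energies of the test functions bounded; the fast rate gives
   pointwise convergence. *)
pose e k := Num.min 1 (fast_rate p k).
have e0 k : 0 < e k by rewrite lt_min ltr01 fast_rate_gt0.
have /choice[phi hphi] : forall k, exists phi, test_function Om phi /\
    [/\ Sobolev Om p phi, Sobolev Om p (fun x => 1 * u x + -1 * phi x),
      Sobolev_energy Om p (fun x => 1 * u x + -1 * phi x) < e k &
      grad_energy Om p phi <= 2 `^ p * (grad_energy Om p u + e k)].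
  by move=> k; have [phi] := Sobolev0_approx oOm p1 Su (e0 k); exists phi.
pose v k x := 1 * u x + -1 * phi k x.
have [||B [_ B0 hB]] := @fast_Lp R 1 Om mOm p v p1'.
- by move=> k; have [_ [_ [+ _ _] _ _]] := hphi k.
- move=> k; have [_ [_ _ he _]] := hphi k.
  rewrite (le_trans _ (_ : e k <= _))//; last by rewrite ge_min lexx orbT.
  by apply: le_trans (ltW he); rewrite lerDl Lp_energy_ge0.
pose K := V + 2 `^ p * (grad_energy Om p u + 1); exists K.
have phiK k x : `|phi k x| <= K.
  have [tphi [Sphi _ _ g]] := hphi k.
  have [Lp1 le1] := partial_energy_le oOm p1 ord0 tphi Sphi.
  have /(LpP mOm _ p1')[m1 i1] := Lp1.
  have iV := cst_integrable 1 mOm bOm.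
  rewrite -lee_fin; apply: (le_trans (test_function_sup x mOm tphi)).
  apply: (@le_trans _ _ (\int[leb]_(y in Om) (1 + `|partial ord0 (phi k) y| `^ p)%:E)%E).
    apply: ge0_le_integral => //.
    - by apply/measurable_EFinP; exact: measurableT_comp.
    - exact: measurable_int (integrableDR mOm iV i1).
    - by move=> y _; rewrite lee_fin le1powR.
  have -> : (\int[leb]_(y in Om) (1 + `|partial ord0 (phi k) y| `^ p)%:E =
      \int[leb]_(y in Om) cst 1%:E y + \int[leb]_(y in Om) (`|partial ord0 (phi k) y| `^ p)%:E)%E.
    exact: (integralD mOm iV i1).
  rewrite integral_cst// mul1e [X in (X + _)%E]fV -Lp_energyE// -EFinD lee_fin lerD2l.
  apply: (le_trans le1); apply: (le_trans g); rewrite ler_wpM2l ?powR_ge0//.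
  by rewrite lerD2l ge_min lexx.
apply: filterS hB => x hx Ox; apply/ler_addgt0Pr => r r0.
have [k hk] : exists k, (2 ^+ k)^-1 * B x < r.
  have : ((2^-1 : R) ^+ k * B x) @[k --> \oo] --> (0 * B x).
    by apply: cvgM; [apply: cvg_expr; rewrite ger0_norm// invf_lt1// ltr1n|exact: cvg_cst].
  rewrite mul0r => /cvgr_lt /(_ r r0)[k _ /(_ k (leqnn k))/= h].
  by exists k; rewrite -exprVn.
rewrite (_ : u x = phi k x + v k x); last by rewrite /v; ring.
by rewrite (le_trans (ler_normD _ _))// lerD// (le_trans (hx Ox k))// ltW.
Qed.

End bounded_one_dimension.

Section square_integrable.
Variables (R : realType) (n : nat) (Om : set 'rV[R]_n) (p : R).
Local Notation leb := (@lebesgue_rV R n).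
Hypothesis oOm : open Om.
Hypothesis bOm : bounded_set Om.
Implicit Types u : 'rV[R]_n -> R.

Let mOm : measurable Om. Proof. exact: open_rV_measurable. Qed.
Let one2 : 1 <= 2 :> R. Proof. by rewrite ler1n. Qed.

Lemma Lp_Lp2 u : 2 <= p -> Lp Om p u -> Lp Om 2 u.
Proof.
move=> p2 Lu; have p1 := le_trans one2 p2.
have /(LpP mOm _ p1)[mu iu] := Lu.
have [|//] := Lp_le mOm one2 mu (integrableDR mOm (cst_integrable 1 mOm bOm) iu).
move=> x Ox; have [t1|t1] := leP `|u x| 1.
  rewrite -[leLHS]addr0 lerD ?powR_ge0//.
  by have := @powR_norm_le R (u x) 1 2; rewrite normr1 powR1; apply.
by rewrite -[leLHS]add0r lerD// ler_powR// ltW.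
Qed.

Lemma bounded_Lp2 u (K : R) : measurable_fun Om u ->
  {ae leb, forall x, Om x -> `|u x| <= K} -> Lp Om 2 u.
Proof.
move=> mu hu; pose v x := Num.max (- `|K|) (Num.min (u x) `|K|).
have mv : measurable_fun Om v.
  apply: measurable_maxr; first exact: measurable_cst.
  by apply: measurable_minr => //; exact: measurable_cst.
apply: (@Lp_ae _ _ _ oOm 2 v u one2) => //.
  have [|//] := Lp_le mOm one2 mv (cst_integrable (`|K| `^ 2) mOm bOm).
  move=> x _; rewrite ge0_ler_powR ?nnegrE// ler_norml /v.
  by rewrite le_max lexx ge_max ge0_cp//= ge_min lexx orbT.
apply: filterS hu => x hx Ox; have {}hx := le_trans (hx Ox) (ler_norm K).
move: hx; rewrite ler_norml => /andP[h1 h2].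
by rewrite /v (min_idPl _)// (max_idPr _).
Qed.

End square_integrable.

(** Needed to insert the minimizer into the subgradient inequalities, which only test elements of
    L^2. If p < 2, then n < p leaves n = 1 only, where elements of the closure are bounded. *)
Lemma Sobolev0_Lp2 (R : realType) (n : nat) (Om : set 'rV[R]_n) (p : R) (u : 'rV[R]_n -> R) :
  open Om -> bounded_set Om -> (0 < n)%N -> n%:R < p -> Sobolev0 Om p u -> Lp Om 2 u.
Proof.
move=> oOm bOm n0 np Su; have [Lu _ _] := Su.1.
have [p2|p2] := leP 2 p; first exact: (Lp_Lp2 oOm bOm p2 Lu).
have n1 : n = 1%N.
  apply/eqP; rewrite eqn_leq n0 andbT -ltnS -(ltr_nat R).
  exact: lt_trans p2.
subst n; have [K hK] := Sobolev0_bounded oOm np bOm Su.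
have /(LpP (open_rV_measurable oOm) _ (ltW np))[mu _] := Lu.
exact: (bounded_Lp2 oOm bOm mu hK).
Qed.

(** * Convergence of the flow *)

Section minimizing_flow.
Variables (R : realType) (n : nat) (Om : set 'rV[R]_n) (p lam delta : R).
Variable f : 'rV[R]_n -> R.
Hypothesis oOm : open Om.
Hypothesis p1 : 1 < p.
Hypothesis lam0 : 0 < lam.
Hypothesis delta0 : 0 < delta.
Local Notation Rn := 'rV[R]_n.
Local Notation E := (energy Om p f lam delta).
Local Notation M0 := (M0 Om p).

Let mOm : measurable Om. Proof. exact: open_rV_measurable. Qed.
Let one2 : 1 <= 2 :> R. Proof. by rewrite ler1n. Qed.

Lemma energy_M0 (u : Rn -> R) : (E u < +oo)%E -> M0 u.
Proof. by rewrite /energy; case: asboolP. Qed.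

Lemma energy_fin_num (u : Rn -> R) : (E u < +oo)%E -> E u \is a fin_num.
Proof.
move=> Eu; have [a [b [_ _ ->]]] := energy_fin oOm p1 (energy_M0 Eu) Eu.
by [].
Qed.

Lemma argmin_le (ms u : Rn -> R) : is_argmin M0 E ms -> (E ms <= E u)%E.
Proof.
move=> [_ hms]; have [Mu|nMu] := pselect (M0 u); first exact: hms.
by rewrite [leRHS]/energy asboolF// leey.
Qed.

Let part_le (a b x y : R) : 0 <= a -> 0 <= b -> a + b + x = y -> x <= y.
Proof. by lra. Qed.

Lemma grad_energy_le_energy (u : Rn -> R) (a : R) : E u = a%:E ->
  grad_energy Om p u <= a / delta.
Proof.
move=> Eu; have Euoo : (E u < +oo)%E by rewrite Eu ltry.
have Mu := energy_M0 Euoo.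
have [a1 [a2 [A1 A2 A3]]] := energy_fin oOm p1 Mu Euoo.
rewrite ler_pdivlMr// mulrC; apply: (@part_le a1 a2).
- by rewrite -lee_fin -A1; exact: (dual_term_ge0 _ _ oOm p1 Mu).
- by rewrite -lee_fin -A2; exact: (mass_ge0 oOm p1 Mu).1.
- by move: A3; rewrite Eu => -[].
Qed.

Let gap_half (c g a s : R) : c + delta * g <= 2^-1 * a + 2^-1 * s -> s <= c -> s <= a ->
  g <= (a - s) / delta.
Proof. by move=> *; rewrite ler_pdivlMr// mulrC; lra. Qed.

Let final_le (C x a s r e : R) : 0 <= C -> x <= C * ((a - s) / delta) + e * (a / delta + s / delta) ->
  a <= s + delta * (r / 2) / (C + 1) -> a <= s + 1 -> 0 <= e ->
  e * ((2 * s + 1) / delta) <= r / 2 -> 0 < r -> x <= r.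
Proof.
move=> C0 hx h1 h2 e0 h3 r0; apply: (le_trans hx).
have k1 : C * ((a - s) / delta) <= r / 2.
  have : (a - s) / delta <= r / 2 / (C + 1) by rewrite ler_pdivrMr// mulrC mulrA; lra.
  have C1 : 0 < C + 1 by rewrite ltr_wpDl.
  rewrite ler_pdivlMr//; have := divr_gt0 r0 (ltr0n R 2); move: ((a - s) / delta) (r / 2) => y z.
  have [y0|y0] := leP 0 y; by nra.
have k2 : e * (a / delta + s / delta) <= e * ((2 * s + 1) / delta).
  by rewrite ler_wpM2l// -mulrDl ler_pM2r ?invr_gt0//; lra.
by lra.
Qed.

(** The midpoint with the minimizer has energy at least the minimum, so the gradient gap is at most
    (E u - E ms) / delta. Uniform convexity converts it into a bound on the gradient of the
    difference. *)
Lemma energy_gap_gradient (ms : Rn -> R) (r : R) : is_argmin M0 E ms -> E ms \is a fin_num ->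
  0 < r -> exists2 eta : R, 0 < eta & forall u, (E u <= E ms + eta%:E)%E ->
    M0 u /\ grad_energy Om p (fun x => 1 * u x + -1 * ms x) <= r.
Proof.
move=> hms /fineK; set s := fine (E ms) => sE r0.
have s0 : 0 <= s.
  have := grad_energy_le_energy (esym sE); move/(le_trans (grad_energy_ge0 _ _ _)).
  by rewrite pmulr_lge0// invr_gt0.
(* For a <= s + 1 the two gradient energies sum to at most (2s + 1) / delta, so this choice makes
   the error term at most r/2; the gap term gets the other half through the choice of eta. *)
pose e := r / 2 / ((2 * s + 1) / delta).
have k0 : 0 < (2 * s + 1) / delta by rewrite divr_gt0// ltr_wpDl// mulr_ge0.
have e0 : 0 < e by rewrite divr_gt0// divr_gt0.
have [C C0 hC] := gradient_uniform_convexity oOm p1 e0.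
have C1 : 0 < C + 1 by rewrite ltr_wpDl.
exists (Num.min 1 (delta * (r / 2) / (C + 1))).
  by rewrite lt_min ltr01 !(divr_gt0, mulr_gt0).
move=> u hu; have Euoo : (E u < +oo)%E by rewrite (le_lt_trans hu)// -sE ltry.
have Mu := energy_M0 Euoo; split => //.
have /fineK := energy_fin_num Euoo; set a := fine (E u) => aE.
move: hu; rewrite -aE -sE lee_fin -lerBlDl le_min => /andP[h1 h2].
have [Mm [c Ec hc]] := energy_mid oOm p1 lam0 Mu hms.1 (esym aE) (esym sE).
have sc : s <= c by rewrite -lee_fin sE -Ec; exact: (argmin_le _ hms).
have sa : s <= a by have := argmin_le u hms; rewrite -aE -sE lee_fin.
have hg := gap_half hc sc sa.
apply: (@final_le C _ a s r e) => //.
- apply: (le_trans (hC _ _ (M0_Sobolev Mu) (M0_Sobolev hms.1))); apply: lerD.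
    exact: ler_wpM2l.
  exact: (ler_wpM2l (ltW e0) (lerD (grad_energy_le_energy (esym aE))
    (grad_energy_le_energy (esym sE)))).
- by rewrite -lerBlDl.
- by rewrite -lerBlDl.
- exact: ltW.
- by rewrite /e divfK// gt_eqF.
Qed.

(** Good times [s] just before [t] give differences that approximate [W] in L^2 with gradient energy
    at most [r], and [Sobolev0_closure] retains this bound in the limit. *)
Lemma dense_flow_gradient (ms mu0 : Rn -> R) (c : R -> Rn -> R) (A : set R) (C T r : R) :
  0 <= C -> (forall u, Sobolev0 Om p u -> Lp_energy Om p u <= C * grad_energy Om p u) ->
  is_gradient_flow Om E mu0 c -> Lp Om 2 ms -> M0 ms ->
  {ae @lebesgue_measure R, forall t : R, 0 < t -> A t} -> 0 <= T ->
  (forall t, A t -> T <= t ->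
     M0 (c t) /\ grad_energy Om p (fun x => 1 * c t x + -1 * ms x) <= r) ->
  forall t, T < t -> let W := fun x => 1 * c t x + -1 * ms x in
  [/\ Sobolev Om p W, grad_energy Om p W <= r & Lp_energy Om p W <= C * r].
Proof.
move=> C0 hC [Lc acc _ _] Lms Mms aeA T0 hA t Tt W.
have t0 : 0 < t by exact: le_lt_trans Tt.
have L x : 0 <= x -> Lp Om 2 (fun y => 1 * c x y + -1 * ms y).
  by move=> x0; exact: (Lp_lin mOm 1 (-1) one2 (Lc x x0) Lms).1.
apply: Sobolev0_closure => //; first by apply: L; exact: ltW.
(* An L^2 distance below 1 dominates its square, so a distance below [e'] gives an L^2 energy at
   most [e]. *)
move=> e e0; pose e' := Num.min 1 e.
have e'0 : 0 < e' by rewrite lt_min ltr01.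
have [d d0 hd] := abs_continuousL2_dist mOm Lc (acc t t0) e'0.
have [s [s1 s2 As]] : exists s, [/\ Num.max T (t - d) < s, s < t & 0 < s -> A s].
  by apply: ae_dense => //; rewrite gt_max Tt gtrBl.
move: s1; rewrite gt_max => /andP[Ts ds].
have s0 := le_lt_trans T0 Ts.
have [Ms gs] := hA s (As s0) (ltW Ts).
have S0s := Ms.1; have S0ms := Mms.1.
exists (fun x => 1 * c s x + -1 * ms x); split;
  [exact: (Sobolev0_lin oOm p1 1 (-1) S0s S0ms)|by apply: L; exact: ltW|exact: gs|].
rewrite (_ : (fun x => _) = (c t : Rn -> R^o) - c s); last first.
  apply/funext => x; rewrite /W -[RHS]/(c t x - c s x).
  by move: (c t x) (c s x) (ms x) => *; ring.
have Ld : Lp Om 2 ((c t : Rn -> R^o) - c s).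
  have := Lp2_lin mOm 1 (-1) (Lc t (ltW t0)) (Lc s (ltW s0)).
  by rewrite scale1r scaleN1r.
have := hd [:: (s, t)]; rewrite !big_seq1 /= => /(_ _ _ _)h.
have {h}h : @dot_norm R (Rn -> R^o) (dotL2 Om) (c t - c s) < e'.
  apply: h => //.
  - by move=> x; rewrite inE => /eqP -> /=; split => //; exact: ltW.
  - by lra.
rewrite Lp_energy2 -[leLHS]sqr_sqrtr ?dotL2_ge0//.
move: h; rewrite lt_min => /andP[h1 h2]; apply: le_trans (ltW h2).
by rewrite expr2 ler_piMl ?sqrtr_ge0// ltW.
Qed.

End minimizing_flow.

Unset Implicit Arguments.
Set Strict Implicit.

Theorem theorem5p2 (R : realType) (n : nat) (f : 'rV[R]_n -> R)
    (Om : set 'rV[R]_n) (p lam delta : R) (mustar mu0 : 'rV[R]_n -> R)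
    (mu : R -> 'rV[R]_n -> R)
    (n_gt0 : (0 < n)%N)
    (f_Linfty : f \in Lfun (@lebesgue_rV R n) +oo%E)
    (f_supp : compact (ess_support f))
    (f_mean : (\int[@lebesgue_rV R n]_x f x = 0)%R)
    (Om_dom : convex_bounded_domain Om)
    (Om_supp : conv_hull (ess_support f) `<=` Om)
    (p_gtn : n%:R < p) (lam_gt0 : 0 < lam) (delta_gt0 : 0 < delta)
    (mustar_min : is_argmin (M0 Om p) (energy Om p f lam delta) mustar)
    (mu0_M0 : M0 Om p mu0)
    (mu_flow : is_gradient_flow Om (energy Om p f lam delta) mu0 mu) :
  Sobolev_norm Om p (mu t \- mustar) @[t --> +oo] --> 0%E.
Proof.
have [oOm _ _ _ bOm] := Om_dom.
have p1 : 1 < p by apply: le_lt_trans p_gtn; rewrite ler1n.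
have p1' := ltW p1.
pose E := energy Om p f lam delta.
have Lms : Lp Om 2 mustar := Sobolev0_Lp2 oOm bOm n_gt0 p_gtn mustar_min.1.1.
have [A [aeA Aoo hA]] := gradient_flow_energy (open_rV_measurable oOm) mu_flow Lms
  (energy_fin_num oOm p1 (f := f)) (fun u => argmin_le u mustar_min).
have Efin : E mustar \is a fin_num.
  have [s [s0 _ As]] := ae_dense aeA (@ltr01 R).
  apply: (energy_fin_num oOm p1); apply: le_lt_trans (argmin_le (mu s) mustar_min) _.
  exact: (Aoo s (As s0)).2.
have [C C0 hC] := poincare oOm p1 (Ordinal n_gt0) bOm.
have C1 : 0 < C + 1 by rewrite ltr_wpDl.
have close (e : R) : 0 < e -> exists2 T : R, 0 <= T & forall t, T < t ->
    exists2 a : R, 0 <= a <= e & Sobolev_norm Om p (mu t \- mustar)%R = a%:E.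
  (* The Lp energy is at most C r and the gradient energy at most r, which add up to e^p. *)
  move=> e0; pose r := e `^ p / (C + 1).
  have r0 : 0 < r by rewrite divr_gt0// powR_gt0.
  have [eta eta0 heta] := energy_gap_gradient oOm p1 lam_gt0 delta_gt0 mustar_min Efin r0.
  have [T T0 hT] := hA eta eta0.
  exists T => // t Tt.
  have [S g l] := dense_flow_gradient oOm p1 C0 hC mu_flow Lms mustar_min.1 aeA T0
    (fun s As Ts => heta (mu s) (hT s As Ts)) Tt.
  have -> : (mu t \- mustar)%R = (fun x => 1 * mu t x + -1 * mustar x).
    by apply/funext => x; rewrite mul1r mulN1r.
  rewrite (Sobolev_normE oOm p1' S).
  have : Lp_energy Om p (fun x => 1 * mu t x + -1 * mustar x) +
      grad_energy Om p (fun x => 1 * mu t x + -1 * mustar x) <= e `^ p.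
    apply: (le_trans (lerD l g)); rewrite -{2}[r]mul1r -mulrDl /r.
    by rewrite mulrC divfK// gt_eqF.
  have := addr_ge0 (Lp_energy_ge0 Om p (fun x => 1 * mu t x + -1 * mustar x))
    (grad_energy_ge0 Om p (fun x => 1 * mu t x + -1 * mustar x)).
  move: (_ + _) => y y0 ye; exists (y `^ p^-1) => //.
  rewrite powR_ge0/=; have pn0 : p != 0 by rewrite gt_eqF// (lt_trans ltr01).
  rewrite -[leRHS](powRK (ltW e0) pn0); apply: ge0_ler_powR => //.
  - by rewrite invr_ge0 (le_trans _ p1').
  - by rewrite nnegrE powR_ge0.
apply/fine_cvgP; split.
  have [T T0 hT] := close 1 ltr01.
  exists T; split; first exact: num_real.
  by move=> t Tt; have [a _ ->] := hT t Tt.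
apply/cvgrPdist_le => e e0; have [T T0 hT] := close e e0.
exists T; split; first exact: num_real.
move=> t Tt /=; have [a /andP[a0 ae] ->] := hT t Tt.
by rewrite sub0r normrN ger0_norm.
Qed.
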